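(* Let $\rho_u>0$, $\mu_1,\dots,\mu_m>0$, and let $\{X_K\}_{K\ge1}$ be a sequence of finite-dimensional subspaces of $H^1_0(\Omega)$ such that for every $\psi\in H^1_0(\Omega)$ there are $\psi_K\in X_K$ with $\|\psi-\psi_K\|_{H^1_0(\Omega)}\to0$ as $K\to\infty$. Let $$S_{uF}=\{u\in L_2(0,t_F)^m:\ \text{for all } i=1,\dots,m,\ -\mu_i\le u_i(t)\le\mu_i\ \text{for a.e. } t\in[0,t_F]\}.$$ With $\mathcal{T}_\theta$, $\mathcal{T}_\theta^K$ and $\theta_{ro}$ as in the context, put $$\mathcal{J}(u)=\|\mathcal{T}_\theta[u]-\theta_{ro}\|^2_{L_2(\Omega)}+\rho_u\|u\|^2_{L_2(0,t_F)^m},\qquad \mathcal{J}_K(u)=\|\mathcal{T}_\theta^K[u]-\theta_{ro}\|^2_{L_2(\Omega)}+\rho_u\|u\|^2_{L_2(0,t_F)^m},$$ and let $u_c$ be the unique minimizer of $\mathcal{J}$ over $S_{uF}$. Then: (a) For every positive integer $K$ there exists $u_c^K\in S_{uF}$ such that $\mathcal{J}_K(u_c^K)<\mathcal{J}_K(u)$ for all $u\in S_{uF}$ with $u\ne u_c^K$. (b) $u_c^K\to u_c$ in $L_2(0,t_F)^m$ as $K\to\infty$.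
   Context: $\Omega\subset\mathbb{R}^d$ is a bounded, open, connected set, $t_F>0$, $m$ is a positive integer, $\langle\cdot,\cdot\rangle$ is the inner product of $L_2(\Omega)$. Coefficients $a^{ij}=a^{ji},b^i,c\in L_\infty(\Omega)$ are given and $$\mathbf{B}[u,v]=\int_\Omega\Big\{\sum_{i,j=1}^d a^{ij}u_{x_i}v_{x_j}+\sum_{i=1}^d b^iu_{x_i}v+cuv\Big\}dx,\qquad u,v\in H^1_0(\Omega).$$ $\mathbf{B}$ satisfies Gårding's inequality: there are $\kappa\ge0$, $\kappa_0>0$ with $\mathbf{B}[\phi,\phi]+\kappa\|\phi\|^2_{L_2(\Omega)}\ge\kappa_0\|\phi\|^2_{H^1_0(\Omega)}$ for all $\phi\in H^1_0(\Omega)$. The operator $A$ on $L_2(\Omega)$ is defined by $\langle -A[\phi],\psi\rangle=\mathbf{B}[\phi,\psi]$ for all $\psi\in H^1_0(\Omega)$, with $\operatorname{dom}(A)$ the set of $\phi\in H^1_0(\Omega)$ for which $\mathbf{B}[\phi,\cdot]$ is represented by an element of $L_2(\Omega)$; $A$ generates a $C_0$-semigroup $S_A(t)$ on $L_2(\Omega)$. For $f\in L_2(\Omega\times(0,t_F))$ and $g\in L_2(\Omega)$, $\underline\theta(t;f,g)=S_A(t)[g]+\int_0^tS_A(t-\tau)[f(\cdot,\tau)]d\tau$. Data: $\beta_{S1},\dots,\beta_{Sm}\in L_2(\Omega)$, $f_S\in L_2(\Omega\times(0,t_F))$, $g,\theta_r\in L_2(\Omega)$; $\theta_{ro}=\theta_r-\underline\theta(t_F;f_S,g)\in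 L_2(\Omega)$. The control-to-final-state operator $\mathcal{T}_\theta:L_2(0,t_F)^m\to L_2(\Omega)$ is $$\mathcal{T}_\theta[u]=\int_0^{t_F}S_A(t_F-\tau)\Big[\sum_{i=1}^m\beta_{Si}u_i(\tau)\Big]d\tau .$$ Finite-dimensional objects: $\mathcal{A}_K:X_K\to X_K$ is the linear operator with $\langle\mathcal{A}_K[\phi],\psi\rangle=-\mathbf{B}[\phi,\psi]$ for all $\phi,\psi\in X_K$; $S_K(t)=\sum_{\ell\ge0}\mathcal{A}_K^\ell t^\ell/\ell!$; $P_K$ is the orthogonal projection of $L_2(\Omega)$ onto $X_K$; and $$\mathcal{T}_\theta^K[u]=\int_0^{t_F}S_K(t_F-\tau)\Big[P_K\Big[\sum_{i=1}^m\beta_{Si}u_i(\tau)\Big]\Big]d\tau .$$ *)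

(* Defs.v *)
From HB Require Import structures.
From mathcomp Require Import all_boot all_order all_algebra.
From mathcomp Require Import all_classical all_reals all_analysis.
From mathcomp Require Import measurable_realfun.

Set Implicit Arguments.
Unset Strict Implicit.
Unset Printing Implicit Defensive.
Import Order.TTheory GRing.Theory Num.Theory.
Import numFieldNormedType.Exports.

Local Open Scope classical_set_scope.
Local Open Scope ring_scope.

Section L2_space.
Context d (T : measurableType d) (R : realType).
Variable mu : {measure set T -> \bar R}.

Definition L2 : Type := LspaceType2 mu.

HB.instance Definition _ := gen_eqMixin L2.
HB.instance Definition _ := gen_choiceMixin L2.

Definition L2fun (x : L2) : T -> R := (x : LspaceType2 mu).
Coercion L2fun : L2 >-> Funclass.

Let meas_sq (f : T -> R) : measurable_fun setT f ->
  measurable_fun setT (fun x => (`|(EFin \o f) x| `^ 2)%E).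
Proof.
move=> mf; rewrite (_ : (fun _ => _) = EFin \o (fun x => `|f x| `^ 2))//.
apply/measurable_EFinP; apply: (measurableT_comp (measurable_powR _)).
exact: measurableT_comp.
Qed.

Lemma ae_eq_Lnorm2 (f g : T -> R) : measurable_fun setT f ->
  measurable_fun setT g -> f = g %[ae mu] ->
  ('N[mu]_2%:E[EFin \o f] = 'N[mu]_2%:E[EFin \o g])%E.
Proof.
move=> mf mg fg; rewrite unlock; congr (_ `^ _)%E.
apply: ae_eq_integral => //=; [exact: meas_sq|exact: meas_sq|].
by apply: filterS fg => x /(_ I) + _ => /= ->.
Qed.

Local Open Scope quotient_scope.

Section of_Lfun.
Variables (f : T -> R) (fP : f \in Lfun mu 2%:E).

Let mf : measurable_fun [set: T] (f : T -> measurableTypeR R).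
Proof. by have /andP[] := fP; rewrite !inE/=. Qed.

Let mfun_of : {mfun T >-> measurableTypeR R} :=
  HB.pack_for {mfun T >-> measurableTypeR R} (f : T -> measurableTypeR R)
    (@isMeasurableFun.Build _ _ T (measurableTypeR R) f mf).

Let cls : {mfun_ mu, T >-> measurableTypeR R} := \pi mfun_of.

Let cls_ae : (cls : T -> R) = f %[ae mu].
Proof.
have : repr cls == mfun_of %[mod {mfun_ mu, T >-> measurableTypeR R}].
  by rewrite reprK.
by rewrite eqmodE => /asboolP.
Qed.

Let cls_finite : finite_norm mu 2%:E cls.
Proof.
have /andP[] := fP; rewrite !inE/= => _ ff.
rewrite /finite_norm (@ae_eq_Lnorm2 cls f)//.
exact: (measurable_funPT (repr cls)).
Qed.

HB.instance Definition _ :=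
  @isFinLebesgue.Build d T R mu 2%:E (lee1n 2) cls cls_finite.

Definition L2_of_Lfun : L2 := (cls : LspaceType mu (lee1n 2)).

Lemma L2_of_LfunE : (L2_of_Lfun : T -> R) = f %[ae mu].
Proof. exact: cls_ae. Qed.

End of_Lfun.

(* The class of f when f is measurable and square integrable, and 0
   otherwise. *)
Definition toL2 (f : T -> R) : L2 :=
  match pselect (f \in Lfun mu 2%:E) with
  | left fP => L2_of_Lfun fP
  | right _ => L2_of_Lfun (LfunP (0 : LfunType mu (lee1n 2)))
  end.

Lemma L2_Lfun (x : L2) : (x : T -> R) \in Lfun mu 2%:E.
Proof.
apply/andP; split; rewrite inE/=; last exact: Lebesgue_finite.
exact: (measurable_funPT
  (repr ((x : LspaceType2 mu) : {mfun_ mu, T >-> measurableTypeR R}))).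
Qed.

Lemma toL2E (f : T -> R) : f \in Lfun mu 2%:E ->
  (toL2 f : T -> R) = f %[ae mu].
Proof. by rewrite /toL2; case: pselect => // fP _; exact: L2_of_LfunE. Qed.

Lemma L2_eqP (x y : L2) : (x : T -> R) = y %[ae mu] -> x = y.
Proof.
case: x y => [x cx] [y cy] xy.
have exy : x = y.
  apply/eqP; rewrite -[x]reprK -[y]reprK eqmodE.
  exact/asboolP.
case: _ / exy cy {xy} => cy; congr LebesgueSpace.Pack.
case: cx cy => [[cx]] [[cy]]; congr (LebesgueSpace.Class _).
by congr isFinLebesgue.Axioms_; exact: bool_irrelevance.
Qed.

Definition L2zero : L2 := toL2 (fun=> 0).
Definition L2add (x y : L2) : L2 := toL2 (fun t => x t + y t).
Definition L2opp (x : L2) : L2 := toL2 (fun t => - x t).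
Definition L2scale (a : R) (x : L2) : L2 := toL2 (fun t => a * x t).

Lemma L2zeroE : (L2zero : T -> R) = (fun=> 0) %[ae mu].
Proof. by apply: toL2E; exact: (LfunP (0 : LfunType mu (lee1n 2))). Qed.

Lemma L2addE (x y : L2) : (L2add x y : T -> R) = (fun t => x t + y t) %[ae mu].
Proof. by apply: toL2E; exact: ((Lfun_addr_closed mu (lee1n 2)).2 _ _ (L2_Lfun x) (L2_Lfun y)). Qed.

Lemma L2scaleE a (x : L2) :
  (L2scale a x : T -> R) = (fun t => a * x t) %[ae mu].
Proof.
apply: toL2E; have [Lf0 LfZ] := Lfun_submod_closed mu (lee1n 2).
by have := LfZ a _ _ (L2_Lfun x) Lf0; rewrite addr0.
Qed.

Lemma L2oppE (x : L2) : (L2opp x : T -> R) = (fun t => - x t) %[ae mu].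
Proof.
have -> : L2opp x = L2scale (-1) x.
  by congr toL2; apply/funext => t; rewrite mulN1r.
by have := L2scaleE (-1) x; apply: filterS => t /(_ I) -> _; rewrite mulN1r.
Qed.

Let L2addA : associative L2add.
Proof.
move=> x y z; apply: L2_eqP.
apply: filterS (filterI (filterI (L2addE x (L2add y z)) (L2addE y z))
  (filterI (L2addE (L2add x y) z) (L2addE x y))).
move=> t [[/(_ I) h4 /(_ I) h3] [/(_ I) h2 /(_ I) h1]] _.
by rewrite h4 h3 h2 h1 addrA.
Qed.

Let L2addC : commutative L2add.
Proof. by move=> x y; congr toL2; apply/funext => t; rewrite addrC. Qed.

Let L2add0 : left_id L2zero L2add.
Proof.
move=> x; apply: L2_eqP.
have := L2addE L2zero x; have := L2zeroE.
apply: filterS2 => t /(_ I) h1 /(_ I) h2 _.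
by rewrite h2 h1 add0r.
Qed.

Let L2addN : left_inverse L2zero L2opp L2add.
Proof.
move=> x; apply: L2_eqP.
have := L2addE (L2opp x) x; have := L2oppE x; have := L2zeroE.
apply: filterS3 => t /(_ I) h1 /(_ I) h2 /(_ I) h3 _.
by rewrite h1 h3 h2 addNr.
Qed.

HB.instance Definition _ := GRing.isZmodule.Build L2 L2addA L2addC L2add0 L2addN.

Let L2scaleA a b x : L2scale a (L2scale b x) = L2scale (a * b) x.
Proof.
apply: L2_eqP.
have := L2scaleE a (L2scale b x); have := L2scaleE b x.
have := L2scaleE (a * b) x.
apply: filterS3 => t /(_ I) h1 /(_ I) h2 /(_ I) h3 _.
by rewrite h1 h3 h2 mulrA.
Qed.

Let L2scale1 : left_id 1 L2scale.
Proof.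
move=> x; apply: L2_eqP; have := L2scaleE 1 x.
by apply: filterS => t /(_ I) h1 _; rewrite h1 mul1r.
Qed.

Let L2scaleDr : right_distributive L2scale +%R.
Proof.
move=> a x y; apply: L2_eqP.
apply: filterS (filterI (filterI (L2scaleE a (L2add x y)) (L2addE x y))
  (filterI (L2addE (L2scale a x) (L2scale a y))
    (filterI (L2scaleE a x) (L2scaleE a y)))).
move=> t [[/(_ I) h5 /(_ I) h4] [/(_ I) h3 [/(_ I) h1 /(_ I) h2]]] _.
by rewrite h5 h4 h3 h1 h2 mulrDr.
Qed.

Let L2scaleDl x : {morph L2scale^~ x : a b / a + b}.
Proof.
move=> a b; apply: L2_eqP.
apply: filterS (filterI (filterI (L2scaleE (a + b) x)
    (L2addE (L2scale a x) (L2scale b x)))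
  (filterI (L2scaleE a x) (L2scaleE b x))).
move=> t [[/(_ I) h4 /(_ I) h1] [/(_ I) h3 /(_ I) h2]] _.
by rewrite h1 h2 h3 h4 mulrDl.
Qed.

HB.instance Definition _ := GRing.Zmodule_isLmodule.Build R L2
  L2scaleA L2scale1 L2scaleDr L2scaleDl.

Definition L2norm (x : L2) : R := fine 'N[mu]_2%:E[EFin \o x].

Let L2_Lf (x : L2) : LfunType mu (lee1n 2) := Lfun_Sub (lee1n 2) (L2_Lfun x).

Let L2norm_ae (x : L2) (f : T -> R) : measurable_fun setT f ->
  (x : T -> R) = f %[ae mu] -> L2norm x = fine 'N[mu]_2%:E[EFin \o f].
Proof.
move=> mf xf; rewrite /L2norm (ae_eq_Lnorm2 _ mf xf)//.
by have /andP[] := L2_Lfun x; rewrite !inE.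
Qed.

Let L2_measurable (x : L2) : measurable_fun setT (x : T -> R).
Proof. by have /andP[] := L2_Lfun x; rewrite !inE. Qed.

Let ler_L2normD x y : L2norm (x + y) <= L2norm x + L2norm y.
Proof.
rewrite (L2norm_ae _ (L2addE x y)).
  exact: (ler_LnormD (L2_Lf x) (L2_Lf y)).
exact: measurable_funD.
Qed.

Let L2normZ a x : L2norm (a *: x) = `|a| * L2norm x.
Proof.
rewrite (L2norm_ae _ (L2scaleE a x)); last exact: measurable_funM.
apply/EFin_inj; rewrite EFinM.
have := LnormZ (L2_Lf x) a.
have := finite_norm_fine (L2_Lf x) => <- h.
have := finite_norm_fine (a *: L2_Lf x).
by rewrite h.
Qed.

Let L2norm0_eq0 x : L2norm x = 0 -> x = 0.
Proof.
move=> x0; apply: L2_eqP.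
have := fine_Lnormr_eq0 (x0 : fine 'N[mu]_2%:E[EFin \o L2_Lf x] = 0).
have := L2zeroE.
by apply: filterS2 => t /(_ I) h1 /(_ I) h2 _; rewrite h1; exact: h2.
Qed.

HB.instance Definition _ := @Lmodule_isNormed.Build R L2
  L2norm ler_L2normD L2normZ L2norm0_eq0.

Definition L2dot (x y : L2) : R := \int[mu]_t (x t * y t).

End L2_space.

Section lebesgue_tuple.
Variable R : realType.
Notation mR := (measurableTypeR R).

Definition tcons n (p : mR * n.-tuple mR) : n.+1.-tuple mR :=
  [tuple of p.1 :: p.2].

Lemma measurable_tcons n : measurable_fun setT (@tcons n).
Proof. exact: (measurable_cons measurable_fst measurable_snd). Qed.

Section step.
Variables (n : nat) (mu : {sigma_finite_measure set (n.-tuple mR) -> \bar R}).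

Definition lebesgue_tupleS :=
  pushforward (@lebesgue_measure R \x mu)%E (@tcons n).

Let nu0 : lebesgue_tupleS set0 = 0%E.
Proof. by rewrite /lebesgue_tupleS /pushforward preimage_set0 measure0. Qed.

Let nu_ge0 A : (0 <= lebesgue_tupleS A)%E.
Proof. exact: (measure_ge0 (@lebesgue_measure R \x mu)%E). Qed.

Let nu_add : semi_sigma_additive lebesgue_tupleS.
Proof.
move=> F mF tF mUF; rewrite /lebesgue_tupleS /pushforward preimage_bigcup.
apply: measure_semi_sigma_additive.
- by move=> k; rewrite -[X in measurable X]setTI; exact: measurable_tcons.
- apply/trivIsetP => /= i j _ _ ij; rewrite -preimage_setI.
  by move/trivIsetP : tF => /(_ _ _ _ _ ij) ->//; rewrite preimage_set0.
- rewrite -preimage_bigcup -[X in measurable X]setTI.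
  exact: measurable_tcons.
Qed.

HB.instance Definition _ :=
  isMeasure.Build _ _ _ lebesgue_tupleS nu0 nu_ge0 nu_add.

Let nu_sfin : sigma_finite setT lebesgue_tupleS.
Proof.
have /sigma_finiteP[A [TA ndA Aoo]] := sigma_finiteT (@lebesgue_measure R).
have /sigma_finiteP[B [TB ndB Boo]] := sigma_finiteT mu.
pose F k := A k `*` B k.
have FT : setT = \bigcup_k F k.
  rewrite -setXTT TA TB predeqE => -[x y]; split.
    move=> [/= [k _ Akx] [l _ Bly]]; exists (maxn k l) => //; split.
    - by move: x Akx; exact/subsetPset/ndA/leq_maxl.
    - by move: y Bly; exact/subsetPset/ndB/leq_maxr.
  by move=> [k _ []/= ? ?]; split; exists k.
have mF k : measurable (F k) /\ ((@lebesgue_measure R \x mu)%E (F k) < +oo)%E.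
  have [? ?] := Aoo k; have [? ?] := Boo k; split; first exact: measurableX.
  by rewrite product_measure1E// lte_mul_pinfty// ge0_fin_numE.
pose g (t : n.+1.-tuple mR) : mR * n.-tuple mR :=
  (tnth t ord0, [tuple of behead t]).
have mg : measurable_fun setT g.
  apply/measurable_fun_pair; [exact: measurable_tnth|exact: measurable_behead].
have gK : cancel (@tcons n) g.
  by case=> a t; rewrite /g /tcons; congr pair; exact/val_inj.
exists (fun k => g @^-1` F k).
  by rewrite -preimage_bigcup -FT preimage_setT.
move=> k; split.
  by rewrite -[X in measurable X]setTI; apply: mg => //; exact: (mF k).1.
rewrite /lebesgue_tupleS /pushforward -comp_preimage (_ : g \o _ = id).
  exact: (mF k).2.
exact/funext.
Qed.

HB.instance Definition _ :=
  Measure_isSigmaFinite.Build _ _ _ lebesgue_tupleS nu_sfin.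

End step.

(* Lebesgue measure on R^n as the n-fold product of the one on R. *)
Fixpoint lebesgue_tuple n : {sigma_finite_measure set (n.-tuple mR) -> \bar R} :=
  match n with
  | 0 => \d_[tuple]
  | n'.+1 => lebesgue_tupleS (lebesgue_tuple n')
  end.

End lebesgue_tuple.

Section lebesgue_rV.
Variables (R : realType) (d : nat).
Notation mR := (measurableTypeR R).

Definition Rd : Type := g_sigma_algebraType (@open 'rV[R]_d).
HB.instance Definition _ := Measurable.on Rd.

Definition rV_of_tuple (t : d.-tuple mR) : Rd := \row_(i < d) tnth t i.

Let box (p : 'rV[rat]_d * nat) : set 'rV[R]_d :=
  [set x | forall i, `|x 0 i - ratr (p.1 0 i)| < p.2.+1%:R^-1].

Let open_boxes (U : set 'rV[R]_d) : open U ->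
  U = \bigcup_p (if `[< box p `<=` U >] then box p else set0).
Proof.
move=> oU; apply/seteqP; split => [x Ux|x [p _]]; last first.
  by case: asboolP => // + bx; exact.
have [e /= e0 xeU] : exists2 e : R, 0 < e & ball x e `<=` U.
  have [e e0 xeU] := (nbhs_ballP x U).1 (open_nbhs_nbhs (conj oU Ux)).
  by exists e.
have [n] : exists n, 0 + n.+1%:R^-1 < e / 2 by apply/ltr_add_invr/divr_gt0.
rewrite add0r => ne.
have qE i : exists q : rat, `|x 0 i - ratr q| < n.+1%:R^-1.
  have [|q] := @rat_in_itvoo R (x 0 i) (x 0 i + n.+1%:R^-1).
    by rewrite ltrDl invr_gt0.
  rewrite in_itv/= => /andP[xq qx]; exists q.
  by rewrite distrC ger0_norm ?subr_ge0 ?(ltW xq)// ltrBlDl.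
pose q := \row_i sval (cid (qE i)).
have xq : box (q, n) x by move=> i; rewrite mxE; exact: svalP (cid (qE i)).
exists (q, n) => //; case: asboolP => // -[] y /= yq; apply: xeU; split => // i j.
rewrite (ord1 i) /ball/= (splitr e).
rewrite (le_lt_trans (ler_distD (ratr (q 0 j)) _ _))// ltrD//.
  by rewrite (lt_trans (xq j)).
by rewrite distrC (lt_trans (yq j)).
Qed.

Lemma measurable_rV_of_tuple : measurable_fun setT rV_of_tuple.
Proof.
have RdE : @measurable _ Rd = <<s (@open 'rV[R]_d : set (set Rd)) >> by [].
refine (@measurability _ _ _ _ _ _ _ RdE _).
move=> _ [U oU <-]; rewrite setTI (open_boxes oU) preimage_bigcup.
apply: countable_bigcupT_measurable => [|p]; first exact: countableP.
case: asboolP => _; last by rewrite preimage_set0.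
have -> : rV_of_tuple @^-1` box p = \bigcap_(i in [set: 'I_d])
    ((@tnth d mR)^~ i @^-1` [set y | `|y - ratr (p.1 0 i)| < p.2.+1%:R^-1]).
  apply/seteqP; split => [t /= bt i _|t bt i] /=.
    by have := bt i; rewrite mxE.
  by rewrite mxE; exact: bt.
apply: fin_bigcap_measurable => [|i _].
  exact: finite_finset.
rewrite -[X in measurable X]setTI; apply: measurable_tnth => //.
rewrite (_ : mkset _ = ball (ratr (p.1 0 i) : R) p.2.+1%:R^-1).
  exact: measurable_ball.
by apply/seteqP; split => y; rewrite /ball/= distrC.
Qed.

(* Lebesgue measure on the Borel sets of R^d. *)
Definition lebesgue_Rd : set Rd -> \bar R :=
  pushforward (lebesgue_tuple R d) rV_of_tuple.

Let lebesgue_Rd0 : lebesgue_Rd set0 = 0%E.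
Proof. by rewrite /lebesgue_Rd /pushforward preimage_set0 measure0. Qed.

Let lebesgue_Rd_ge0 A : (0 <= lebesgue_Rd A)%E.
Proof. exact: (measure_ge0 (lebesgue_tuple R d)). Qed.

Let lebesgue_Rd_add : semi_sigma_additive lebesgue_Rd.
Proof.
move=> F mF tF mUF; rewrite /lebesgue_Rd /pushforward preimage_bigcup.
apply: measure_semi_sigma_additive.
- by move=> k; rewrite -[X in measurable X]setTI; exact: measurable_rV_of_tuple.
- apply/trivIsetP => /= i j _ _ ij; rewrite -preimage_setI.
  by move/trivIsetP : tF => /(_ _ _ _ _ ij) ->//; rewrite preimage_set0.
- rewrite -preimage_bigcup -[X in measurable X]setTI.
  exact: measurable_rV_of_tuple.
Qed.

HB.instance Definition _ := isMeasure.Build _ _ _ lebesgue_Rd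
  lebesgue_Rd0 lebesgue_Rd_ge0 lebesgue_Rd_add.

Lemma open_measurable_Rd (Omega : set 'rV[R]_d) :
  open Omega -> measurable (Omega : set Rd).
Proof. by move=> oOmega; exact: sub_sigma_algebra. Qed.

End lebesgue_rV.

Section bochner.
Variables (R : realType) (V : normedModType R).
Notation mR := (measurableTypeR R).
Notation lambda := (@lebesgue_measure R).

Record simple_fun := SimpleFun {
  simple_size : nat ;
  simple_set : 'I_simple_size -> set mR ;
  simple_val : 'I_simple_size -> V }.
Arguments simple_set : clear implicits.
Arguments simple_val : clear implicits.

Definition simple_eval (s : simple_fun) (t : R) : V :=
  \sum_i \1_(simple_set s i) t *: simple_val s i.

Definition simple_integrable (D : set mR) (s : simple_fun) : Prop :=
  forall i, measurable (simple_set s i) /\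
    (lambda (simple_set s i `&` D) < +oo)%E.

Definition simple_integral (D : set mR) (s : simple_fun) : V :=
  \sum_i fine (lambda (simple_set s i `&` D)) *: simple_val s i.

(* z is the limit of the integrals of integrable simple functions that
   approximate F in the L1 sense. *)
Definition is_bochner (D : set mR) (F : R -> V) (z : V) : Prop :=
  exists s : nat -> simple_fun,
  [/\ forall n, simple_integrable D (s n),
      forall n, lambda.-integrable D (fun t => `|F t - simple_eval (s n) t|%:E),
      (\int[lambda]_(t in D) `|F t - simple_eval (s n) t|%:E)%E
        @[n --> \oo] --> 0%E
    & simple_integral D (s n) @[n --> \oo] --> z].

(* 0 when F is not Bochner integrable on D. *)
Definition bochner (D : set mR) (F : R -> V) : V := xget 0 (is_bochner D F).

End bochner.

Section semigroup.
Variables (R : realType) (V : normedModType R).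

Definition C0_semigroup (S : R -> V -> V) : Prop :=
  [/\ forall t, 0 <= t -> linear (S t) /\ continuous (S t),
      forall x, S 0 x = x,
      forall s t, 0 <= s -> 0 <= t -> forall x, S (s + t) x = S s (S t x)
    & forall x, S t x @[t --> 0^'+] --> x].

(* Operators with a domain are represented by their graphs: generator S x y
   says that x is in the domain and is mapped to y. *)
Definition generator (S : R -> V -> V) (x y : V) : Prop :=
  t^-1 *: (S t x - x) @[t --> 0^'+] --> y.

Definition generates (A : V -> V -> Prop) (S : R -> V -> V) : Prop :=
  C0_semigroup S /\ forall x y, A x y <-> generator S x y.

Definition findim_subspace (X : set V) : Prop :=
  exists n (e : 'I_n -> V),
    X = [set v | exists k : 'I_n -> R, v = \sum_i k i *: e i].

End semigroup.

Section test_functions.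
Variables (R : realType) (d : nat).

Definition partial (i : 'I_d) (f : 'rV[R]_d -> R) : 'rV[R]_d -> R :=
  fun x => 'D_(delta_mx 0 i) f x.

Definition iter_partial (s : seq 'I_d) (f : 'rV[R]_d -> R) : 'rV[R]_d -> R :=
  foldr partial f s.

(* Partial derivatives of all orders exist and are continuous. *)
Definition smooth (f : 'rV[R]_d -> R) : Prop := forall s : seq 'I_d,
  continuous (iter_partial s f) /\
  forall i x, derivable (iter_partial s f) x (delta_mx 0 i).

Definition test_function (Omega : set 'rV[R]_d) (f : 'rV[R]_d -> R) : Prop :=
  let supp := closure [set x | f x != 0] in
  [/\ smooth f, compact supp & supp `<=` Omega].

End test_functions.

Section elliptic.
Variables (R : realType) (d : nat) (Omega : set 'rV[R]_d) (oOmega : open Omega).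

Definition lebesgue_on : {measure set (Rd R d) -> \bar R} :=
  mrestr (@lebesgue_Rd R d) (open_measurable_Rd oOmega).

Definition Linfty : Type := LspaceType lebesgue_on (leey 1).
Definition Linfty_fun (f : Linfty) : 'rV[R]_d -> R :=
  (f : LspaceType lebesgue_on (leey 1)).
Coercion Linfty_fun : Linfty >-> Funclass.

Definition is_weak_partial (i : 'I_d) (u v : L2 lebesgue_on) : Prop :=
  forall eta, test_function Omega eta ->
    \int[lebesgue_on]_x (u x * partial i eta x) =
    - \int[lebesgue_on]_x (v x * eta x).

(* The weak derivative is unique when it exists; this is 0 when it does not. *)
Definition weak_partial (i : 'I_d) (u : L2 lebesgue_on) : L2 lebesgue_on :=
  xget 0 (is_weak_partial i u).

Definition H1 : set (L2 lebesgue_on) :=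
  [set u | forall i, exists v, is_weak_partial i u v].

Definition H1norm (u : L2 lebesgue_on) : R :=
  Num.sqrt (`|u| ^+ 2 + \sum_i `|weak_partial i u| ^+ 2).

(* The closure of the test functions in H1. *)
Definition H10 : set (L2 lebesgue_on) :=
  [set u | H1 u /\ exists eta : nat -> 'rV[R]_d -> R,
    [/\ forall n, test_function Omega (eta n),
        toL2 lebesgue_on (eta n) @[n --> \oo] --> u
      & forall i, toL2 lebesgue_on (partial i (eta n)) @[n --> \oo]
                    --> weak_partial i u]].

Definition elliptic_form (a : 'I_d -> 'I_d -> Linfty) (b : 'I_d -> Linfty) (c : Linfty)
    (u v : L2 lebesgue_on) : R :=
  \int[lebesgue_on]_x
    (\sum_i \sum_j a i j x * weak_partial i u x * weak_partial j v x
     + \sum_i b i x * weak_partial i u x * v x + c x * u x * v x).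

Definition garding (B : L2 lebesgue_on -> L2 lebesgue_on -> R) : Prop :=
  exists kappa kappa0 : R, [/\ 0 <= kappa, 0 < kappa0 &
    forall phi, H10 phi ->
      kappa0 * H1norm phi ^+ 2 <= B phi phi + kappa * `|phi| ^+ 2].

(* The graph of A: w represents - B[phi, .] on H10. *)
Definition opA (B : L2 lebesgue_on -> L2 lebesgue_on -> R)
    (phi w : L2 lebesgue_on) : Prop :=
  H10 phi /\ forall psi, H10 psi -> L2dot (- w) psi = B phi psi.

End elliptic.

Section galerkin.
Variables (d : measure_display) (T : measurableType d) (R : realType).
Variables (mu : {measure set T -> \bar R}) (B : L2 mu -> L2 mu -> R).
Variable X : set (L2 mu).

(* For X a finite-dimensional subspace, the element below exists and is unique
   for every phi; only the restriction of this map to X is used. *)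
Definition galerkin_op (phi : L2 mu) : L2 mu :=
  xget 0 [set w | X w /\ forall psi, X psi -> L2dot w psi = - B phi psi].

Definition galerkin_semigroup (t : R) (phi : L2 mu) : L2 mu :=
  limn (series (fun l => (t ^+ l / l`!%:R) *: iter l galerkin_op phi)).

Definition orth_proj (f : L2 mu) : L2 mu :=
  xget 0 [set w | X w /\ forall psi, X psi -> L2dot (f - w) psi = 0].

End galerkin.

Section control.
Variables (R : realType) (d : nat) (Omega : set 'rV[R]_d) (oOmega : open Omega) (tF : R).
Notation mR := (measurableTypeR R).
Notation L2O := (L2 (lebesgue_on oOmega)).

Definition lebesgue_time : {measure set mR -> \bar R} :=
  mrestr (@lebesgue_measure R) (measurable_itv `]0, tF[).

Definition lebesgue_spacetime : {measure set (Rd R d * mR) -> \bar R} :=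
  mrestr (@lebesgue_Rd R d \x @lebesgue_measure R)%E
    (measurableX (open_measurable_Rd oOmega) (measurable_itv `]0, tF[)).

(* 0 for the (null set of) times at which the slice is not in L2. *)
Definition slice (f : L2 lebesgue_spacetime) (t : R) : L2O :=
  toL2 (lebesgue_on oOmega) (fun x => f (x, t)).

Definition theta_free (S : R -> L2O -> L2O) (f : L2 lebesgue_spacetime)
    (g : L2O) (t : R) : L2O :=
  S t g + bochner `[0, t] (fun tau => S (t - tau) (slice f tau)).

Variable m : nat.

(* L_2(0, t_F)^m *)
Definition control : Type := 'I_m -> L2 lebesgue_time.

Definition control_norm (u : control) : R := Num.sqrt (\sum_i `|u i| ^+ 2).

Definition admissible (bnd : 'I_m -> R) : set control :=
  [set u | forall i, {ae @lebesgue_measure R,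
    forall t, t \in `[0, tF] -> - bnd i <= u i t <= bnd i}].

Definition source (beta : 'I_m -> L2O) (u : control) (t : R) : L2O :=
  \sum_i u i t *: beta i.

Definition Ttheta (S : R -> L2O -> L2O) (beta : 'I_m -> L2O) (u : control)
    : L2O :=
  bochner `[0, tF] (fun tau => S (tF - tau) (source beta u tau)).

Definition TthetaK (B : L2O -> L2O -> R) (XK : set L2O) (beta : 'I_m -> L2O)
    (u : control) : L2O :=
  bochner `[0, tF] (fun tau =>
    galerkin_semigroup B XK (tF - tau) (orth_proj XK (source beta u tau))).

Definition cost (T : control -> L2O) (target : L2O) (rho : R) (u : control)
    : R :=
  `|T u - target| ^+ 2 + rho * control_norm u ^+ 2.

Definition unique_minimizer (J : control -> R) (A : set control) (u : control)
    : Prop :=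
  A u /\ forall v, A v -> v <> u -> J u < J v.

End control.

(* Main.v *)
Require Import Defs.
From HB Require Import structures.
From mathcomp Require Import all_boot all_order all_algebra.
From mathcomp Require Import all_classical all_reals all_analysis.
From mathcomp Require Import measurable_realfun ess_sup_inf ring lra.
Set Implicit Arguments.
Unset Strict Implicit.
Unset Printing Implicit Defensive.
Import Order.TTheory GRing.Theory Num.Theory.
Import numFieldNormedType.Exports.

Local Open Scope classical_set_scope.
Local Open Scope ring_scope.

(* By the midpoint identity, J(u) + J(v) - 2 J((u + v)/2) is at least
   rho/2 |u - v|^2.  Hence a minimizing sequence is Cauchy, which gives (a), and
   rho/4 |u_K - u_c|^2 is bounded by the supremum of |J_K - J| over the
   admissible controls, so (b) follows once T_K -> T uniformly on them.  Pairing
   the Bochner integrals with vectors reduces that to S_K(t) P_K x -> S_A(t) x,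
   uniformly on [0, t_F], for x = beta_1, ..., beta_m.  Both semigroups being
   bounded, x may be taken in the dense set dom(A^2).  There, the difference of
   S_K(t) P_K x with the H^1_0-orthogonal projection of S_A(t) x onto X_K is
   controlled by Garding's inequality and Gronwall's lemma in terms of the
   projection errors of the orbits of x and A x, which tend to 0 uniformly
   because these orbits are compact in H^1_0. *)

(** * Inner products and finite-dimensional subspaces *)

(** Two obstacles shape the proof. [weak_partial] selects some weak derivative, and neither its
    linearity nor that of [H10] comes with the definition. The estimates are therefore run in
    [Wgrad], where the gradient [grad] is unique and linear, and differences of orbit points return
    to [H10] through the linearity of the domain of the generator. Secondly, [bochner] is 0 where no
    integral exists, so existence is proved first, for finite sums of bounded measurable scalars
    times continuous vectors. This covers admissible controls, and the operators are only ever
    compared on those. The domain of A^2 enters because the H^1_0-projection is controlled only in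
    the H^1_0 norm: differentiating the projected orbit requires the difference quotients of S_A(t)
    x to converge in H^1_0. Garding's inequality bounds the H^1_0 norm by the graph norm of A, so
    differentiability of the orbits of x and of A x in L_2 suffices. *)

Section subspace_forms.
Variables (R : realType) (H : lmodType R).

Definition lin_subspace (W : set H) :=
  W 0 /\ forall (a : R) x y, W x -> W y -> W (a *: x + y).

(** Bilinearity is relative to [W] because the forms to come are built from weak gradients, which
    are linear only where they exist. *)
Definition bilinear_on (W : set H) (f : H -> H -> R) :=
  (forall a x y z, W x -> W y -> W z -> f (a *: x + y) z = a * f x z + f y z) /\
  (forall a x y z, W x -> W y -> W z -> f z (a *: x + y) = a * f z x + f z y).

Variables (W : set H) (f : H -> H -> R).
Hypothesis sW : lin_subspace W.

Lemma lin_subspace0 : W 0. Proof. exact: sW.1. Qed.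

Lemma lin_subspaceZ a x : W x -> W (a *: x).
Proof. by move=> Wx; rewrite -[_ *: _]addr0; exact: sW.2 _ _ _ Wx sW.1. Qed.

Lemma lin_subspaceD x y : W x -> W y -> W (x + y).
Proof. by move=> Wx Wy; rewrite -[x]scale1r; exact: sW.2. Qed.

Lemma lin_subspaceB x y : W x -> W y -> W (x - y).
Proof.
by move=> Wx Wy; rewrite addrC -[- y]scaleN1r; exact: sW.2.
Qed.

Lemma lin_subspace_sum (I : Type) (r : seq I) (P : pred I) (F : I -> H) :
  (forall i, P i -> W (F i)) -> W (\sum_(i <- r | P i) F i).
Proof. by move=> WF; elim/big_ind : _ => //; [exact: sW.1|exact: lin_subspaceD]. Qed.

Hypothesis bf : bilinear_on W f.

Lemma bilDl x y z : W x -> W y -> W z -> f (x + y) z = f x z + f y z.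
Proof. by move=> *; rewrite -[x]scale1r bf.1// scale1r mul1r. Qed.

Lemma bilDr x y z : W x -> W y -> W z -> f z (x + y) = f z x + f z y.
Proof. by move=> *; rewrite -[x]scale1r bf.2// scale1r mul1r. Qed.

Lemma bil0l z : W z -> f 0 z = 0.
Proof.
move=> Wz; have := bilDl lin_subspace0 lin_subspace0 Wz.
by rewrite addr0 => /eqP; rewrite -subr_eq0 opprD addNKr oppr_eq0 => /eqP.
Qed.

Lemma bil0r z : W z -> f z 0 = 0.
Proof.
move=> Wz; have := bilDr lin_subspace0 lin_subspace0 Wz.
by rewrite addr0 => /eqP; rewrite -subr_eq0 opprD addNKr oppr_eq0 => /eqP.
Qed.

Lemma bilZl a x z : W x -> W z -> f (a *: x) z = a * f x z.
Proof. by move=> Wx Wz; rewrite -[_ *: _]addr0 bf.1 ?bil0l ?addr0//; exact: sW.1. Qed.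

Lemma bilZr a x z : W x -> W z -> f z (a *: x) = a * f z x.
Proof. by move=> Wx Wz; rewrite -[_ *: _]addr0 bf.2 ?bil0r ?addr0//; exact: sW.1. Qed.

Lemma bilBl x y z : W x -> W y -> W z -> f (x - y) z = f x z - f y z.
Proof. by move=> *; rewrite addrC -scaleN1r bf.1// mulN1r addrC. Qed.

Lemma bilBr x y z : W x -> W y -> W z -> f z (x - y) = f z x - f z y.
Proof. by move=> *; rewrite addrC -scaleN1r bf.2// mulN1r addrC. Qed.

Lemma bil_suml (I : eqType) (r : seq I) (F : I -> H) z :
  (forall i, i \in r -> W (F i)) -> W z ->
  f (\sum_(i <- r) F i) z = \sum_(i <- r) f (F i) z.
Proof.
elim: r => [|i r IH] WF Wz; first by rewrite !big_nil bil0l.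
have WF' j : j \in r -> W (F j) by move=> jr; apply: WF; rewrite inE jr orbT.
rewrite !big_cons bilDl ?IH//; first by apply: WF; rewrite mem_head.
by rewrite big_seq; exact: lin_subspace_sum.
Qed.

(** The parallelogram law, with the nonnegative term [f (x - y) (x - y)] dropped. *)
Lemma quad_triangle x y : (forall z, W z -> 0 <= f z z) -> W x -> W y ->
  f (x + y) (x + y) <= 2 * f x x + 2 * f y y.
Proof.
move=> f0 Wx Wy; have := f0 _ (lin_subspaceB Wx Wy).
have [WD WB] := (lin_subspaceD Wx Wy, lin_subspaceB Wx Wy).
rewrite !(bilBl, bilBr, bilDl, bilDr)//; lra.
Qed.

End subspace_forms.

Section inner_product.
Variables (R : realType) (H : normedModType R).

(** Keeping the pairing abstract, and tied to the norm by the last clause, lets one theory serve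
    both L_2(Omega) and L_2(0, t_F). *)
Definition inner_product (dot : H -> H -> R) :=
  [/\ forall x y, dot x y = dot y x,
      forall a x y z, dot (a *: x + y) z = a * dot x z + dot y z
    & forall x, dot x x = `|x| ^+ 2].

Variable dot : H -> H -> R.
Hypothesis ip : inner_product dot.

Lemma dotC x y : dot x y = dot y x. Proof. by case: ip. Qed.

Lemma dotxx x : dot x x = `|x| ^+ 2. Proof. by case: ip. Qed.

Lemma dot_bilinear : bilinear_on setT dot.
Proof. by case: ip => dC dl _; split => a x y z _ _ _; rewrite ?dl// ![dot z _]dC dl. Qed.

Lemma lin_subspaceT : lin_subspace [set: H]. Proof. by []. Qed.

Lemma dotDl x y z : dot (x + y) z = dot x z + dot y z.
Proof. exact: (bilDl dot_bilinear). Qed.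
Lemma dotDr x y z : dot z (x + y) = dot z x + dot z y.
Proof. exact: (bilDr dot_bilinear). Qed.
Lemma dotBl x y z : dot (x - y) z = dot x z - dot y z.
Proof. exact: (bilBl dot_bilinear). Qed.
Lemma dotBr x y z : dot z (x - y) = dot z x - dot z y.
Proof. exact: (bilBr dot_bilinear). Qed.
Lemma dotZl a x z : dot (a *: x) z = a * dot x z.
Proof. exact: (bilZl lin_subspaceT dot_bilinear). Qed.
Lemma dotZr a x z : dot z (a *: x) = a * dot z x.
Proof. exact: (bilZr lin_subspaceT dot_bilinear). Qed.
Lemma dot0l z : dot 0 z = 0.
Proof. exact: (bil0l lin_subspaceT dot_bilinear). Qed.
Lemma dot0r z : dot z 0 = 0.
Proof. exact: (bil0r lin_subspaceT dot_bilinear). Qed.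
Lemma dotNl x z : dot (- x) z = - dot x z.
Proof. by rewrite -scaleN1r dotZl mulN1r. Qed.
Lemma dot_suml (I : Type) (r : seq I) (P : pred I) (F : I -> H) z :
  dot (\sum_(i <- r | P i) F i) z = \sum_(i <- r | P i) dot (F i) z.
Proof. by apply: (big_morph (dot^~ z)) => [x y|]; rewrite ?dotDl ?dot0l. Qed.

Lemma normB_sqr x y : `|x - y| ^+ 2 = `|x| ^+ 2 - 2 * dot x y + `|y| ^+ 2.
Proof. by rewrite -!dotxx !(dotBl, dotBr) (dotC y x); ring. Qed.

Lemma normD_sqr x y : `|x + y| ^+ 2 = `|x| ^+ 2 + 2 * dot x y + `|y| ^+ 2.
Proof. by rewrite -!dotxx !(dotDl, dotDr) (dotC y x); ring. Qed.

Lemma cauchy_schwarz x y : `|dot x y| <= `|x| * `|y|.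
Proof.
have [->|y0] := eqVneq y 0; first by rewrite dot0r !normr0 mulr0.
have ny : 0 < `|y| by rewrite normr_gt0.
rewrite -ler_sqr ?nnegrE ?mulr_ge0// real_normK ?num_real//.
(* Expand the squared distance from [x] to its projection on the line of [y], then clear the
   denominator. *)
have := sqr_ge0 `|x - (dot x y / `|y| ^+ 2) *: y|.
rewrite normB_sqr dotZr normrZ exprMn.
rewrite [`|_ / _| ^+ 2]real_normK ?num_real//.
move=> /(mulr_ge0 (sqr_ge0 `|y|)); rewrite mulrC.
set s := dot x y; set b := `|y|; set a := `|x|.
have -> : (a ^+ 2 - 2 * (s / b ^+ 2 * s) + (s / b ^+ 2) ^+ 2 * b ^+ 2) * b ^+ 2
  = a ^+ 2 * b ^+ 2 - s ^+ 2.
  by field; rewrite gt_eqF.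
by rewrite exprMn subr_ge0.
Qed.

Lemma dot_le x y : dot x y <= `|x| * `|y|.
Proof. exact: le_trans (ler_norm _) (cauchy_schwarz _ _). Qed.

Lemma cvg_dotl (T : Type) (F : set_system T) {FF : Filter F} (u : T -> H) x y :
  u @ F --> x -> dot (u t) y @[t --> F] --> dot x y.
Proof.
move=> ux; apply/cvgrPdist_lt => e e0.
have e1 : 0 < e / (`|y| + 1) by rewrite divr_gt0// ltr_wpDl.
move/cvgrPdist_lt : ux => /(_ _ e1); apply: filterS => t xt.
rewrite -dotBl (le_lt_trans (cauchy_schwarz _ _))//.
rewrite (@le_lt_trans _ _ (`|x - u t| * (`|y| + 1)))//.
  by rewrite ler_wpM2l// lerDl.
by rewrite -ltr_pdivlMr// ltr_wpDl.
Qed.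

(* A vector is bounded by C as soon as its pairings are: test against itself. *)
Lemma norm_le_dot x C : 0 <= C -> (forall y, dot x y <= C * `|y|) -> `|x| <= C.
Proof.
move=> C0 /(_ x); rewrite dotxx expr2.
have [->|x0] := eqVneq x 0; first by rewrite normr0.
by rewrite ler_pM2r// normr_gt0.
Qed.

Lemma dot_ext x y : (forall z, dot x z = dot y z) -> x = y.
Proof.
move=> xy; apply/eqP; rewrite -subr_eq0 -normr_le0.
by apply: norm_le_dot => // z; rewrite dotBl xy subrr mul0r.
Qed.

End inner_product.

Section finite_dimension.
Variables (R : realType) (H : lmodType R) (W : set H) (f : H -> H -> R).
Hypothesis sW : lin_subspace W.
Hypothesis bf : bilinear_on W f.
Hypothesis fC : forall x y, W x -> W y -> f x y = f y x.
Hypothesis fpos : forall x, W x -> 0 <= f x x ?= iff (x == 0).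

Definition orthonormal (s : seq H) :=
  uniq s /\ forall x y, x \in s -> y \in s -> f x y = (x == y)%:R.

(** A list rather than a family over 'I_n: the dimension is not known beforehand, the generators of
    [X] may be dependent. *)
Definition is_onb (X : set H) (s : seq H) :=
  [/\ (forall x, x \in s -> X x), orthonormal s &
      forall x, X x -> x = \sum_(e <- s) f x e *: e].

Let span n (e : 'I_n -> H) : set H :=
  [set v | exists k : 'I_n -> R, v = \sum_i k i *: e i].

Lemma lin_subspace_span n (e : 'I_n -> H) :
  lin_subspace [set v | exists k : 'I_n -> R, v = \sum_i k i *: e i].
Proof.
split.
  by exists (fun=> 0); rewrite big1// => i _; rewrite scale0r.
move=> a x y [k ->] [l ->]; exists (fun i => a * k i + l i).
rewrite scaler_sumr -big_split/=; apply: eq_bigr => i _.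
by rewrite scalerDl scalerA.
Qed.

(** Gram-Schmidt, by induction on the number of generators. It is stated for any positive definite
    form because each X_K receives two bases, one for the L_2 product and one for the H^1_0
    product. *)
Lemma findim_onb n (e : 'I_n -> H) : (forall i, W (e i)) ->
  exists s, is_onb [set v | exists k : 'I_n -> R, v = \sum_i k i *: e i] s.
Proof.
elim: n e => [|n IH] e We.
  by exists [::]; split => // x [k ->]; rewrite big_ord0 big_nil.
pose e' := fun i : 'I_n => e (widen_ord (leqnSn n) i).
have [s [sX [us os] sE]] := IH e' (fun=> We _).
have subX x : span e' x -> span e x.
  move=> [k ->]; exists (fun i => if unlift ord_max i is Some j then k j else 0).
  rewrite big_ord_recr/= unlift_none scale0r addr0; apply: eq_bigr => i _.
  have -> : widen_ord (leqnSn n) i = lift ord_max i.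
    by apply/val_inj; rewrite /= /bump leqNgt ltn_ord.
  rewrite liftK /e'; congr (_ *: e _).
  by apply/val_inj; rewrite /= /bump leqNgt ltn_ord.
have WX x : span e x -> W x.
  by move=> [k ->]; apply: lin_subspace_sum => // i _; exact: lin_subspaceZ.
pose m := e ord_max.
have Wm : W m by exact: We.
have Ws x : x \in s -> W x by move=> /sX /subX /WX.
have Xm : span e m.
  exists (fun i => (i == ord_max)%:R).
  rewrite (bigD1 ord_max)//= eqxx scale1r big1 ?addr0// => i /negbTE ->.
  by rewrite scale0r.
(* [p] is the projection of the last generator [m] onto the span of the others, and [q] the
   orthogonal remainder. *)
pose p := \sum_(x <- s) f m x *: x.
have Xp : span e p.
  rewrite /p big_seq; apply: (lin_subspace_sum (lin_subspace_span e)) => x xs.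
  by apply: (lin_subspaceZ (lin_subspace_span e)); apply: subX; exact: sX.
pose q := m - p.
have Xq : span e q by exact: (lin_subspaceB (lin_subspace_span e)).
have [Wp Wq] := (WX _ Xp, WX _ Xq).
have qs x : x \in s -> f q x = 0.
  move=> xs; have Wx := Ws _ xs.
  rewrite (bilBl bf)// /p (bil_suml sW bf)//; last first.
    by move=> y ys; apply: lin_subspaceZ => //; exact: Ws.
  rewrite (bigD1_seq x)//= (bilZl sW bf)// (os x x)// eqxx mulr1 big_seq_cond big1.
    by rewrite addr0 subrr.
  move=> y /andP[ys yx]; rewrite (bilZl sW bf)//; last exact: Ws.
  by rewrite (os y x)// (negbTE yx) mulr0.
have dec x : span e x -> exists2 x', span e' x' & exists c, x = x' + c *: m.
  move=> [k ->]; rewrite big_ord_recr/=.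
  exists (\sum_(i < n) k (widen_ord (leqnSn n) i) *: e' i); last by exists (k ord_max).
  by exists (fun i => k (widen_ord (leqnSn n) i)).
(* If the remainder vanishes, [m] is redundant and the basis does not grow. *)
have [q0|q0] := eqVneq q 0.
  exists s; split => //; first by move=> x /sX /subX.
  move=> x /dec[x' Xx' [c ->]]; apply: sE.
  apply: (lin_subspaceD (lin_subspace_span e')) => //; apply: (lin_subspaceZ (lin_subspace_span e')).
  have -> : m = p by apply/eqP; rewrite -subr_eq0; exact/eqP.
  rewrite /p big_seq; apply: (lin_subspace_sum (lin_subspace_span e')) => y ys.
  by apply: (lin_subspaceZ (lin_subspace_span e')); exact: sX.
have fq : 0 < f q q by rewrite lt_def eq_sym (fpos Wq).2 q0 (fpos Wq).1.
pose g := (Num.sqrt (f q q))^-1 *: q.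
have sqq : Num.sqrt (f q q) ^+ 2 = f q q by rewrite sqr_sqrtr// ltW.
have sq0 : 0 < Num.sqrt (f q q) by rewrite sqrtr_gt0.
have Xg : span e g by exact: (lin_subspaceZ (lin_subspace_span e)).
have Wg := WX _ Xg.
have fgg : f g g = 1.
  rewrite (bilZl sW bf)// (bilZr sW bf)// -{3}sqq; field.
  by rewrite gt_eqF.
have gs x : x \in s -> f g x = 0.
  by move=> xs; have Wx := Ws _ xs; rewrite (bilZl sW bf)// (qs _ xs) mulr0.
have gns : g \notin s.
  by apply/negP => /[dup] /gs; rewrite fgg => /eqP; rewrite oner_eq0.
exists (g :: s); split.
- by move=> x; rewrite inE => /predU1P[->//|/sX /subX].
- split; first by rewrite /= gns.
  move=> x y; rewrite !inE => /predU1P[->|xs] /predU1P[->|ys].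
  + by rewrite eqxx.
  + by rewrite gs//; case: eqP => // gy; rewrite -gy (negbTE gns) in ys.
  + rewrite fC// ?gs//; last exact: Ws.
    by case: eqP => // gy; rewrite gy (negbTE gns) in xs.
  + exact: os.
- move=> x /dec[x' Xx' [c ->]]; have Wx' := WX _ (subX _ Xx').
  have mE : m = p + Num.sqrt (f q q) *: g.
    by rewrite /g scalerA divff ?gt_eqF// scale1r /q addrC subrK.
  have Xy : span e' (x' + c *: p).
    apply: (lin_subspaceD (lin_subspace_span e')) => //; apply: (lin_subspaceZ (lin_subspace_span e')).
    rewrite /p big_seq; apply: (lin_subspace_sum (lin_subspace_span e')) => y ys.
    by apply: (lin_subspaceZ (lin_subspace_span e')); exact: sX.
  rewrite mE scalerDr addrA scalerA.
  (* With [x = y + a *: g], [y] in the old span and orthogonal to [g], the expansion splits into the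
     old one of [y] and the coefficient [a]. *)
  set y := x' + c *: p in Xy *; set a := _ * Num.sqrt _. clearbody y a.
  have Wy : W y by apply: WX; exact: subX.
  have yg : f y g = 0.
    rewrite {1}(sE _ Xy) (bil_suml sW bf)//.
      rewrite big_seq big1// => z zs; have Wz := Ws _ zs.
      by rewrite (bilZl sW bf)// (fC Wz Wg) gs// mulr0.
    by move=> z zs; apply: lin_subspaceZ => //; exact: Ws.
  have Wag : W (a *: g) by exact: lin_subspaceZ.
  rewrite big_cons (bilDl bf)// (bilZl sW bf)// fgg yg mulr1 add0r addrC.
  congr (_ + _); rewrite {1}(sE _ Xy) big_seq [RHS]big_seq.
  apply: eq_bigr => z zs; have Wz := Ws _ zs.
  by rewrite (bilDl bf)// (bilZl sW bf)// gs// mulr0 ?addr0 ?add0r.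
Qed.

End finite_dimension.

Lemma cvg_geometric_steps (R : realType) (V : completeNormedModType R)
    (u : nat -> V) (C q : R) : 0 <= q -> q < 1 ->
  (forall n, `|u n.+1 - u n| <= C * q ^+ n) -> cvgn u.
Proof.
move=> q0 q1 uC.
have C0 : 0 <= C by have := uC 0%N; rewrite expr0 mulr1; exact: le_trans.
have st : cvgn (series (telescope u)).
  apply: normed_cvg; apply: (@series_le_cvg _ _ (geometric C q)) => //.
  - by move=> n /=.
  - by move=> n; rewrite /geometric/= mulr_ge0// exprn_ge0.
  - by apply: is_cvg_geometric_series; rewrite ger0_norm.
have -> : u = (fun n => u 0%N + series (telescope u) n).
  by apply/funext => n; rewrite -eq_sum_telescope.
by apply: is_cvgD => //; exact: is_cvg_cst.
Qed.

(** * Completeness of L2 *)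

Section L2_inner_product.
Context d (T : measurableType d) (R : realType).
Variable mu : {measure set T -> \bar R}.
Implicit Types x y z : L2 mu.

Lemma L2_measurable x : measurable_fun setT (x : T -> R).
Proof. by have /andP[] := L2_Lfun x; rewrite !inE. Qed.

Lemma Lfun2P (f : T -> R) : f \in Lfun mu 2%:E <->
  measurable_fun setT f /\ (\int[mu]_t (f t ^+ 2)%:E < +oo)%E.
Proof.
have pE : (fun t => (`|(EFin \o f) t| `^ 2)%E) = (fun t => (f t ^+ 2)%:E).
  apply/funext => t /=; congr EFin.
  by rewrite powR_mulrn// real_normK// num_real.
split=> [/[dup] f2 /andP[]|[mf f2]].
  rewrite !inE/= => mf _; split => //.
  have /integrableP[_] := Lfun2_integrable_sqr f2.
  by under eq_integral do rewrite /= ger0_norm ?sqr_ge0//.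
apply/andP; rewrite !inE/=; split => //.
by rewrite /finite_norm unlock pE poweR_lty.
Qed.

Lemma toL2_norm (f : T -> R) : f \in Lfun mu 2%:E ->
  (`|toL2 mu f| ^+ 2)%:E = (\int[mu]_t (f t ^+ 2)%:E)%E.
Proof.
move=> /[dup] Lf /Lfun2P[mf f2].
have pE : (fun t => (`|(EFin \o f) t| `^ 2)%E) = (fun t => (f t ^+ 2)%:E).
  apply/funext => t /=; congr EFin.
  by rewrite powR_mulrn// real_normK// num_real.
have -> : `|toL2 mu f| = fine 'N[mu]_2%:E[EFin \o f].
  rewrite -(ae_eq_Lnorm2 _ mf (toL2E Lf)) //.
  exact: L2_measurable.
have I0 : (0 <= \int[mu]_t (f t ^+ 2)%:E)%E.
  by apply: integral_ge0 => t _; rewrite lee_fin sqr_ge0.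
have If : (\int[mu]_t (f t ^+ 2)%:E)%E \is a fin_num by rewrite ge0_fin_numE.
rewrite unlock pE fine_poweR -powR_mulrn ?powR_ge0// -powRrM mulVf//.
by rewrite powRr1 ?fineK// fine_ge0.
Qed.

Lemma toL2K x : toL2 mu (x : T -> R) = x.
Proof. by apply: L2_eqP; apply: toL2E; exact: L2_Lfun. Qed.

Lemma L2_norm x : (`|x| ^+ 2)%:E = (\int[mu]_t (x t ^+ 2)%:E)%E.
Proof. by rewrite -{1}(toL2K x) toL2_norm//; exact: L2_Lfun. Qed.

Lemma L2_DE x y : ((x + y : L2 mu) : T -> R) = (fun t => x t + y t) %[ae mu].
Proof. exact: L2addE. Qed.

Lemma L2_NE x : ((- x : L2 mu) : T -> R) = (fun t => - x t) %[ae mu].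
Proof. exact: L2oppE. Qed.

Lemma L2_ZE a x : ((a *: x : L2 mu) : T -> R) = (fun t => a * x t) %[ae mu].
Proof. exact: L2scaleE. Qed.

Lemma L2_BE x y : ((x - y : L2 mu) : T -> R) = (fun t => x t - y t) %[ae mu].
Proof.
have := L2_DE x (- y); have := L2_NE y.
by apply: filterS2 => t /(_ I) h1 /(_ I) h2 _; rewrite h2 h1.
Qed.

Lemma L2_integrableM (f g : T -> R) : f \in Lfun mu 2%:E ->
  g \in Lfun mu 2%:E -> mu.-integrable setT (EFin \o (fun t => f t * g t)).
Proof. by move=> Lf Lg; apply/Lfun1_integrable; exact: Lfun2_mul_Lfun1. Qed.

Lemma Lfun2_measurable (f : T -> R) : f \in Lfun mu 2%:E -> measurable_fun setT f.
Proof. by case/Lfun2P. Qed.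

Lemma L2dot_ae x y (f g : T -> R) : measurable_fun setT f ->
  measurable_fun setT g -> (x : T -> R) = f %[ae mu] ->
  (y : T -> R) = g %[ae mu] -> L2dot x y = \int[mu]_t (f t * g t).
Proof.
move=> mf mg xf yg; congr fine; apply: ae_eq_integral => //.
- by apply/measurable_EFinP; apply: measurable_funM; exact: L2_measurable.
- by apply/measurable_EFinP; exact: measurable_funM.
- by apply: filterS2 xf yg => t + + _ => /(_ I) -> /(_ I) ->.
Qed.

Lemma L2dot_toL2 x (f : T -> R) : f \in Lfun mu 2%:E ->
  L2dot x (toL2 mu f) = \int[mu]_t (x t * f t).
Proof.
move=> Lf; apply: L2dot_ae => //; last exact: toL2E.
- exact: L2_measurable.
- exact: Lfun2_measurable.
- exact: ae_eq_refl.
Qed.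

Lemma L2dot_inner_product : inner_product (@L2dot _ T R mu).
Proof.
split.
- by move=> x y; congr fine; apply: eq_integral => t _; rewrite mulrC.
- move=> a x y z.
  rewrite (@L2dot_ae _ z (fun t => a * x t + y t) z)//.
  + rewrite /L2dot -RintegralZl//; last by apply: L2_integrableM; exact: L2_Lfun.
    rewrite -RintegralD//.
    * by congr Rintegral; apply/funext => t; rewrite mulrDl mulrA.
    * exact: (integrableZl measurableT a (L2_integrableM (L2_Lfun x) (L2_Lfun z))).
    * by apply: L2_integrableM; exact: L2_Lfun.
  + by apply: measurable_funD; [apply: measurable_funM => //|]; exact: L2_measurable.
  + exact: L2_measurable.
  + have := L2_DE (a *: x) y; have := L2_ZE a x.
    by apply: filterS2 => t /(_ I) h1 /(_ I) h2 _; rewrite h2 h1.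
  + exact: ae_eq_refl.
- move=> x; apply/EFin_inj; rewrite L2_norm /L2dot /Rintegral.
  under eq_integral do rewrite -expr2.
  by rewrite -L2_norm.
Qed.

End L2_inner_product.

Section L2_complete.
Context d (T : measurableType d) (R : realType).
Variable mu : {measure set T -> \bar R}.

Lemma L2_normB (x y : L2 mu) :
  (`|x - y| ^+ 2)%:E = (\int[mu]_t ((x t - y t) ^+ 2)%:E)%E.
Proof.
rewrite L2_norm; apply: ae_eq_integral => //.
- by apply/measurable_EFinP; apply: measurable_funX; exact: L2_measurable.
- apply/measurable_EFinP; apply: measurable_funX.
  by apply: measurable_funB; exact: L2_measurable.
- by have := L2_BE x y; apply: filterS => t + _ => /(_ I) ->.
Qed.

Lemma measurable_limn_einf (h : nat -> T -> \bar R) :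
  (forall n, measurable_fun setT (h n)) ->
  measurable_fun setT (fun t => limn_einf (h ^~ t)).
Proof.
move=> mh; under eq_fun => t.
  rewrite -[limn_einf _]oppeK -limn_esupN; over.
apply: (@measurableT_comp _ _ _ _ _ _ -%E) => //.
apply: (@measurable_fun_limn_esup _ _ _ setT (fun n t => - h n t)%E) => n.
exact: measurableT_comp.
Qed.

(** Here [f] need not be known to lie in L2: the bound gives both that membership, by finiteness,
    and the distance from the limit to a term of the sequence. *)
Lemma L2_fatou (x : nat -> L2 mu) (f : T -> R) (y : L2 mu) (C : R) :
  measurable_fun setT f ->
  {ae mu, forall t, x n t @[n --> \oo] --> f t} ->
  (\forall n \near \oo, `|x n - y| ^+ 2 <= C) ->
  (\int[mu]_t ((f t - y t) ^+ 2)%:E <= C%:E)%E.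
Proof.
move=> mf xf xyC.
have mx n : measurable_fun setT (fun t => ((x n t - y t) ^+ 2)%:E).
  apply/measurable_EFinP; apply: measurable_funX.
  by apply: measurable_funB; exact: L2_measurable.
have x0 n t : setT t -> (0 <= ((x n t - y t) ^+ 2)%:E)%E.
  by rewrite lee_fin sqr_ge0.
have := fatou mu measurableT mx x0.
have -> : (\int[mu]_t limn_einf (fun n => ((x n t - y t) ^+ 2)%:E) =
    \int[mu]_t ((f t - y t) ^+ 2)%:E)%E.
  apply: ae_eq_integral => //.
  - exact: measurable_limn_einf.
  - apply/measurable_EFinP; apply: measurable_funX.
    by apply: measurable_funB => //; exact: L2_measurable.
  apply: filterS xf => t xf _; apply: (cvg_limn_einf_sup _).1.
  apply/cvg_EFin; first exact: nearW.
  by apply: cvgM; apply: cvgB => //; exact: cvg_cst.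
move=> /le_trans; apply.
rewrite limn_einf_lim; apply: lime_le; first exact: is_cvg_einfs.
near=> n; apply: (@le_trans _ _ (\int[mu]_t ((x n t - y t) ^+ 2)%:E)%E).
  by apply: ereal_inf_lbound; exists n => /=.
by rewrite -L2_normB lee_fin; near: n.
Unshelve. all: by end_near. Qed.

(** The squared steps weighted by 4^n have integral at most 4 * 4^-n, so their sum S is finite
    almost everywhere; at such points the steps are at most sqrt(S) 2^-n. *)
Lemma L2_fast_cauchy_ae (x : nat -> L2 mu) :
  (forall n, `|x n.+1 - x n| <= 2 * (4^-1) ^+ n) ->
  {ae mu, forall t, cvgn (fun n => x n t)}.
Proof.
move=> xx.
pose h n t := (4 ^+ n * (x n.+1 t - x n t) ^+ 2)%:E.
have h0 n t : (0 <= h n t)%E.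
  by rewrite lee_fin; apply: mulr_ge0; [exact: exprn_ge0|exact: sqr_ge0].
have mh n : measurable_fun setT (h n).
  apply/measurable_EFinP; apply: measurable_funM => //.
  by apply: measurable_funX; apply: measurable_funB; exact: L2_measurable.
have Ih n : (\int[mu]_t h n t <= (geometric 4 4^-1 n)%:E)%E.
  under eq_integral do rewrite /h EFinM.
  rewrite ge0_integralZl//; last 2 first.
  - apply/measurable_EFinP; apply: measurable_funX.
    by apply: measurable_funB; exact: L2_measurable.
  - by move=> t _; rewrite lee_fin sqr_ge0.
  rewrite -L2_normB -EFinM lee_fin /geometric/=.
  have : `|x n.+1 - x n| ^+ 2 <= (2 * 4^-1 ^+ n) ^+ 2.
    by rewrite ler_sqr ?nnegrE ?mulr_ge0 ?exprn_ge0.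
  move=> /(ler_wpM2l (exprn_ge0 n (ler0n R 4))) /le_trans; apply.
  have pq : (4 : R) ^+ n * 4^-1 ^+ n = 1 by rewrite -exprMn divff ?expr1n.
  have -> : (4 : R) ^+ n * (2 * 4^-1 ^+ n) ^+ 2 =
      4 * 4^-1 ^+ n * (4 ^+ n * 4^-1 ^+ n) by ring.
  by rewrite pq mulr1.
have hs : (\int[mu]_t (\sum_(n <oo) h n t) < +oo)%E.
  rewrite integral_nneseries//.
  apply: (@le_lt_trans _ _ (4 * (1 - 4^-1)^-1 : R)%:E); last exact: ltry.
  apply: lime_le; first by apply: is_cvg_nneseries => n _ _; exact: integral_ge0.
  near=> n; apply: (@le_trans _ _ (\sum_(0 <= i < n) (geometric 4 (4^-1) i)%:E)%E).
    by apply: lee_sum => i _; exact: Ih.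
  rewrite sumEFin lee_fin; apply: geometric_le_lim => //.
  by rewrite ger0_norm// invf_lt1// ltr1n.
have : mu.-integrable setT (fun t => \sum_(n <oo) h n t)%E.
  apply/integrableP; split; first exact: ge0_emeasurable_sum.
  under eq_integral => t _.
    rewrite gee0_abs; last by apply: nneseries_ge0 => n _ _; exact: h0.
    over.
  exact: hs.
move=> /integrable_ae -/(_ measurableT); apply: filterS => t /(_ I) St.
set S := (\sum_(n <oo) h n t)%E in St.
have hS n : (h n t <= S)%E.
  apply: le_trans (nneseries_lim_ge n.+1 _) => //.
  by rewrite big_nat_recr//= leeDr// sume_ge0.
apply: (@cvg_geometric_steps _ _ _ (Num.sqrt (fine S)) (2^-1)) => //.
  by rewrite invf_lt1// ltr1n.
move=> n; have := hS n; rewrite -(fineK St) lee_fin => hn.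
have S0 : 0 <= fine S.
  by apply: le_trans hn; apply: mulr_ge0; [exact: exprn_ge0|exact: sqr_ge0].
rewrite -ler_sqr ?nnegrE ?mulr_ge0 ?sqrtr_ge0 ?exprn_ge0//.
rewrite real_normK ?num_real// exprMn sqr_sqrtr// -exprM mulnC exprM.
have -> : 2^-1 ^+ 2 = 4^-1 :> R by rewrite exprVn -natrX.
by rewrite exprVn ler_pdivlMr ?exprn_gt0// mulrC.
Unshelve. all: by end_near. Qed.

Lemma L2_fast_cauchy (x : nat -> L2 mu) :
  (forall m n, (m <= n)%N -> `|x n - x m| <= 2 * (4^-1) ^+ m) ->
  cvgn x.
Proof.
move=> xx.
have xc := L2_fast_cauchy_ae (fun n => xx n n.+1 (leqnSn n)).
(* The lower limit is measurable on the whole space and equals the limit wherever the sequence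
   converges. *)
pose f t := fine (limn_einf (fun n => (x n t)%:E)).
have mf : measurable_fun setT f.
  apply: measurableT_comp => //; apply: measurable_limn_einf => n.
  by apply/measurable_EFinP; exact: L2_measurable.
have xf : {ae mu, forall t, x n t @[n --> \oo] --> f t}.
  apply: filterS xc => t /cvg_ex[l xl]; rewrite /f.
  suff -> : limn_einf (fun n => (x n t)%:E) = l%:E by [].
  by apply: (cvg_limn_einf_sup _).1; apply/cvg_EFin; [exact: nearW|exact: xl].
have fx m : (\int[mu]_t ((f t - x m t) ^+ 2)%:E <= ((2 * 4^-1 ^+ m) ^+ 2)%:E)%E.
  apply: L2_fatou xf _ => //; near=> n.
  rewrite ler_sqr ?nnegrE ?mulr_ge0 ?exprn_ge0//; apply: xx.
  by near: n; exact: nbhs_infty_ge.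
have Lfm m : (f \- x m) \in Lfun mu 2%:E.
  apply/Lfun2P; split; first by apply: measurable_funB => //; exact: L2_measurable.
  by apply: le_lt_trans (fx m) _; exact: ltry.
have Lf : f \in Lfun mu 2%:E.
  have -> : f = (f \- x 0%N) \+ x 0%N by apply/funext => t /=; rewrite subrK.
  exact: ((Lfun_addr_closed mu (lee1n 2)).2 _ _ (Lfm _) (L2_Lfun _)).
have fxm m : `|toL2 mu f - x m| <= 2 * 4^-1 ^+ m.
  rewrite -ler_sqr ?nnegrE ?mulr_ge0 ?exprn_ge0// -lee_fin L2_normB.
  apply: le_trans (fx m); rewrite le_eqVlt; apply/orP; left; apply/eqP.
  apply: ae_eq_integral => //.
  - apply/measurable_EFinP; apply: measurable_funX.
    by apply: measurable_funB; exact: L2_measurable.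
  - by apply/measurable_EFinP; apply: measurable_funX; exact: (Lfun2_measurable (Lfm m)).
  - by have := toL2E Lf; apply: filterS => t + _ => /(_ I) ->.
apply/cvg_ex; exists (toL2 mu f); apply/cvgrPdist_le => e e0.
have : (2 * 4^-1 ^+ m : R) @[m --> \oo] --> 0.
  rewrite -[X in _ --> X](mulr0 2); apply: cvgMr.
  by apply: cvg_expr; rewrite ger0_norm// invf_lt1// ltr1n.
move/cvgrPdist_le => /(_ _ e0); apply: filterS => m; rewrite sub0r normrN.
by apply: le_trans; apply: le_trans (fxm m) _; exact: ler_norm.
Unshelve. all: by end_near. Qed.

(** Centres of balls of radius 4^-n belonging to the filter form a fast Cauchy sequence, since any
    two of these balls meet; the filter converges to its limit. *)
Lemma L2_complete (F : set_system (L2 mu)) : ProperFilter F -> cauchy F -> cvg F.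
Proof.
move=> PF /cauchyP cF.
have q0 n : 0 < (4^-1 : R) ^+ n by rewrite exprn_gt0.
have /choice[x Fx] n : exists x : L2 mu, F (ball x (4^-1 ^+ n)).
  exact: cF.
have xx m n : (m <= n)%N -> `|x n - x m| <= 2 * (4^-1) ^+ m.
  move=> mn; have [z [/=]] := filter_ex (filterI (Fx n) (Fx m)).
  rewrite -!ball_normE/= => zn zm.
  apply: le_trans (ler_distD z _ _) _; rewrite mulr_natl mulr2n lerD//.
    apply: le_trans (ltW zn) _; apply: ler_wiXn2l => //.
    by rewrite invf_le1// ler1n.
  by rewrite distrC ltW.
have /cvg_ex[l xl] := L2_fast_cauchy xx.
apply/cvg_ex; exists l; apply/cvgrPdist_lt => e e0.
have : (4^-1 ^+ m : R) @[m --> \oo] --> 0.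
  by apply: cvg_expr; rewrite ger0_norm// invf_lt1// ltr1n.
have e2 : 0 < e / 2 by rewrite divr_gt0.
move/cvgrPdist_lt => /(_ _ e2) H1; move/cvgrPdist_lt : xl => /(_ _ e2) H2.
have [m [/= h1 h2]] := filter_ex (filterI H1 H2).
move: h1; rewrite sub0r normrN ger0_norm; last exact: ltW.
move=> h1; apply: filterS (Fx m) => z; rewrite -ball_normE/= => xz.
rewrite (splitr e); apply: le_lt_trans (ler_distD (x m) _ _) _.
by rewrite ltrD// (lt_trans xz).
Qed.

HB.instance Definition _ := Uniform_isComplete.Build (L2 mu) L2_complete.

End L2_complete.

Lemma ae_bounded_integral d (T : measurableType d) (R : realType)
    (mu : {measure set T -> \bar R}) (D : set T) (f : T -> R) (C : R) :
  measurable D -> (mu D < +oo)%E -> measurable_fun D f -> 0 <= C ->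
  {ae mu, forall t, D t -> `|f t| <= C} ->
  mu.-integrable D (EFin \o f) /\ \int[mu]_(t in D) `|f t| <= C * fine (mu D).
Proof.
move=> mD Doo mf C0 fC.
have I : (\int[mu]_(t in D) (`|f t|)%:E <= C%:E * mu D)%E.
  rewrite -integral_cst//; apply: ae_ge0_le_integral => //.
  by apply/measurable_EFinP; exact: measurableT_comp.
have Coo : (C%:E * mu D < +oo)%E by rewrite lte_mul_pinfty.
split.
  apply/integrableP; split; first exact/measurable_EFinP.
  exact: le_lt_trans I Coo.
have Df : mu D \is a fin_num by rewrite ge0_fin_numE.
rewrite -lee_fin EFinM /Rintegral !fineK// ge0_fin_numE.
  exact: le_lt_trans I Coo.
by apply: integral_ge0.
Qed.

(** * Bochner integrals through bounded functionals *)

Section bochner_weak.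
Variables (R : realType) (H : completeNormedModType R) (dot : H -> H -> R).
Hypothesis ip : inner_product dot.
Notation mR := (measurableTypeR R).
Notation lambda := (@lebesgue_measure R).
Variable D : set mR.
Hypotheses (mD : measurable D) (Doo : (lambda D < +oo)%E).

(** General bounded functionals, and not only the pairings [dot ^~ y], because [z |-> dot (S t z) y]
    is later used to move a semigroup operator inside an integral. *)
Definition functional_bounded (l : H -> R) (C : R) :=
  (forall a x y, l (a *: x + y) = a * l x + l y) /\
  forall x, `|l x| <= C * `|x|.

Section functional.
Variables (l : H -> R) (C : R).
Hypothesis lP : functional_bounded l C.

Let lD x y : l (x + y) = l x + l y.
Proof. by rewrite -[x]scale1r lP.1 scale1r mul1r. Qed.

Lemma functionalB x y : l (x - y) = l x - l y.
Proof. by rewrite addrC -scaleN1r lP.1 mulN1r addrC. Qed.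

Let l0 : l 0 = 0. Proof. by rewrite -(subrr 0) functionalB subrr. Qed.

Let lZ a x : l (a *: x) = a * l x.
Proof. by rewrite -[_ *: _]addr0 lP.1 l0 addr0. Qed.

Let l_sum (I : Type) (r : seq I) (F : I -> H) :
  l (\sum_(i <- r) F i) = \sum_(i <- r) l (F i).
Proof. exact: (big_morph l lD l0). Qed.

Lemma simple_eval_functional (s : simple_fun H) t :
  l (simple_eval s t) = \sum_i \1_(@simple_set _ _ s i) t * l (@simple_val _ _ s i).
Proof. by rewrite /simple_eval l_sum; apply: eq_bigr => i _; rewrite lZ. Qed.

Lemma measurable_simple_functional (s : simple_fun H) : simple_integrable D s ->
  measurable_fun D (fun t => l (simple_eval s t)).
Proof.
move=> sD; under eq_fun do rewrite simple_eval_functional.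
apply: measurable_sum => i; apply: measurable_funM => //.
by apply: measurable_funTS; apply: measurable_indic; exact: (sD i).1.
Qed.

Lemma simple_integral_functional (s : simple_fun H) : simple_integrable D s ->
  lambda.-integrable D (EFin \o (fun t => l (simple_eval s t))) /\
  \int[lambda]_(t in D) l (simple_eval s t) = l (simple_integral D s).
Proof.
move=> sD.
have si i : lambda.-integrable D
    (fun t => (\1_(@simple_set _ _ s i) t * l (@simple_val _ _ s i))%:E).
  under eq_fun do rewrite mulrC EFinM.
  apply: integrableZl => //; apply: (@ae_bounded_integral _ _ _ _ _ _ 1 _ _ _ _ _).1 => //.
  - by apply: measurable_funTS; apply: measurable_indic; exact: (sD i).1.
  - by apply: aeW => t _; rewrite indicE; case: (t \in _); rewrite ?normr1 ?normr0.
have E : (EFin \o (fun t => l (simple_eval s t))) = (fun t =>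
    \sum_(i <- index_enum _) (\1_(@simple_set _ _ s i) t * l (@simple_val _ _ s i))%:E)%E.
  by apply/funext => t /=; rewrite simple_eval_functional sumEFin.
split; first by rewrite E; exact: integrable_sum.
apply/EFin_inj; rewrite /Rintegral.
under eq_integral => t _ do rewrite simple_eval_functional -sumEFin.
rewrite integral_sum// /simple_integral l_sum.
have Ei i : (\int[lambda]_(t in D) (\1_(@simple_set _ _ s i) t * l (@simple_val _ _ s i))%:E =
    (l (fine (lambda (@simple_set _ _ s i `&` D)) *: @simple_val _ _ s i))%:E)%E.
  rewrite lZ EFinM fineK; last by rewrite ge0_fin_numE//; exact: (sD i).2.
  under eq_integral do rewrite mulrC EFinM.
  rewrite integralZl//.
    rewrite integral_indic//; last exact: (sD i).1.
    by rewrite [LHS]muleC.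
  apply: (@ae_bounded_integral _ _ _ _ _ _ 1 _ _ _ _ _).1 => //.
  - by apply: measurable_funTS; apply: measurable_indic; exact: (sD i).1.
  - by apply: aeW => t _; rewrite indicE; case: (t \in _); rewrite ?normr1 ?normr0.
by under eq_bigr do rewrite Ei; rewrite sumEFin.
Qed.

(** Measurability of [l \o F] is a separate premise because [is_bochner] speaks only of the norms of
    [F] minus simple functions. *)
Lemma is_bochner_functional (F : mR -> H) z : is_bochner D F z ->
  measurable_fun D (l \o F) ->
  lambda.-integrable D (EFin \o (l \o F)) /\ l z = \int[lambda]_(t in D) l (F t).
Proof.
move=> [s [sD sI sF sz]] mlF.
have Ci n : lambda.-integrable D (EFin \o (fun t => l (F t) - l (simple_eval (s n) t))).
  apply: (@le_integrable _ _ _ _ _ mD _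
      (fun t => (C * `|F t - simple_eval (s n) t|)%:E)).
  - apply/measurable_EFinP; apply: measurable_funB => //.
    exact: measurable_simple_functional.
  - move=> t _ /=; rewrite lee_fin -functionalB.
    by apply: le_trans (lP.2 _) _; exact: ler_norm.
  - exact: (integrableZl mD C (sI n)).
(* [l \o F] is its difference with the functional of one simple approximant, plus the latter; both
   are integrable. *)
have lFi : lambda.-integrable D (EFin \o (l \o F)).
  have := integrableD mD (Ci 0%N) (simple_integral_functional (sD 0%N)).1.
  by apply: eq_integrable => // t _ /=; rewrite -EFinD subrK.
split => //.
(* The images under [l] of the simple integrals have two limits: [l z] by continuity, and the
   integral of [l \o F] by L1 approximation. *)
have lz : l (simple_integral D (s n)) @[n --> \oo] --> l z.
  apply/cvgrPdist_lt => e e0.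
  have e1 : 0 < e / (`|C| + 1) by rewrite divr_gt0// ltr_wpDl.
  move/cvgrPdist_lt : sz => /(_ _ e1); apply: filterS => n zn.
  rewrite -functionalB; apply: le_lt_trans (lP.2 _) _.
  apply: (@le_lt_trans _ _ ((`|C| + 1) * `|z - simple_integral D (s n)|)).
    by rewrite ler_wpM2r// ler_wpDr// ler_norm.
  by rewrite mulrC -ltr_pdivlMr// ltr_wpDl.
have lI : l (simple_integral D (s n)) @[n --> \oo] --> \int[lambda]_(t in D) l (F t).
  have C0 : `|C| * \int[lambda]_(t in D) `|F t - simple_eval (s n) t|
      @[n --> \oo] --> (0 : R).
    by rewrite -[X in _ --> X](mulr0 `|C|); apply: cvgMr; exact: (fine_cvg sF).
  apply/cvgrPdist_le => e e0.
  have /cvgrPdist_le/(_ _ e0) := C0; apply: filterS => n; rewrite sub0r normrN.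
  apply: le_trans; rewrite -(simple_integral_functional (sD n)).2.
  rewrite -RintegralB//; last exact: (simple_integral_functional (sD n)).1.
  apply: le_trans (le_normr_Rintegral mD (Ci n)) _.
  apply: (@le_trans _ _ (\int[lambda]_(t in D) (`|C| * `|F t - simple_eval (s n) t|))).
    apply: le_Rintegral => //.
    - exact: (integrable_norm (Ci n)).
    - exact: (integrableZl mD `|C| (sI n)).
    - move=> t _; rewrite -functionalB; apply: le_trans (lP.2 _) _.
      by rewrite ler_wpM2r// ler_norm.
  rewrite RintegralZl//; last exact: sI.
  exact: ler_norm.
exact: cvg_unique lz lI.
Qed.

End functional.

Lemma dot_functional x : functional_bounded (dot ^~ x) `|x|.
Proof.
split => [a y z|y]; first by rewrite (dotDl ip) (dotZl ip).
by rewrite mulrC; exact: (cauchy_schwarz ip).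
Qed.

End bochner_weak.

Lemma measurable_sqrt_comp d (T : measurableType d) (R : realType) (D : set T)
    (f : T -> R) : measurable_fun D f -> measurable_fun D (fun t => Num.sqrt (f t)).
Proof.
move=> mf; apply: (measurableT_comp _ mf).
by apply: continuous_measurable_fun; exact: sqrt_continuous.
Qed.

Section bochner_existence.
Variables (R : realType) (H : completeNormedModType R) (dot : H -> H -> R).
Hypothesis ip : inner_product dot.
Notation mR := (measurableTypeR R).
Notation lambda := (@lebesgue_measure R).
Variable D : set mR.
Hypotheses (mD : measurable D) (Doo : (lambda D < +oo)%E).

Definition weakly_measurable (F : mR -> H) :=
  (forall x, measurable_fun D (fun t => dot (F t) x)) /\
  measurable_fun D (fun t => `|F t|).

(** Covering almost all of the range by finitely many small balls yields simple functions that are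
    uniformly close almost everywhere, which on a set of finite measure is more than L1
    closeness. *)
Definition ae_totally_bounded (F : mR -> H) := forall e : R, 0 < e ->
  exists xs : seq H,
    {ae lambda, forall t, D t -> exists2 x, x \in xs & `|F t - x| < e}.

Variable F : mR -> H.
Hypotheses (mF : weakly_measurable F) (tF : ae_totally_bounded F).

Let measurable_indicD (A : set mR) : measurable A ->
  measurable_fun D (\1_A : mR -> R).
Proof. by move=> mA; apply: measurable_funTS; exact: measurable_indic. Qed.

Lemma measurable_norm_simple (s : simple_fun H) : simple_integrable D s ->
  measurable_fun D (fun t => `|F t - simple_eval s t|).
Proof.
move=> sD.
(* The squared norm is expanded into pairings, whose measurability is that of [F] against fixed
   vectors. *)
have nE t : `|F t - simple_eval s t| = Num.sqrt (`|F t| ^+ 2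
    - 2 * (\sum_i \1_(@simple_set _ _ s i) t * dot (F t) (@simple_val _ _ s i))
    + \sum_i \1_(@simple_set _ _ s i) t *
        \sum_j \1_(@simple_set _ _ s j) t * dot (@simple_val _ _ s j) (@simple_val _ _ s i)).
  rewrite -[LHS]ger0_norm// -sqrtr_sqr; congr Num.sqrt.
  rewrite (normB_sqr ip); congr (_ - 2 * _ + _).
    rewrite (dotC ip) (dot_suml ip); apply: eq_bigr => i _.
    by rewrite (dotZl ip) (dotC ip).
  rewrite -(dotxx ip) {1}/simple_eval (dot_suml ip); apply: eq_bigr => i _.
  rewrite (dotZl ip) (dotC ip); congr (_ * _).
  by rewrite (dot_suml ip); apply: eq_bigr => j _; rewrite (dotZl ip).
under eq_fun do rewrite nE.
apply: measurable_sqrt_comp; apply: measurable_funD; first apply: measurable_funB.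
- by apply: measurable_funX; exact: mF.2.
- apply: measurable_funM => //; apply: measurable_sum => i.
  by apply: measurable_funM; [apply: measurable_indicD; exact: (sD i).1|exact: mF.1].
- apply: measurable_sum => i; apply: measurable_funM.
    by apply: measurable_indicD; exact: (sD i).1.
  apply: measurable_sum => j; apply: measurable_funM => //.
  by apply: measurable_indicD; exact: (sD j).1.
Qed.

Let measurable_norm_cst (x : H) : measurable_fun D (fun t => `|F t - x|).
Proof.
have nE t : `|F t - x| = Num.sqrt (`|F t| ^+ 2 - 2 * dot (F t) x + `|x| ^+ 2).
  by rewrite -[LHS]ger0_norm// -sqrtr_sqr (normB_sqr ip).
under eq_fun do rewrite nE.
apply: measurable_sqrt_comp; apply: measurable_funD => //; apply: measurable_funB.
- by apply: measurable_funX; exact: mF.2.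
- by apply: measurable_funM => //; exact: mF.1.
Qed.

(* Disjoint pieces of D on which F is close to a point of a finite net. *)
Lemma simple_approx (e : R) : 0 < e -> exists s : simple_fun H,
  simple_integrable D s /\
  {ae lambda, forall t, D t -> `|F t - simple_eval s t| < e}.
Proof.
move=> e0; have [xs xsP] := tF e0.
pose A k : set mR := D `&` [set t | `|F t - nth 0 xs k| < e].
have mA k : measurable (A k).
  have := measurable_norm_cst (nth 0 xs k) mD (measurable_itv `]-oo, e[).
  by congr measurable; apply/seteqP; split=> t /=; rewrite /A/= in_itv/=.
have mB k : measurable (seqDU A k) by exact: seqDU_measurable.
exists (@SimpleFun _ _ (size xs) (fun i => seqDU A i) (fun i => nth 0 xs i)).
split=> [i|].
  split => //=; apply: le_lt_trans Doo; apply: le_measure; rewrite ?inE//.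
  exact: measurableI.
apply: filterS xsP => t + Dt => /(_ Dt)[x xxs Fx].
have [k ks Bk] : exists2 k, (k < size xs)%N & seqDU A k t.
  have Ak : exists k, `[< A k t >].
    by exists (index x xs); apply/asboolP; split => //=; rewrite nth_index.
  (* [seqDU] removes the earlier sets, so [t] belongs to the piece of least index. *)
  exists (ex_minn Ak); case: ex_minnP => k /asboolP Akt kmin.
    apply: (@leq_ltn_trans (index x xs)); last by rewrite index_mem.
    by apply: kmin; apply/asboolP; split => //=; rewrite nth_index.
  split => //; rewrite -bigcup_mkord => -[j /= jk Aj].
  by have := kmin j (introT (asboolP _) Aj); rewrite leqNgt jk.
suff -> : simple_eval (SimpleFun (fun i : 'I_(size xs) => seqDU A i)
    (fun i => nth 0 xs i)) t = nth 0 xs k.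
  by have [[]] := Bk.
rewrite /simple_eval/= (bigD1 (Ordinal ks))//= indicE mem_set// scale1r.
rewrite big1 ?addr0// => i ik; rewrite indicE memNset ?scale0r// => Bi.
have /trivIsetP/(_ i k I I) := trivIset_seqDU A.
have -> : (i : nat) != k by apply: contra ik => /eqP ik; exact/eqP/val_inj.
by move=> /(_ isT)/seteqP[/(_ t) + _]; apply.
Qed.

(** Pairing the difference with a vector [y] gives a real integral whose integrand is at most
    [(e + e') * |y|] almost everywhere. *)
Lemma simple_integral_dist (s s' : simple_fun H) (e e' : R) :
  0 <= e -> 0 <= e' -> simple_integrable D s -> simple_integrable D s' ->
  {ae lambda, forall t, D t -> `|F t - simple_eval s t| < e} ->
  {ae lambda, forall t, D t -> `|F t - simple_eval s' t| < e'} ->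
  `|simple_integral D s - simple_integral D s'| <= (e + e') * fine (lambda D).
Proof.
move=> e0 e'0 sD s'D se se'; have D0 : 0 <= fine (lambda D) by rewrite fine_ge0.
apply: (norm_le_dot ip) => [|y]; first by rewrite !mulr_ge0// addr_ge0.
have [i1 E1] := simple_integral_functional mD Doo (dot_functional ip y) sD.
have [i2 E2] := simple_integral_functional mD Doo (dot_functional ip y) s'D.
rewrite (dotBl ip) -E1 -E2 -RintegralB//.
apply: le_trans (ler_norm _) _.
apply: le_trans (le_normr_Rintegral mD (integrableB mD i1 i2)) _.
rewrite mulrAC; apply: (@ae_bounded_integral _ _ _ _ _ _ _ _ _ _ _ _).2 => //.
- by apply: measurable_funB; apply/measurable_EFinP; [case/integrableP : i1|case/integrableP : i2].
- by rewrite mulr_ge0// addr_ge0.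
- apply: filterS2 se se' => t /[swap] h' h Dt.
  rewrite -(dotBl ip); apply: le_trans (cauchy_schwarz ip _ _) _.
  rewrite ler_wpM2r//; apply: le_trans (ler_distD (F t) _ _) _.
  by rewrite lerD// ltW// ?h' // distrC h.
Qed.

(** Approximants accurate to 2^-n have integrals with geometrically decreasing steps, so
    completeness provides the value. *)
Lemma bochner_exists : exists z, is_bochner D F z.
Proof.
have q0 n : 0 < (2^-1 : R) ^+ n by rewrite exprn_gt0// invr_gt0.
have /choice[s sP] n := simple_approx (q0 n).
have D0 : 0 <= fine (lambda D) by rewrite fine_ge0.
have /cvg_ex[z zP] : cvgn (fun n => simple_integral D (s n)).
  apply: (@cvg_geometric_steps _ _ _ (2 * fine (lambda D)) 2^-1) => //.
    by rewrite invf_lt1// ltr1n.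
  move=> n.
  have := simple_integral_dist (ltW (q0 n.+1)) (ltW (q0 n)) (sP n.+1).1 (sP n).1
    (sP n.+1).2 (sP n).2.
  move=> /le_trans; apply; rewrite [leRHS]mulrAC ler_wpM2r//.
  have : (2^-1 : R) ^+ n.+1 <= 2^-1 ^+ n.
    by rewrite ler_wiXn2l// invf_le1// ler1n.
  lra.
have bI n : lambda.-integrable D (EFin \o (fun t => `|F t - simple_eval (s n) t|)) /\
    \int[lambda]_(t in D) `|F t - simple_eval (s n) t| <= 2^-1 ^+ n * fine (lambda D).
  have mn := measurable_norm_simple (sP n).1.
  have [] // := @ae_bounded_integral _ _ _ _ D _ (2^-1 ^+ n) mD Doo mn (ltW (q0 n)).
    by have := (sP n).2; apply: filterS => t + Dt => /(_ Dt) /ltW; rewrite normr_id.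
  move=> i1 i2; split => //; move: i2.
  by under eq_Rintegral do rewrite normr_id.
exists z, s; split.
- by move=> n; exact: (sP n).1.
- by move=> n; exact: (bI n).1.
- have I0 : \int[lambda]_(t in D) `|F t - simple_eval (s n) t| @[n --> \oo] --> (0 : R).
    have c0 : 2^-1 ^+ n * fine (lambda D) @[n --> \oo] --> (0 : R).
      rewrite -(mul0r (fine (lambda D))); apply: cvgMl.
      by apply: cvg_expr; rewrite ger0_norm// invf_lt1// ltr1n.
    apply: (squeeze_cvgr _ (@cvg_cst _ _ _ _ _) c0).
    by apply: nearW => n; rewrite (bI n).2 Rintegral_ge0.
  have : (\int[lambda]_(t in D) `|F t - simple_eval (s n) t|)%:E @[n --> \oo] --> (0%:E : \bar R).
    by apply/cvg_EFin => //; exact: nearW.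
  by under eq_fun do rewrite /Rintegral (fineK (integrable_fin_num mD (bI _).1)).
- exact: zP.
Qed.

(* Existence is essential: otherwise the Bochner integral is 0 by convention. *)
Lemma bochner_functional (l : H -> R) (C : R) : functional_bounded l C ->
  measurable_fun D (l \o F) -> l (bochner D F) = \int[lambda]_(t in D) l (F t).
Proof.
move=> lC mlF; have [z zP] := bochner_exists.
rewrite /bochner; case: xgetP => [y _ yP|/(_ z)//].
exact: (is_bochner_functional mD Doo lC yP mlF).2.
Qed.

End bochner_existence.

(** * Bochner integrals of bounded scalars times continuous vectors *)

Section control_integral.
Variables (R : realType) (H : completeNormedModType R) (dot : H -> H -> R).
Hypothesis ip : inner_product dot.
Notation mR := (measurableTypeR R).
Notation lambda := (@lebesgue_measure R).

Lemma functional_cvg (l : H -> R) C (T : Type) (F : set_system T) {FF : Filter F}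
    (u : T -> H) x : functional_bounded l C -> u @ F --> x ->
  l (u t) @[t --> F] --> l x.
Proof.
move=> lC ux; apply/cvgrPdist_lt => e e0.
have e1 : 0 < e / (`|C| + 1) by rewrite divr_gt0// ltr_wpDl.
move/cvgrPdist_lt : ux => /(_ _ e1); apply: filterS => t xt.
rewrite -(functionalB lC); apply: le_lt_trans (lC.2 _) _.
apply: (@le_lt_trans _ _ ((`|C| + 1) * `|x - u t|)).
  by rewrite ler_wpM2r// ler_wpDr// ler_norm.
by rewrite mulrC -ltr_pdivlMr// ltr_wpDl.
Qed.

Variable D : set mR.

Lemma ae_totally_boundedD (F G : mR -> H) :
  ae_totally_bounded D F -> ae_totally_bounded D G ->
  ae_totally_bounded D (fun t => F t + G t).
Proof.
move=> tF tG e e0; have e2 : 0 < e / 2 by rewrite divr_gt0.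
have [[xs Fx] [ys Gy]] := (tF _ e2, tG _ e2).
exists [seq x + y | x <- xs, y <- ys].
apply: filterS2 Fx Gy => t Fx Gy Dt.
have [[x xxs xF] [y yys yG]] := (Fx Dt, Gy Dt).
exists (x + y); first by apply/allpairsP; exists (x, y).
rewrite opprD addrACA (splitr e); apply: le_lt_trans (ler_normD _ _) _.
exact: ltrD.
Qed.

Lemma ae_totally_bounded_sum (I : Type) (r : seq I) (F : I -> mR -> H) :
  (forall i, ae_totally_bounded D (F i)) ->
  ae_totally_bounded D (fun t => \sum_(i <- r) F i t).
Proof.
move=> tF; elim: r => [|i r IH] e e0.
  exists [:: 0]; apply: aeW => t Dt; exists 0; first by rewrite mem_head.
  by rewrite big_nil subrr normr0.
have [xs xsP] := ae_totally_boundedD (tF i) IH e0.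
exists xs; apply: filterS xsP => t /[apply] -[x xxs xe].
by exists x => //; rewrite big_cons.
Qed.

Lemma compact_net (A : set H) (e : R) : compact A -> 0 < e ->
  exists xs : seq H, forall x, A x -> exists2 y, y \in xs & `|x - y| < e.
Proof.
rewrite compact_cover => cA e0.
have [|x Ax|D' _ D'P] := cA H A (fun x => ball x e).
- by move=> x _; exact: ball_open.
- by exists x => //; exact: ballxx.
- exists (finmap.enum_fset D') => x /D'P[y /= yD']; rewrite -ball_normE/= => xy.
  by exists y => //; rewrite distrC.
Qed.

Lemma interval_net (m e : R) : 0 < e ->
  exists cs : seq R, forall c, `|c| <= m -> exists2 c', c' \in cs & `|c - c'| < e.
Proof.
move=> e0; have := @segment_compact R (- m) m.
rewrite compact_cover => /(_ R [set` `[- m, m]] (fun x => ball x e)) [].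
- by move=> x _; exact: ball_open.
- by move=> x Ax; exists x => //; exact: ballxx.
- move=> D' _ D'P; exists (finmap.enum_fset D') => c cm.
  have [|y yD'] := D'P c; first by rewrite /= in_itv/= -ler_norml.
  by rewrite -ball_normE/= => yc; exists y => //; rewrite distrC.
Qed.

Lemma ae_totally_boundedM (u : mR -> R) (v : mR -> H) (m : R) : 0 <= m ->
  {ae lambda, forall t, D t -> `|u t| <= m} -> ae_totally_bounded D v ->
  ae_totally_bounded D (fun t => u t *: v t).
Proof.
move=> m0 um tv e e0.
have e1 : 0 < e / 2 / (m + 1) by rewrite !divr_gt0// ltr_wpDl.
have [xs xsP] := tv _ e1.
(* A common bound on the points of the net for [v] fixes how fine the net of scalars must be:
   [u v - c x = u (v - x) + (u - c) x]. *)
pose M := \sum_(x <- xs) `|x|.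
have M0 : 0 <= M by exact: sumr_ge0.
have xM x : x \in xs -> `|x| <= M.
  by move=> xxs; rewrite /M (big_rem x)//= lerDl sumr_ge0.
have e2 : 0 < e / 2 / (M + 1) by rewrite !divr_gt0// ltr_wpDl.
have [cs csP] := interval_net m e2.
exists [seq c *: x | c <- cs, x <- xs].
apply: filterS2 um xsP => t um xsPt Dt.
have [[x xxs xv] [c ccs cu]] := (xsPt Dt, csP _ (um Dt)).
exists (c *: x); first by apply/allpairsP; exists (c, x).
have -> : u t *: v t - c *: x = u t *: (v t - x) + (u t - c) *: x.
  by rewrite scalerBr scalerBl addrA subrK.
rewrite (splitr e); apply: le_lt_trans (ler_normD _ _) _; rewrite !normrZ ltr_leD//.
  apply: (@le_lt_trans _ _ ((m + 1) * `|v t - x|)).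
    by rewrite ler_wpM2r// ler_wpDr// um.
  by rewrite mulrC -ltr_pdivlMr// ltr_wpDl.
apply: (@le_trans _ _ (e / 2 / (M + 1) * (M + 1))).
  by rewrite ler_pM// ?(ltW cu)// ler_wpDr// xM.
by rewrite divfK// gt_eqF// ltr_wpDl.
Qed.

End control_integral.

Section control_integral_itv.
Variables (R : realType) (H : completeNormedModType R) (dot : H -> H -> R).
Hypothesis ip : inner_product dot.
Notation mR := (measurableTypeR R).
Notation lambda := (@lebesgue_measure R).
Variable T : R.
Let D : set mR := `[0, T]%classic.

Let mD : measurable D. Proof. exact: measurable_itv. Qed.

Lemma continuous_totally_bounded (v : R -> H) :
  {within `[0, T], continuous v} -> ae_totally_bounded D v.
Proof.
move=> cv e e0; have [|xs xsP] := @compact_net _ _ (v @` `[0, T]) e _ e0.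
  by apply: continuous_compact => //; exact: segment_compact.
by exists xs; apply: aeW => t Dt; apply: xsP; exists t.
Qed.

Lemma measurable_continuous_norm (v : R -> H) :
  {within `[0, T], continuous v} -> measurable_fun D (fun t => `|v t|).
Proof.
move=> cv; apply: (subspace_continuous_measurable_fun mD).
by move=> t; apply: cvg_norm; exact: cv.
Qed.

Lemma measurable_continuous_dot (v w : R -> H) :
  {within `[0, T], continuous v} -> {within `[0, T], continuous w} ->
  measurable_fun D (fun t => dot (v t) (w t)).
Proof.
move=> cv cw.
(* Polarization reduces the pairing to norms of continuous functions. *)
have E t : dot (v t) (w t) = 2^-1 * (`|v t + w t| ^+ 2 - `|v t| ^+ 2 - `|w t| ^+ 2).
  by rewrite (normD_sqr ip); field.
under eq_fun do rewrite E.
apply: measurable_funM => //; apply: measurable_funB; first apply: measurable_funB.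
- apply: measurable_funX; apply: measurable_continuous_norm => t.
  by apply: cvgD; [exact: cv|exact: cw].
- by apply: measurable_funX; exact: measurable_continuous_norm.
- by apply: measurable_funX; exact: measurable_continuous_norm.
Qed.

Section sum.
Variables (m : nat) (u : 'I_m -> mR -> R) (v : 'I_m -> R -> H) (bnd : 'I_m -> R).
Hypothesis mu : forall i, measurable_fun D (u i).
Hypothesis bnd0 : forall i, 0 <= bnd i.
Hypothesis ub : forall i, {ae lambda, forall t, D t -> `|u i t| <= bnd i}.
Hypothesis cv : forall i, {within `[0, T], continuous (v i)}.

Let F (t : mR) := \sum_i u i t *: v i t.

Let mF : weakly_measurable dot D F.
Proof.
split=> [x|].
  under eq_fun do rewrite (dot_suml ip).
  apply: measurable_sum => i; under eq_fun do rewrite (dotZl ip).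
  apply: measurable_funM => //; apply: measurable_continuous_dot => //.
  by move=> t; exact: cvg_cst.
have nE t : `|F t| = Num.sqrt (\sum_i u i t * \sum_j u j t * dot (v j t) (v i t)).
  rewrite -[LHS]ger0_norm// -sqrtr_sqr; congr Num.sqrt.
  rewrite -(dotxx ip) {1}/F (dot_suml ip); apply: eq_bigr => i _.
  rewrite (dotZl ip) (dotC ip) (dot_suml ip); congr (_ * _).
  by apply: eq_bigr => j _; rewrite (dotZl ip).
under eq_fun do rewrite nE.
apply: measurable_sqrt_comp; apply: measurable_sum => i; apply: measurable_funM => //.
apply: measurable_sum => j; apply: measurable_funM => //.
exact: measurable_continuous_dot.
Qed.

Let tF : ae_totally_bounded D F.
Proof.
apply: ae_totally_bounded_sum => i; apply: ae_totally_boundedM (bnd0 i) (ub i) _.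
exact: continuous_totally_bounded.
Qed.

(** The [u i] are merely measurable and essentially bounded, so the integrand need not be
    continuous; it is still almost everywhere totally bounded, hence integrable. All the Bochner
    integrals of the proof are evaluated through this formula. *)
Lemma bochner_control (l : H -> R) (C : R) : functional_bounded l C ->
  (forall i, lambda.-integrable D (EFin \o (fun t => u i t * l (v i t)))) /\
  l (bochner `[0, T] (fun t => \sum_i u i t *: v i t)) =
    \sum_i \int[lambda]_(t in `[0, T]) (u i t * l (v i t)).
Proof.
move=> lC.
have Doo : (lambda D < +oo)%E.
  by rewrite /D lebesgue_measure_itv/=; case: ifP => // _; rewrite -EFinB ltry.
have clv i : {within `[0, T], continuous (l \o v i)}.
  by move=> t; apply: (functional_cvg lC); exact: cv.
have mlv i : measurable_fun D (l \o v i).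
  exact: (subspace_continuous_measurable_fun mD (clv i)).
have ulv i : lambda.-integrable D (EFin \o (fun t => u i t * l (v i t))).
  have [M lvM] : exists M : R, forall t, D t -> `|l (v i t)| <= M.
    have := compact_bounded (continuous_compact (clv i) (@segment_compact R 0 T)).
    move=> [M [_ /(_ (M + 1))]] h; exists (M + 1) => t Dt.
    by apply: h; [rewrite ltrDl|exists t].
  apply: (@ae_bounded_integral _ _ _ _ D _ (bnd i * `|M|) _ _ _ _ _).1 => //.
  - exact: (measurable_funM (mu i) (mlv i)).
  - by rewrite mulr_ge0.
  - apply: filterS (ub i) => t ubt Dt; rewrite normrM ler_pM// ?ubt//.
    by apply: le_trans (lvM t Dt) _; exact: ler_norm.
have lF t : l (F t) = \sum_i u i t * l (v i t).
  have l0 : l 0 = 0 by rewrite -(subrr 0) (functionalB lC) subrr.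
  rewrite /F (big_morph l (id1 := 0) (op1 := +%R))//.
    by apply: eq_bigr => i _; rewrite -[_ *: _]addr0 lC.1 l0 addr0.
  by move=> x y; rewrite -[x]scale1r lC.1 scale1r mul1r.
split => //.
rewrite (bochner_functional ip mD Doo mF tF lC)//; last first.
  rewrite (_ : l \o _ = fun t => \sum_i u i t * l (v i t)); last exact/funext.
  by apply: measurable_sum => i; exact: (measurable_funM (mu i) (mlv i)).
apply/EFin_inj; rewrite /Rintegral.
under eq_integral => t _ do rewrite lF -sumEFin.
rewrite -sumEFin fineK; last first.
  by apply: integrable_fin_num => //; apply: integrable_sum => // i _; exact: ulv.
rewrite integral_sum//; apply: eq_bigr => i _; rewrite fineK//.
exact: (integrable_fin_num mD (ulv i)).
Qed.

End sum.

End control_integral_itv.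

(** * Strongly continuous semigroups *)

Section has_deriv.
Variable R : realType.

Definition has_deriv (H : normedModType R) (f : R -> H) (t : R) (y : H) :=
  h^-1 *: (f (t + h) - f t) @[h --> (0 : R)^'] --> y.

Lemma has_derivP (H : normedModType R) (f : R -> H) t y :
  has_deriv f t y <-> forall e, 0 < e -> exists2 d, 0 < d &
    forall h, h != 0 -> `|h| < d -> `|y - h^-1 *: (f (t + h) - f t)| <= e.
Proof.
split => [/cvgrPdist_le fy e e0|fy].
  have /nbhs_ballP[d /= d0 dP] := fy _ e0; exists d => // h h0 hd.
  by apply: dP => //; rewrite -ball_normE/= sub0r normrN.
apply/cvgrPdist_le => e e0; have [d d0 dP] := fy _ e0.
apply/nbhs_ballP; exists d => //= h; rewrite -ball_normE/= sub0r normrN => hd h0.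
exact: dP.
Qed.

Lemma has_derivB (H : normedModType R) (f g : R -> H) t y z :
  has_deriv f t y -> has_deriv g t z -> has_deriv (fun s => f s - g s) t (y - z).
Proof.
move=> fy gz; rewrite /has_deriv.
have -> : (fun h => h^-1 *: (f (t + h) - g (t + h) - (f t - g t))) =
    (fun h => h^-1 *: (f (t + h) - f t) - h^-1 *: (g (t + h) - g t)).
  apply/funext => h; rewrite -scalerBr; congr (_ *: _).
  by rewrite !opprB [g t - f t]addrC addrACA [- g _ + _]addrC.
exact: cvgB.
Qed.

Lemma has_deriv_cvg (H : normedModType R) (f : R -> H) t y :
  has_deriv f t y -> f (t + h) @[h --> (0 : R)^'] --> f t.
Proof.
move=> fy.
have h0 : (h : R) @[h --> (0 : R)^'] --> (0 : R) by exact: cvg_within.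
have -> : (fun h => f (t + h)) = (fun h => f t + h *: (h^-1 *: (f (t + h) - f t))).
  apply/funext => h; have [->|h0'] := eqVneq h 0; first by rewrite scale0r !addr0.
  by rewrite scalerA divff// scale1r subrKC.
by rewrite -[X in _ --> X]addr0 -(scale0r y); apply: cvgD; [exact: cvg_cst|exact: cvgZ].
Qed.

Lemma has_deriv_is_derive (f : R -> R) t y : has_deriv f t y -> is_derive t 1 f y.
Proof.
move=> fy.
have E : (fun h : R => h^-1 *: ((f \o shift t) (h *: (1 : R)) - f t)) =
    (fun h => h^-1 *: (f (t + h) - f t)).
  by apply/funext => h /=; rewrite -[h *: 1]/(h * 1) mulr1 [h + t]addrC.
by split; [rewrite /derivable E; apply/cvg_ex; exists y|
           rewrite /derive E; exact/cvg_lim].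
Qed.

(** With D the increment of [f], the increment of the squared norm is |D|^2 + 2 <D, f(t)>; after
    division by h the first term is a converging quotient paired with D, which tends to 0. *)
Lemma has_deriv_dot (H : normedModType R) (dot : H -> H -> R) (f : R -> H) t y :
  inner_product dot -> has_deriv f t y ->
  has_deriv (fun s => `|f s| ^+ 2) t (2 * dot y (f t)).
Proof.
move=> ip fy; rewrite /has_deriv.
have -> : (fun h : R => h^-1 *: (`|f (t + h)| ^+ 2 - `|f t| ^+ 2)) =
    (fun h => dot (h^-1 *: (f (t + h) - f t)) (f (t + h) - f t) +
              2 * dot (h^-1 *: (f (t + h) - f t)) (f t)).
  apply/funext => h; rewrite !(dotZl ip) mulrCA -mulrDr; congr (_ * _).
  rewrite -!(dotxx ip) !(dotBl ip, dotBr ip) (dotC ip (f t) (f (t + h))); ring.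
rewrite -[X in _ --> X]add0r; apply: cvgD; last first.
  by apply: cvgMr; apply: (cvg_dotl ip).
have f0 : f (t + h) - f t @[h --> (0 : R)^'] --> (0 : H).
  by rewrite -(subrr (f t)); apply: cvgB; [exact: has_deriv_cvg fy|exact: cvg_cst].
have n0 : `|h^-1 *: (f (t + h) - f t)| * `|f (t + h) - f t| @[h --> (0 : R)^'] --> (0 : R).
  rewrite -[X in _ --> X](mulr0 `|y|); apply: cvgM; first exact: (cvg_norm fy).
  by rewrite -[X in _ --> X](normr0 H); exact: (cvg_norm f0).
apply/norm_cvg0P; apply: (squeeze_cvgr _ (@cvg_cst _ _ _ _ _) n0).
by apply: nearW => h; rewrite normr_ge0 (cauchy_schwarz ip).
Qed.

End has_deriv.

Section gronwall.
Variable R : realType.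

(* The derivative of [exp(- c t) f - d t] is nonpositive. *)
Lemma gronwall (f df : R -> R) (T c d : R) : 0 <= c -> 0 <= d ->
  {within `[0, T], continuous f} ->
  (forall t, 0 < t < T -> has_deriv f t (df t)) ->
  (forall t, 0 < t < T -> df t <= c * f t + d) ->
  forall t, 0 <= t <= T -> f t <= expR (c * t) * (f 0 + d * t).
Proof.
move=> c0 d0 cf fdf dfle t /andP[t0 tT].
pose g s := expR (- (c * s)) * f s - d * s.
have cg : {within `[0, T], continuous g}.
  have ce : continuous (fun s : R => expR (- (c * s))).
    move=> x; apply: (@continuous_comp _ _ _ (fun s : R => - (c * s)) expR).
      by apply: cvgN; apply: cvgMr; exact: cvg_id.
    exact: continuous_expR.
  have cd : continuous (fun s : R => d * s).
    by move=> x; apply: cvgMr; exact: cvg_id.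
  move=> x; apply: cvgB; first apply: cvgM.
  - exact: (continuous_subspaceT ce).
  - exact: cf.
  - exact: (continuous_subspaceT cd).
have dP x : x \in `]0, T[ ->
    is_derive x 1 g (expR (- (c * x)) * df x + f x * (- c * expR (- (c * x))) - d).
  rewrite in_itv/= => xab; have fx := has_deriv_is_derive (fdf _ xab).
  rewrite /g; apply: is_derive_eq.
  rewrite /GRing.scale/=; ring.
have i0 : 0 \in `[0, T] by rewrite in_itv/= lexx (le_trans t0).
have it : t \in `[0, T] by rewrite in_itv/= t0.
have g0 : g 0 = f 0 by rewrite /g !mulr0 !oppr0 expR0 mul1r addr0.
have gt : g t = expR (- (c * t)) * f t - d * t by [].
clearbody g.
have : g t <= g 0.
  apply: (@ler0_derive1_le_cc _ g 0 T _ _ cg) => //.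
  - by move=> x xab; have [] := dP x xab.
  - move=> x xab; rewrite derive1E; have [_ ->] := dP x xab.
    have := dfle x; rewrite -[0 < x < T]/(x \in `]0, T[) => /(_ xab) h.
    have cx0 : 0 <= c * x.
      by rewrite mulr_ge0//; move: xab; rewrite in_itv/= => /andP[/ltW].
    (* Since [d >= 0], this lets the linear correction [d * s] in [g] absorb the forcing term
       [exp(- c x) d]. *)
    have e1 : expR (- (c * x)) <= 1 by rewrite -expR0 ler_expR oppr_le0.
    have e0 := expR_ge0 (- (c * x)).
    have h1 := ler_wpM2l e0 h.
    have h2 : expR (- (c * x)) * d <= d by rewrite ler_piMl.
    rewrite mulrDr in h1; lra.
rewrite g0 gt lerBlDr => h.
by rewrite -ler_pdivrMl ?expR_gt0// -expRN.
Qed.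

End gronwall.

Section C0.
Variables (R : realType) (H : completeNormedModType R).
Variable S : R -> H -> H.
Hypothesis SC0 : C0_semigroup S.

Let lin t : 0 <= t -> linear (S t). Proof. by case: SC0 => + _ _ _ t0 => /(_ _ t0)[]. Qed.
Let S0 x : S 0 x = x. Proof. by case: SC0. Qed.
Let SD s t x : 0 <= s -> 0 <= t -> S (s + t) x = S s (S t x).
Proof. by case: SC0 => _ _ + _ s0 t0; apply. Qed.

Lemma C0_linear t a x y : 0 <= t -> S t (a *: x + y) = a *: S t x + S t y.
Proof. by move=> t0; exact: lin. Qed.

Lemma C0B t x y : 0 <= t -> S t (x - y) = S t x - S t y.
Proof. by move=> t0; rewrite addrC -scaleN1r C0_linear// scaleN1r addrC. Qed.

Lemma C00 t : 0 <= t -> S t 0 = 0.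
Proof. by move=> t0; rewrite -{1}(subrr (0 : H)) C0B// subrr. Qed.

Lemma C0Z t a x : 0 <= t -> S t (a *: x) = a *: S t x.
Proof. by move=> t0; rewrite -[a *: x]addr0 C0_linear// C00// addr0. Qed.

Lemma C0_small x e : 0 < e ->
  exists2 d, 0 < d & forall t, 0 <= t < d -> `|S t x - x| < e.
Proof.
move=> e0; case: SC0 => _ _ _ /(_ x)/cvgrPdist_lt/(_ _ e0)/nbhs_ballP[d /= d0 dP]; exists d => // t /andP[t0 td].
move: t0; rewrite le_eqVlt => /predU1P[<-|t0]; first by rewrite S0 subrr normr0.
by rewrite distrC; apply: dP => //; rewrite /ball/= sub0r normrN gtr0_norm.
Qed.

Let pack_linear (f : H -> H) (lf : linear f) : {linear H -> H} :=
  HB.pack f (GRing.isLinear.Build _ _ _ _ _ lf).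

Let bounded_each t : 0 <= t -> exists2 C, 0 < C & forall x, `|S t x| <= C * `|x|.
Proof.
move=> t0; have [lS cS] : linear (S t) /\ continuous (S t) by case: SC0 => + _ _ _; apply.
have := @continuous_linear_bounded _ _ _ 0 (pack_linear lS) (cS 0).
by move=> /linear_boundedP/pinfty_ex_gt0[C C0 CP]; exists C.
Qed.

(* Banach-Steinhaus along a sequence of times decreasing to 0. *)
Let bounded_near0 : exists d M, [/\ 0 < d, 1 <= M &
  forall t x, 0 <= t <= d -> `|S t x| <= M * `|x|].
Proof.
apply: contrapT => /forallNP unb.
have /choice[t tP] n : exists t, 0 <= t <= n.+1%:R^-1 /\
    exists x, n.+1%:R * `|x| < `|S t x|.
  apply: contrapT => /forallNP nt; have /forallNP := unb n.+1%:R^-1.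
  move=> /(_ n.+1%:R); apply; split; [by rewrite invr_gt0|by rewrite ler1n|].
  move=> s x s0; rewrite leNgt; apply/negP => h.
  by apply: (nt s); split => //; exists x.
have t0 n : 0 <= t n by have [/andP[]] := tP n.
have [|x|M MP] := @Banach_Steinhauss _ _ _ [set f | exists n, f = S (t n)] _ _ 1.
- move=> _ [n ->]; split; last exact: lin.
  have [C C0 CP] := bounded_each (t0 n).
  move=> r; exists (C * r) => x xr; apply: le_trans (CP x) _.
  by rewrite ler_wpM2l// ltW.
- have : (fun n => S (t n) x) @ \oo --> x.
    apply/cvgrPdist_lt => e /(C0_small x)[d d0 dP].
    near=> n; rewrite distrC; apply: dP; rewrite t0/=.
    have [/andP[_ tn] _] := tP n; apply: le_lt_trans tn _.
    by near: n; exact: near_infty_natSinv_lt (PosNum d0).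
  move=> Sx; have := cvg_seq_bounded (cvgP _ Sx).
  move=> [M [_ /(_ (M + 1))]]; rewrite ltrDl => /(_ ltr01) h.
  by exists (M + 1) => _ [n ->]; exact: h.
(* The vector that witnesses the failure at step [n], once normalized, contradicts the uniform bound
   [M] on the unit ball. *)
have [n nM] : exists n : nat, M < n.+1%:R.
  by exists (Num.truncn `|M|); apply: le_lt_trans (ler_norm M) _; exact: Num.Theory.truncnS_gt.
have [_ [x xn]] := tP n.
have x0 : 0 < `|x|.
  rewrite normr_gt0; apply/eqP => x0.
  by move: xn; rewrite x0 C00// !normr0 mulr0 ltxx.
have := MP (S (t n)) (ex_intro _ n erefl) (`|x|^-1 *: x).
rewrite normrZ normfV normr_id mulVf ?gt_eqF// lexx C0Z// normrZ normfV normr_id.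
move=> /(_ isT); rewrite ler_pdivrMl// leNgt => /negP; apply.
by apply: lt_trans xn; rewrite mulrC ltr_pM2r.
Unshelve. all: by end_near. Qed.

(** The semigroup law propagates the bound [M] on [0, d] to M^n on [0, n d]; [1 <= M] makes these
    bounds increase with n. *)
Lemma C0_bounded T : exists2 M, 0 < M &
  forall t x, 0 <= t <= T -> `|S t x| <= M * `|x|.
Proof.
have [d [M [d0 M1 dP]]] := bounded_near0.
have M0 : 0 <= M by exact: le_trans M1.
have nP n : forall t x, 0 <= t <= d *+ n -> `|S t x| <= M ^+ n * `|x|.
  elim: n => [|n IH] t x /andP[t0 tn].
    have -> : t = 0 by apply: le_anti; rewrite tn t0.
    by rewrite S0 expr0 mul1r.
  have [td|dt] := leP t d.
    apply: le_trans (dP _ _ _) _; first by rewrite t0.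
    by rewrite ler_wpM2r// exprS ler_peMr// exprn_ege1.
  have td0 : 0 <= t - d by rewrite subr_ge0 ltW.
  rewrite -(subrKC d t) SD ?(ltW d0)//.
  apply: le_trans (dP _ _ _) _; first by rewrite lexx ltW.
  rewrite exprS -mulrA ler_wpM2l//; apply: IH; rewrite td0/=.
  by rewrite lerBlDl -mulrS.
pose n := (Num.truncn (`|T| / d)).+1.
exists (M ^+ n); first by rewrite exprn_gt0// (lt_le_trans ltr01).
move=> t x /andP[t0 tT]; apply: nP; rewrite t0/= (le_trans tT)//.
apply: le_trans (ler_norm T) _; rewrite -mulr_natr mulrC -ler_pdivrMr//.
by rewrite ltW// Num.Theory.truncnS_gt.
Qed.

Lemma C0_dist (M T a b : R) x : (forall t x, 0 <= t <= T -> `|S t x| <= M * `|x|) ->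
  0 <= a -> a <= b -> b <= T -> `|S b x - S a x| <= M * `|S (b - a) x - x|.
Proof.
move=> MP a0 ab bT; have ba : 0 <= b - a by rewrite subr_ge0.
rewrite -{1}(subrKC a b) SD// -C0B//; apply: MP.
by rewrite a0 (le_trans ab).
Qed.

(** A semigroup is only constrained at nonnegative times; clamping the time makes the orbit
    continuous on the whole line. *)
Definition C0_orbit x t := S (Num.max 0 t) x.

Lemma C0_orbit_continuous x : continuous (C0_orbit x).
Proof.
move=> t; apply/cvgrPdist_lt => e e0.
have [M M0 MP] := C0_bounded (`|t| + 1).
have eM : 0 < e / M by rewrite divr_gt0.
have [d d0 dP] := C0_small x eM.
near=> s; rewrite /C0_orbit.
have st : `|s - t| < Num.min d 1.
  by near: s; apply/nbhs_ballP; exists (Num.min d 1) => /=;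
    [rewrite lt_min d0 ltr01|move=> s; rewrite /ball/= distrC].
move: st; rewrite lt_min => /andP[std st1].
have tT : Num.max 0 t <= `|t| + 1.
  by rewrite ge_max addr_ge0//= (le_trans (ler_norm t))// lerDl.
have sT : Num.max 0 s <= `|t| + 1.
  rewrite ge_max addr_ge0//=; have := ler_norm (s - t); have := ler_norm t; lra.
have m0 u : 0 <= Num.max 0 u :> R by rewrite le_max lexx.
have mst : `|Num.max 0 s - Num.max 0 t| < d.
  apply: le_lt_trans std.
  have n1 := ler_norm (s - t); have n2 := ler_norm (t - s).
  rewrite (distrC t) in n2; rewrite ler_norml.
  by case: (leP 0 s) => hs; case: (leP 0 t) => ht; apply/andP; split; lra.
have fin a b : 0 <= a -> a <= b -> b <= `|t| + 1 -> b - a < d -> `|S b x - S a x| < e.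
  move=> a0 ab bT bad; apply: le_lt_trans (C0_dist x MP a0 ab bT) _.
  by rewrite mulrC -ltr_pdivlMr//; apply: dP; rewrite subr_ge0 ab.
have [ts|st] := leP (Num.max 0 t) (Num.max 0 s).
  by rewrite distrC; apply: fin => //; apply: le_lt_trans mst; exact: ler_norm.
apply: fin => //; first exact: ltW.
by apply: le_lt_trans mst; rewrite distrC ler_norm.
Unshelve. all: by end_near. Qed.

Lemma C0_orbitE x t : 0 <= t -> C0_orbit x t = S t x.
Proof. by move=> t0; rewrite /C0_orbit (max_idPr t0). Qed.

Lemma generator_linear a x y x' y' : generator S x y -> generator S x' y' ->
  generator S (a *: x + x') (a *: y + y').
Proof.
move=> xy xy'; have h : a *: (t^-1 *: (S t x - x)) + t^-1 *: (S t x' - x')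
    @[t --> (0 : R)^'+] --> a *: y + y'.
  by apply: cvgD => //; exact: cvgZr.
rewrite /generator; apply: cvg_trans h.
apply: near_eq_cvg; near=> t; have t0 : 0 <= t by exact: ltW.
rewrite C0_linear// scalerA mulrC -scalerA -scalerDr; congr (_ *: _).
by rewrite scalerBr opprD addrACA.
Unshelve. all: by end_near. Qed.

Lemma generator_invariant t x y : 0 <= t -> generator S x y ->
  generator S (S t x) (S t y).
Proof.
move=> t0 xy; have cS : continuous (S t) by case: SC0 => + _ _ _ => /(_ _ t0)[].
have h : S t (s^-1 *: (S s x - x)) @[s --> (0 : R)^'+] --> S t y.
  by apply: continuous_cvg => //; exact: cS.
rewrite /generator; apply: cvg_trans h.
apply: near_eq_cvg; near=> s; have s0 : 0 <= s by exact: ltW.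
by rewrite C0Z// C0B// -!SD// [s + t]addrC.
Unshelve. all: by end_near. Qed.

Lemma generatorP x y e : generator S x y -> 0 < e -> exists2 d, 0 < d &
  forall t, 0 < t < d -> `|y - t^-1 *: (S t x - x)| < e.
Proof.
move=> + e0 => /cvgrPdist_lt/(_ _ e0)/nbhs_ballP[d /= d0 dP]; exists d => // t /andP[t0 td].
by apply: dP => //; rewrite /ball/= sub0r normrN gtr0_norm.
Qed.

Lemma C0_orbit_deriv x y t : generator S x y -> 0 < t -> has_deriv (C0_orbit x) t (S t y).
Proof.
move=> xy t0; apply/has_derivP => e e0.
have [M M0 MP] := C0_bounded (t + t).
have e1 : 0 < e / 2 / M by rewrite !divr_gt0.
have e2 : 0 < e / 2 by rewrite divr_gt0.
have [d d0 dP] := generatorP xy e1.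
have /cvgrPdist_lt/(_ _ e2)/nbhs_ballP[d' /= d'0 d'P] := @C0_orbit_continuous y t.
exists (Num.min (Num.min d d') t); first by rewrite !lt_min d0 d'0.
move=> h h0; rewrite !lt_min -andbA => /and3P[hd hd' ht].
have th : 0 <= t + h by have := ler_norm (- h); rewrite normrN; lra.
have th2 : t + h <= t + t by have := ler_norm h; lra.
have tt : 0 <= t <= t + t by rewrite ltW//= lerDl ltW.
have t0' := ltW t0.
rewrite !C0_orbitE//.
have [hpos|hneg] := ltP 0 h.
  have hpos' := ltW hpos; rewrite SD// -C0B// -C0Z// -C0B//.
  apply: le_trans (MP _ _ tt) _.
  have := dP h; rewrite hpos/=; rewrite gtr0_norm// in hd; rewrite hd => /(_ isT) dh.
  apply: (@le_trans _ _ (M * (e / 2 / M))); first by rewrite ler_wpM2l// ltW.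
  by rewrite mulrC divfK ?gt_eqF// ler_pdivrMr// mulr_natr mulr2n lerDl ltW.
(* For [h < 0] the quotient is [S (t + h)] applied to a forward quotient of step [- h]. Its limit is
   compared with [S (t + h) y], then with [S t y] by continuity of the orbit of [y]. *)
have {}hneg : 0 < - h by rewrite oppr_gt0 lt_neqAle h0.
have tE : t = (t + h) + (- h) by rewrite addrK.
have -> : S t x = S (t + h) (S (- h) x) by rewrite {1}tE SD// ltW.
rewrite -C0B// -C0Z//.
have -> : h^-1 *: (x - S (- h) x) = (- h)^-1 *: (S (- h) x - x).
  by rewrite invrN scaleNr -scalerN opprB.
rewrite -(subrKA (S (t + h) y)) -C0B//.
apply: le_trans (ler_normD _ _) _; rewrite (splitr e) lerD//.
  have := d'P (t + h); rewrite /ball/= opprD addrA subrr sub0r normrN => /(_ hd').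
  by rewrite !C0_orbitE// => /ltW.
apply: le_trans (MP _ _ _) _; first by rewrite th th2.
have nd : - h < d by apply: le_lt_trans hd; rewrite -normrN ler_norm.
have := dP (- h); rewrite hneg nd => /(_ isT) dh.
apply: (@le_trans _ _ (M * (e / 2 / M))); first by rewrite ler_wpM2l// ltW.
by rewrite mulrC divfK ?gt_eqF.
Qed.

End C0.

(** * Time averages of orbits and density of the domain of A^2 *)

Section interval_integrals.
Variable R : realType.
Notation lambda := (@lebesgue_measure R).
Variable g : R -> R.
Hypothesis cg : continuous g.

Lemma continuous_itv_integrable (a b : R) :
  lambda.-integrable `[a, b] (EFin \o g).
Proof.
apply: continuous_compact_integrable; first exact: segment_compact.
exact: continuous_subspaceT.
Qed.

Lemma integral_itv_shift (t h : R) : 0 <= h ->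
  \int[lambda]_(s in `[0, h]) g (s + t) = \int[lambda]_(s in `[t, h + t]) g s.
Proof.
move=> h0; pose F (s : R) := s + t.
have F1 (s : R) : is_derive s 1 F 1.
  by rewrite /F; apply: is_derive_eq; rewrite addr0.
have dF : derive1 F = cst 1 by apply/funext => s; rewrite derive1E; have [_ ->] := F1 s.
have := @integration_by_substitution_increasing R F g 0 h h0.
have F0 : F 0 = t by rewrite /F add0r.
rewrite dF F0 => E; rewrite /Rintegral E.
- by congr fine; apply: eq_integral => s _ /=; rewrite fctE /= mulr1.
- by move=> x y _ _ xy; rewrite /F ltrD2r.
- by move=> x _; exact: cvg_cst.
- exact: is_cvg_cst.
- exact: is_cvg_cst.
- have cF x : F y @[y --> x] --> F x by apply: cvgD; [exact: cvg_id|exact: cvg_cst].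
  split.
  + by move=> x _; have [] := F1 x.
  + by apply: cvg_at_right_filter; exact: cF.
  + by apply: cvg_at_left_filter; exact: cF.
- exact: continuous_subspaceT.
Qed.

Lemma integral_itv_split (a b c : R) : a <= b -> b <= c ->
  \int[lambda]_(s in `[a, c]) g s =
  \int[lambda]_(s in `[a, b]) g s + \int[lambda]_(s in `[b, c]) g s.
Proof.
move=> ab bc; have := @Rintegral_itvB R g (BLeft a) (BRight c) b.
move=> /(_ (continuous_itv_integrable a c)); rewrite !bnd_simp => /(_ ab bc).
rewrite Rintegral_itv_obnd_cbnd => [<-|]; first by rewrite addrC subrK.
apply: integrableS (continuous_itv_integrable b c) => //.
exact: subset_itv_oc_cc.
Qed.

Lemma integral_itv_near (a t c e : R) : 0 <= t -> 0 <= e ->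
  (forall s, a <= s <= a + t -> `|g s - c| <= e) ->
  `|\int[lambda]_(s in `[a, a + t]) g s - t * c| <= t * e.
Proof.
move=> t0 e0 gc.
have lE : fine (lambda `[a, a + t]%classic) = t.
  rewrite lebesgue_measure_itv/= lte_fin ltrDl.
  case: ltP => [_|t0']; first by rewrite -EFinB/= addrC addKr.
  by rewrite (le_anti (introT andP (conj t0' t0))).
have Doo : (lambda `[a, (a + t)%R]%classic < +oo)%E.
  by rewrite lebesgue_measure_itv/=; case: ifP => // _; rewrite -EFinB ltry.
have mD : measurable (`[a, a + t]%classic : set (measurableTypeR R)).
  exact: measurable_itv.
have ic : lambda.-integrable `[a, a + t] (EFin \o (fun=> c)).
  apply: (@ae_bounded_integral _ _ _ _ _ _ `|c| _ _ _ _ _).1 => //.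
  by apply: aeW.
rewrite -{2}lE mulrC -Rintegral_cst// -RintegralB//; last first.
  exact: continuous_itv_integrable.
apply: le_trans (le_normr_Rintegral _ _) _ => //.
  exact: (integrableB mD (continuous_itv_integrable _ _) ic).
rewrite -[in leRHS]lE mulrC.
apply: (@ae_bounded_integral _ _ _ _ _ _ _ _ _ _ _ _).2 => //.
  apply: measurable_funB => //.
  by have /integrableP[/measurable_EFinP] := continuous_itv_integrable a (a + t).
by apply: aeW => s; rewrite /= in_itv/= => /gc.
Qed.

End interval_integrals.

Section averages.
Variables (R : realType) (H : completeNormedModType R) (dot : H -> H -> R).
Hypothesis ip : inner_product dot.
Variable S : R -> H -> H.
Hypothesis SC0 : C0_semigroup S.
Notation lambda := (@lebesgue_measure R).

Lemma C0_orbit_within x T : {within `[0, T], continuous (S^~ x)}.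
Proof.
apply: (@subspace_eq_continuous _ _ _ (C0_orbit S x)).
  by move=> t; rewrite inE/= in_itv/= => /andP[t0 _]; rewrite C0_orbitE.
apply: continuous_subspaceT; exact: C0_orbit_continuous.
Qed.

Lemma C0_integral_functional (l : H -> R) C x h : functional_bounded l C ->
  l (bochner `[0, h] (S^~ x)) = \int[lambda]_(s in `[0, h]) l (S s x).
Proof.
move=> lC.
have [] := @bochner_control _ _ _ ip h 1 (fun _ _ => 1) (fun _ s => S s x)
  (fun=> 1) _ _ _ _ l C lC => //.
- by move=> i; apply: aeW => t _; rewrite normr1.
- by move=> i; exact: C0_orbit_within.
move=> _; rewrite big_ord1; under eq_Rintegral do rewrite mul1r.
have -> // : (fun t => \sum_(i < 1) 1 *: S t x) = S^~ x.
by apply/funext => t; rewrite big_ord1 scale1r.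
Qed.

Let g x y s := dot (C0_orbit S x s) y.

Let cg x y : continuous (g x y).
Proof. by move=> s; apply: (cvg_dotl ip); exact: (C0_orbit_continuous SC0). Qed.

Lemma C0_integral_dot x y h : dot (bochner `[0, h] (S^~ x)) y =
  \int[lambda]_(s in `[0, h]) g x y s.
Proof.
rewrite (C0_integral_functional _ _ (dot_functional ip y)).
apply: eq_Rintegral => s; rewrite inE/= in_itv/= => /andP[s0 _].
by rewrite /g C0_orbitE.
Qed.

(** [z |-> dot (S t z) y] is a bounded functional, so it passes inside the integral; the semigroup
    law then shifts the interval. *)
Lemma C0_integral_shift_dot x y h t : 0 <= t -> 0 <= h ->
  dot (S t (bochner `[0, h] (S^~ x))) y = \int[lambda]_(s in `[t, h + t]) g x y s.
Proof.
move=> t0 h0; have [M M0 MP] := C0_bounded SC0 t.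
have lC : functional_bounded (fun z => dot (S t z) y) (M * `|y|).
  split => [a u v|u].
    by rewrite (C0_linear SC0)// (dotDl ip) (dotZl ip).
  rewrite mulrAC; apply: le_trans (cauchy_schwarz ip _ _) _.
  by rewrite ler_wpM2r// MP// t0 lexx.
rewrite (C0_integral_functional x h lC) -(integral_itv_shift (@cg x y))//.
apply: eq_Rintegral => s; rewrite inE/= in_itv/= => /andP[s0 _].
rewrite /g C0_orbitE ?addr_ge0//; case: SC0 => _ _ + _ => <- //.
by rewrite addrC.
Qed.

Lemma average_near x e : 0 < e -> exists2 d, 0 < d & forall h, 0 < h < d ->
  `|h^-1 *: bochner `[0, h] (S^~ x) - x| <= e.
Proof.
move=> e0; have [d d0 dP] := C0_small SC0 x e0; exists d => // h /andP[h0 hd].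
apply: (norm_le_dot ip (ltW e0)) => y.
rewrite (dotBl ip) (dotZl ip) C0_integral_dot.
have := @integral_itv_near _ _ (@cg x y) 0 h (dot x y) (e * `|y|) (ltW h0) _ _.
rewrite !add0r => /(_ _ _)/le_trans h1.
have {}h1 : `|\int[lambda]_(s in `[0, h]) g x y s - h * dot x y| <= h * (e * `|y|).
  apply: h1 => //; first by rewrite mulr_ge0// ltW.
  move=> s /andP[s0 sh]; rewrite /g C0_orbitE// -(dotBl ip).
  apply: le_trans (cauchy_schwarz ip _ _) _; rewrite ler_wpM2r// ltW//.
  by apply: dP; rewrite s0 (le_lt_trans sh).
apply: le_trans (ler_norm _) _; rewrite -(ler_pM2l h0).
rewrite -{1}(gtr0_norm h0) -normrM mulrBr mulrA divff ?gt_eqF// mul1r.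
exact: h1.
Qed.

Lemma average_generator x h : 0 < h ->
  generator S (bochner `[0, h] (S^~ x)) (S h x - x).
Proof.
move=> h0; apply/cvgrPdist_le => e e0; have e2 : 0 < e / 2 by rewrite divr_gt0.
set I := bochner _ _.
have [d1 d10 d1P] := C0_small SC0 x e2.
have [d2 d20 d2P] : exists2 d2, 0 < d2 & forall s, h <= s <= h + d2 ->
    `|C0_orbit S x s - S h x| <= e / 2.
  have /cvgrPdist_lt/(_ _ e2)/nbhs_ballP[d /= d0 dP] := @C0_orbit_continuous _ _ _ SC0 x h.
  exists (d / 2); first by rewrite divr_gt0.
  move=> s /andP[hs sd]; rewrite distrC ltW// -(C0_orbitE S x (ltW h0)); apply: dP.
  rewrite /ball/= ltr_distl; apply/andP; split; lra.
near=> t.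
have t0 : 0 < t by near: t; exact: nbhs_right_gt.
have td1 : t < d1 by near: t; exact: nbhs_right_lt.
have td2 : t < d2 by near: t; exact: nbhs_right_lt.
apply: (norm_le_dot ip (ltW e0)) => y.
have [t0' h0'] := (ltW t0, ltW h0).
rewrite (dotBl ip) (dotZl ip) (dotBl ip (S t I)) C0_integral_shift_dot//.
rewrite C0_integral_dot.
have s1 := @integral_itv_split _ _ (@cg x y) 0 t (h + t).
have s2 := @integral_itv_split _ _ (@cg x y) 0 h (h + t).
have {}s1 := s1 (ltW t0) _; have {}s2 := s2 (ltW h0) _.
(* The overlap of [t, h + t] and [0, h] cancels. Two intervals of length t remain, on which the
   orbit is close to [S h x] and to [x]. *)
have E : \int[lambda]_(s in `[t, h + t]) g x y s - \int[lambda]_(s in `[0, h]) g x y s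
   = \int[lambda]_(s in `[h, h + t]) g x y s - \int[lambda]_(s in `[0, t]) g x y s.
  have := s2; rewrite lerDl (ltW t0) => /(_ isT).
  have := s1; rewrite lerDr (ltW h0) => /(_ isT) ->; lra.
rewrite E (dotBl ip).
have y0 : 0 <= e / 2 * `|y| by rewrite mulr_ge0// ltW.
have I1 : `|\int[lambda]_(s in `[h, h + t]) g x y s - t * dot (S h x) y| <= t * (e / 2 * `|y|).
  apply: (integral_itv_near (@cg x y) (ltW t0) y0) => s /andP[hs sh].
  rewrite /g -(dotBl ip); apply: le_trans (cauchy_schwarz ip _ _) _.
  rewrite ler_wpM2r// d2P// hs/= (le_trans sh)// lerD2l ltW//.
have I2 : `|\int[lambda]_(s in `[0, t]) g x y s - t * dot x y| <= t * (e / 2 * `|y|).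
  have := @integral_itv_near _ _ (@cg x y) 0 t (dot x y) _ (ltW t0) y0.
  rewrite add0r; apply => s /andP[s0 st].
  rewrite /g -(dotBl ip); apply: le_trans (cauchy_schwarz ip _ _) _.
  by rewrite ler_wpM2r// C0_orbitE// ltW// d1P// s0 (le_lt_trans st).
rewrite -(ler_pM2l t0) mulrBr [t * (t^-1 * _)]mulrA divff ?gt_eqF// mul1r mulrBr.
move: I1 I2; rewrite !ler_norml => /andP[a1 a2] /andP[b1 b2]; lra.
Unshelve. all: by end_near. Qed.

(** Average twice. The first average [z1] lies in the domain; the generator maps the average of [z1]
    to a combination of [S k z1] and [z1], which is in the domain again. *)
Lemma generator2_dense x e : 0 < e -> exists z y w,
  [/\ generator S z y, generator S y w & `|x - z| <= e].
Proof.
move=> e0; have e2 : 0 < e / 2 by rewrite divr_gt0.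
have genZ a u v : generator S u v -> generator S (a *: u) (a *: v).
  move=> uv; have gl := @generator_linear _ _ _ SC0; have := gl a _ _ _ _ uv (gl (-1) _ _ _ _ uv uv).
  by rewrite !scaleN1r !addNr !addr0.
have genB u v u' v' : generator S u v -> generator S u' v' -> generator S (u - u') (v - v').
  move=> uv uv'; have -> : u - u' = -1 *: u' + u by rewrite scaleN1r addrC.
  have -> : v - v' = -1 *: v' + v by rewrite scaleN1r addrC.
  exact: (@generator_linear _ _ _ SC0 (-1) _ _ _ _ uv' uv).
have half (u : R) : 0 < u -> 0 < u / 2 < u.
  by move=> u0; apply/andP; split; [rewrite divr_gt0|lra].
have [d d0 dP] := average_near x e2.
have hd := half _ d0; have [h0 _] := andP hd; have z1x := dP _ hd.
set h := d / 2 in hd h0 z1x; set z1 := _ *: bochner _ _ in z1x.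
have g1 : generator S z1 (h^-1 *: (S h x - x)) by apply: genZ; exact: average_generator.
have [d' d'0 d'P] := average_near z1 e2.
have kd := half _ d'0; have [k0 _] := andP kd; have z2z1 := d'P _ kd.
set k := d' / 2 in kd k0 z2z1; set z2 := _ *: bochner _ _ in z2z1.
exists z2, (k^-1 *: (S k z1 - z1)), (k^-1 *: (S k (h^-1 *: (S h x - x)) - h^-1 *: (S h x - x))).
split.
- by apply: genZ; exact: average_generator.
- by apply: genZ; apply: genB => //; apply: generator_invariant => //; exact: ltW.
- rewrite distrC -(subrKA z1); apply: le_trans (ler_normD _ _) _.
  by rewrite (splitr e) lerD.
Qed.

End averages.

(** * Exponentials on finite-dimensional subspaces *)

Section finite_dim_exponential.
Variables (R : realType) (H : completeNormedModType R) (dot : H -> H -> R).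
Hypothesis ip : inner_product dot.
Variables (X : set H) (s : seq H) (G : H -> H).
Hypothesis sX : lin_subspace X.
Hypothesis onb : is_onb dot X s.
Hypothesis GX : forall x, X x -> X (G x).
Hypothesis Glin : forall a x y, X x -> X y -> G (a *: x + y) = a *: G x + G y.

(** For [G := galerkin_op B X] this unfolds to [galerkin_semigroup B X]; [G] is supposed linear on
    [X] only. *)
Definition expsum (t : R) (x : H) : H :=
  limn (series (fun l => (t ^+ l / l`!%:R) *: iter l G x)).

Let ser (t : R) (x : H) := series (fun l => (t ^+ l / l`!%:R) *: iter l G x).

Let G0 : G 0 = 0.
Proof.
have X0 := lin_subspace0 sX; have := Glin 1 X0 X0.
by rewrite !scale1r addr0 => /eqP; rewrite -subr_eq0 opprD addNKr oppr_eq0 => /eqP.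
Qed.

Let GZ a x : X x -> G (a *: x) = a *: G x.
Proof. by move=> Xx; rewrite -[_ *: _]addr0 Glin ?G0 ?addr0//; exact: lin_subspace0. Qed.

Let GD x y : X x -> X y -> G (x + y) = G x + G y.
Proof. by move=> Xx Xy; rewrite -[x]scale1r Glin// !scale1r. Qed.

Let GB x y : X x -> X y -> G (x - y) = G x - G y.
Proof. by move=> Xx Xy; rewrite addrC -scaleN1r Glin// scaleN1r addrC. Qed.

Let G_sum (I : eqType) (r : seq I) (F : I -> H) : (forall i, i \in r -> X (F i)) ->
  G (\sum_(i <- r) F i) = \sum_(i <- r) G (F i).
Proof.
elim: r => [|i r IH] XF; first by rewrite !big_nil G0.
have XF' j : j \in r -> X (F j) by move=> jr; apply: XF; rewrite inE jr orbT.
rewrite !big_cons GD ?IH//; first by apply: XF; rewrite mem_head.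
by rewrite big_seq; exact: lin_subspace_sum.
Qed.

Lemma finite_dim_bounded : exists2 C, 0 <= C & forall x, X x -> `|G x| <= C * `|x|.
Proof.
have [sX' [_ os] sE] := onb.
exists (\sum_(e <- s) `|G e|); first exact: sumr_ge0.
move=> x Xx; rewrite {1}(sE _ Xx) G_sum; last first.
  by move=> e es; apply: lin_subspaceZ => //; exact: sX'.
apply: le_trans (ler_norm_sum _ _ _) _; rewrite mulr_suml !big_seq.
apply: ler_sum => e es; rewrite GZ; last exact: sX'.
rewrite normrZ mulrC ler_wpM2l//; apply: le_trans (cauchy_schwarz ip _ _) _.
have : `|e| ^+ 2 = 1 by rewrite -(dotxx ip) os// eqxx.
move=> /eqP; rewrite -{1}(expr1n R 2) eqrXn2// => /eqP ->.
by rewrite mulr1.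
Qed.

(** The coordinates in the orthonormal basis pass to the limit, so the limit equals its own
    expansion. *)
Lemma finite_dim_closed (T : Type) (F : set_system T) {FF : ProperFilter F}
    (u : T -> H) x : (forall t, X (u t)) -> u @ F --> x -> X x.
Proof.
move=> Xu ux; have [sX' _ sE] := onb.
have h : (fun t => \sum_(e <- s) dot (u t) e *: e) @ F --> \sum_(e <- s) dot x e *: e.
  apply: cvg_big => [|e _]; first exact: add_continuous.
  by apply: cvgZl; exact: (cvg_dotl ip).
have uE : u = (fun t => \sum_(e <- s) dot (u t) e *: e).
  by apply/funext => t; rewrite {1}(sE _ (Xu t)).
rewrite -uE in h; rewrite (cvg_unique _ ux h)//.
by rewrite big_seq; apply: lin_subspace_sum => // e es; apply: lin_subspaceZ => //; exact: sX'.
Qed.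

Let Xiter l x : X x -> X (iter l G x).
Proof. by move=> Xx; elim: l => //= l; exact: GX. Qed.

Let Xpartial t x n : X x -> X (series (fun l => (t ^+ l / l`!%:R) *: iter l G x) n).
Proof.
move=> Xx; rewrite /series/=; apply: lin_subspace_sum => // i _.
by apply: lin_subspaceZ => //; exact: Xiter.
Qed.

Lemma is_cvg_expsum t x : X x ->
  cvgn (series (fun l => (t ^+ l / l`!%:R) *: iter l G x)).
Proof.
move=> Xx; have [C C0 GC] := finite_dim_bounded.
have iC l : `|iter l G x| <= C ^+ l * `|x|.
  elim: l => [|l IH]; first by rewrite expr0 mul1r.
  rewrite iterS; apply: le_trans (GC _ (Xiter _ Xx)) _.
  by rewrite exprS -mulrA ler_wpM2l.
apply: normed_cvg.
apply: (@series_le_cvg _ _ (`|x| *: exp_coeff (`|t| * C))).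
- by move=> n /=.
- by move=> n; rewrite fctE mulr_ge0// exp_coeff_ge0// mulr_ge0.
- move=> n; rewrite fctE /= normrZ normrM normfV normrX (ger0_norm (ler0n R n`!)).
  rewrite mulrC [leRHS]mulrCA exprMn -mulrA.
  apply: le_trans (ler_wpM2r _ (iC n)) _; first by rewrite mulr_ge0// ?invr_ge0// exprn_ge0.
  by rewrite le_eqVlt; apply/orP; left; apply/eqP; ring.
- by apply: is_cvg_seriesZ; exact: is_cvg_series_exp_coeff.
Qed.

Lemma expsum_cvg t x : X x ->
  series (fun l => (t ^+ l / l`!%:R) *: iter l G x) @ \oo --> expsum t x.
Proof. by move=> Xx; have := @is_cvg_expsum t _ Xx. Qed.
Arguments expsum_cvg t {x} _.

Lemma expsum_in t x : X x -> X (expsum t x).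
Proof.
move=> Xx; apply: (finite_dim_closed _ (expsum_cvg t Xx)) => n.
exact: Xpartial.
Qed.

Lemma expsum0 x : expsum 0 x = x.
Proof.
(* The partial sum of index 0 is empty; all later ones equal [x]. *)
apply: cvg_lim => //; rewrite -cvg_shiftS /=.
apply: cvg_near_cst; apply: nearW => n /=.
rewrite /series/= big_nat_recl//= expr0 fact0 divr1 scale1r big1 ?addr0// => i _.
by rewrite expr0n/= mul0r scale0r.
Qed.

Lemma expsumB t x y : X x -> X y -> expsum t (x - y) = expsum t x - expsum t y.
Proof.
move=> Xx Xy; apply: cvg_lim => //; rewrite -/(ser _ _).
have -> : ser t (x - y) = (fun n => ser t x n - ser t y n); last first.
  exact: cvgB (expsum_cvg t Xx) (expsum_cvg t Xy).
apply/funext => n; rewrite /ser /series/= -sumrB; apply: eq_bigr => l _; rewrite -scalerBr; congr (_ *: _).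
by elim: l => //= l ->; rewrite GB//; exact: Xiter.
Qed.

Lemma expsum_lin t a x y : X x -> X y ->
  expsum t (a *: x + y) = a *: expsum t x + expsum t y.
Proof.
move=> Xx Xy; apply: cvg_lim => //; rewrite -/(ser _ _).
have -> : ser t (a *: x + y) = (fun n => a *: ser t x n + ser t y n); last first.
  exact: cvgD (cvgZr (expsum_cvg t Xx)) (expsum_cvg t Xy).
apply/funext => n; rewrite /ser /series/= scaler_sumr -big_split/=; apply: eq_bigr => l _.
have -> : iter l G (a *: x + y) = a *: iter l G x + iter l G y.
  by elim: l => //= l ->; rewrite Glin//; exact: Xiter.
by rewrite scalerDr !scalerA mulrC.
Qed.

Lemma expsum_comm t x : X x -> G (expsum t x) = expsum t (G x).
Proof.
move=> Xx; have [C C0 GC] := finite_dim_bounded.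
have c1 : G (ser t x n) @[n --> \oo]
    --> G (expsum t x).
  apply/cvgrPdist_lt => e e0.
  have e1 : 0 < e / (C + 1) by rewrite divr_gt0// ltr_wpDl.
  have /cvgrPdist_lt/(_ _ e1) := expsum_cvg t Xx; apply: filterS => n xn.
  rewrite -GB; [|exact: expsum_in|exact: Xpartial].
  apply: le_lt_trans (GC _ _) _.
    by apply: lin_subspaceB => //; [exact: expsum_in|exact: Xpartial].
  apply: (@le_lt_trans _ _ ((C + 1) * `|expsum t x - ser t x n|)).
    by rewrite ler_wpM2r// lerDl.
  by rewrite mulrC -ltr_pdivlMr// ltr_wpDl.
apply: (cvg_unique _ c1) => //.
have -> : (fun n => G (ser t x n)) = ser t (G x); last exact: (expsum_cvg t (GX Xx)).
apply/funext => n; rewrite /ser /series/= G_sum.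
  by apply: eq_bigr => l _; rewrite GZ; [rewrite -iterS iterSr|exact: Xiter].
by move=> l _; apply: lin_subspaceZ => //; exact: Xiter.
Qed.

Let coef x e l := dot (iter l G x) e / l`!%:R.

Let coef_cvg x e t : X x -> pseries (coef x e) t @ \oo --> dot (expsum t x) e.
Proof.
move=> Xx.
have -> : pseries (coef x e) t = (fun n => dot (ser t x n) e); last first.
  exact: (@cvg_dotl _ _ _ ip _ _ _ _ _ e (expsum_cvg t Xx)).
apply/funext => n; rewrite /ser /pseries /series/= (dot_suml ip); apply: eq_bigr => l _.
by rewrite (dotZl ip) /coef mulrC mulrA mulrAC.
Qed.

Let coef_diffs x e : pseries_diffs (coef x e) = coef (G x) e.
Proof.
apply/funext => i; rewrite /pseries_diffs /coef -iterSr factS natrM invfM.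
by rewrite mulrCA mulVKf ?pnatr_eq0.
Qed.

(** Each coordinate is a scalar power series; differentiating it term by term replaces the
    coefficients of [x] by those of [G x], and the basis reassembles the coordinates. *)
Lemma expsum_deriv t x : X x -> has_deriv (expsum ^~ x) t (G (expsum t x)).
Proof.
move=> Xx; have [sX' _ sE] := onb.
have ce e : h^-1 *: (dot (expsum (t + h) x) e - dot (expsum t x) e)
    @[h --> (0 : R)^'] --> dot (G (expsum t x)) e.
  have XG := GX Xx; have XGG := GX XG.
  (* Termwise differentiation asks for convergence at a point farther from 0 than [t]; the series
     converge everywhere, and [|t| + 1] will do. *)
  have tK : `|t| < `| `|t| + 1 | by apply: (@lt_le_trans _ _ (`|t| + 1)); [rewrite ltrDl|exact: ler_norm].
  have := @pseries_snd_diffs R (coef x e) (`|t| + 1) t; rewrite !coef_diffs.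
  move=> /(_ (cvgP _ (@coef_cvg _ e _ Xx)) (cvgP _ (@coef_cvg _ e _ XG))
    (cvgP _ (@coef_cvg _ e _ XGG)) tK) [].
  have -> : (fun x0 => limn (pseries (coef x e) x0)) = (fun r => dot (expsum r x) e).
    by apply/funext => r; exact: (cvg_lim (@Rhausdorff R) (@coef_cvg _ e r Xx)).
  move=> + hD; rewrite (expsum_comm t Xx).
  rewrite -(cvg_lim (@Rhausdorff R) (@coef_cvg _ e t XG)) -hD.
  rewrite /derivable /derive => /cvg_ex[l hl].
  have E : (fun h : R => h^-1 *: (((fun r => dot (expsum r x) e) \o shift t)
        (h *: (1 : R)) - dot (expsum t x) e)) =
      (fun h => h^-1 *: (dot (expsum (t + h) x) e - dot (expsum t x) e)).
    by apply/funext => h /=; rewrite -[h *: 1]/(h * 1) mulr1 [h + t]addrC.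
  by rewrite E in hl *; rewrite (cvg_lim _ hl).
have h : (fun h => \sum_(e <- s) (h^-1 *: (dot (expsum (t + h) x) e -
    dot (expsum t x) e)) *: e) @ (0 : R)^' --> \sum_(e <- s) dot (G (expsum t x)) e *: e.
  apply: cvg_big => [|e _]; first exact: add_continuous.
  by apply: cvgZl; exact: ce.
rewrite /has_deriv (sE _ (GX (expsum_in t Xx))).
set q := (X in X @ _ --> _).
have -> // : q = (fun h => \sum_(e <- s) (h^-1 *: (dot (expsum (t + h) x) e -
    dot (expsum t x) e)) *: e).
apply/funext => {}h; rewrite /q {1}(sE _ (expsum_in (t + h) Xx)) {1}(sE _ (expsum_in t Xx)).
rewrite -sumrB scaler_sumr; apply: eq_bigr => e _.
by rewrite -scalerBl scalerA.
Qed.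

End finite_dim_exponential.

(** * Energy estimates and convergence of the Galerkin semigroups *)

Section galerkin_form.
Variables (R : realType) (H : completeNormedModType R) (dot : H -> H -> R).
Hypothesis ip : inner_product dot.
Variables (W V : set H) (vdot B : H -> H -> R) (M kappa kappa0 : R).
Hypothesis sW : lin_subspace W.
Hypothesis bV : bilinear_on W vdot.
Hypothesis vC : forall x y, W x -> W y -> vdot x y = vdot y x.
Hypothesis vge : forall x, W x -> `|x| ^+ 2 <= vdot x x.
Hypothesis bB : bilinear_on W B.
Hypothesis M0 : 0 <= M.
Hypothesis BM : forall u v, W u -> W v ->
  `|B u v| <= M * Num.sqrt (vdot u u) * Num.sqrt (vdot v v).
Hypothesis VW : V `<=` W.
Hypothesis kappa_ge0 : 0 <= kappa.
Hypothesis kappa0_gt0 : 0 < kappa0.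
Hypothesis gard : forall x, V x ->
  kappa0 * vdot x x <= B x x + kappa * `|x| ^+ 2.

Let v0 x : W x -> 0 <= vdot x x.
Proof. by move=> Wx; apply: le_trans (vge Wx); exact: sqr_ge0. Qed.

Lemma norm_le_vdot x d : W x -> vdot x x <= d ^+ 2 -> 0 <= d -> `|x| <= d.
Proof.
by move=> Wx xd d0; rewrite -ler_sqr ?nnegrE//; apply: le_trans (vge Wx) xd.
Qed.

Section semigroup.
Variable S : R -> H -> H.
Hypothesis SC0 : C0_semigroup S.
Hypothesis gen : forall x y,
  (V x /\ forall psi, V psi -> dot (- y) psi = B x psi) <-> generator S x y.

Lemma generator_V x y : generator S x y -> V x.
Proof. by move=> /gen[]. Qed.

(* Garding's inequality turns the graph norm of A into a bound on vdot. *)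
Lemma vdot_generator x y : generator S x y ->
  kappa0 * vdot x x <= `|y| * `|x| + kappa * `|x| ^+ 2.
Proof.
move=> /gen[Vx xy]; apply: le_trans (gard Vx) _; rewrite lerD2r -xy//.
by apply: le_trans (dot_le ip _ _) _; rewrite normrN.
Qed.

(** This will be applied to differences and to difference quotients of orbits, to pass from L_2
    limits to H^1_0 limits. *)
Lemma vdot_generator_small x y e : generator S x y -> 0 <= e ->
  `|y| <= e -> `|x| <= e -> vdot x x <= (1 + kappa) / kappa0 * e ^+ 2.
Proof.
move=> xy e0 ye xe; rewrite mulrAC ler_pdivlMr// mulrC.
apply: le_trans (vdot_generator xy) _; rewrite mulrDl mul1r lerD//.
  by rewrite expr2 ler_pM.
by rewrite ler_wpM2l// ler_sqr ?nnegrE.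
Qed.

Lemma generatorB x y x' y' : generator S x y -> generator S x' y' ->
  generator S (x - x') (y - y').
Proof.
move=> xy xy'; have -> : x - x' = -1 *: x' + x by rewrite scaleN1r addrC.
have -> : y - y' = -1 *: y' + y by rewrite scaleN1r addrC.
exact: (@generator_linear _ _ _ SC0 (-1) _ _ _ _ xy' xy).
Qed.

Lemma generatorZ a x y : generator S x y -> generator S (a *: x) (a *: y).
Proof.
move=> xy; have := @generator_linear _ _ _ SC0 a _ _ _ _ xy (generatorB xy xy).
by rewrite !subrr !addr0.
Qed.

Section fixed_subspace.
Variables (X : set H) (s sv : seq H) (G P : H -> H).
Hypothesis sX : lin_subspace X.
Hypothesis XV : X `<=` V.
Hypothesis onb : is_onb dot X s.
Hypothesis onbv : is_onb vdot X sv.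
Hypothesis GP : forall x, X x -> X (G x) /\ forall y, X y -> dot (G x) y = - B x y.
Hypothesis PP : forall x, X (P x) /\ forall y, X y -> dot (x - P x) y = 0.

Let XW x : X x -> W x. Proof. by move=> /XV/VW. Qed.

Let GX x : X x -> X (G x). Proof. by move=> /GP[]. Qed.

Let X_ext x y : X x -> X y -> (forall z, X z -> dot x z = dot y z) -> x = y.
Proof.
move=> Xx Xy xy; apply/eqP; rewrite -subr_eq0 -normr_eq0 -sqrf_eq0 -(dotxx ip).
by rewrite (dotBl ip) xy ?subrr//; exact: lin_subspaceB.
Qed.

Let Glin a x y : X x -> X y -> G (a *: x + y) = a *: G x + G y.
Proof.
move=> Xx Xy; have Xaxy : X (a *: x + y) by exact: sX.2.
apply: X_ext => [||z Xz]; first exact: GX.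
  by apply: sX.2; exact: GX.
rewrite (GP Xaxy).2// (dotDl ip) (dotZl ip) (GP Xx).2// (GP Xy).2//.
by rewrite bB.1//; [ring|exact: XW|exact: XW|exact: XW].
Qed.

Lemma galerkin_proj_lin a x y : P (a *: x + y) = a *: P x + P y.
Proof.
apply: X_ext => [||z Xz]; first exact: (PP _).1.
  by apply: sX.2; exact: (PP _).1.
have h u : dot (P u) z = dot u z.
  by have := (PP u).2 _ Xz; rewrite (dotBl ip) => /eqP; rewrite subr_eq0 => /eqP.
by rewrite (dotDl ip) (dotZl ip) !h (dotDl ip) (dotZl ip).
Qed.

Lemma galerkin_projB x y : P (x - y) = P x - P y.
Proof. by rewrite addrC -scaleN1r galerkin_proj_lin scaleN1r addrC. Qed.

Lemma galerkin_proj_contr x : `|P x| <= `|x|.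
Proof.
have [XP /(_ _ XP)] := PP x; rewrite (dotBl ip) (dotxx ip) => /eqP.
rewrite subr_eq0 => /eqP h; have := dot_le ip x (P x); rewrite h expr2.
have [->|Px0] := eqVneq (P x) 0; first by rewrite normr0.
by rewrite ler_pM2r// normr_gt0.
Qed.

Notation T := (expsum G).

(** The derivative of the squared norm of v = T t x is -2 B(v, v), at most 2 kappa |v|^2 by Garding.
    The rate does not depend on the subspace, whence stability uniform in K. *)
Lemma galerkin_stable t x : 0 <= t -> X x -> `|T t x| ^+ 2 <= expR (2 * kappa * t) * `|x| ^+ 2.
Proof.
move=> t0 Xx; have XT r : X (T r x) by exact: (expsum_in ip sX onb GX Glin).
have dT r := @expsum_deriv _ _ _ ip _ _ _ sX onb GX Glin r _ Xx.
have df r := has_deriv_dot ip (dT r).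
have k2 : 0 <= 2 * kappa by rewrite mulr_ge0.
have := @gronwall _ _ _ t (2 * kappa) 0 k2 (lexx 0) _ (fun r _ => df r) _ t.
rewrite mul0r addr0 expsum0 t0 lexx; apply => //.
  apply: continuous_subspaceT => r.
  have [+ _] := has_deriv_is_derive (df r); move=> /derivable1_diffP.
  exact: differentiable_continuous.
move=> r _; rewrite addr0 -mulrA ler_pM2l// (GP (XT r)).2// lerNl.
have := gard (XV (XT r)); have := mulr_ge0 (ltW kappa0_gt0) (v0 (XW (XT r))); lra.
Qed.

(** The H^1_0-orthogonal projection onto [X], written in a [vdot]-orthonormal basis; it is linear on
    [W]. *)
Definition vproj (x : H) := \sum_(e <- sv) vdot x e *: e.

Lemma vproj_in x : X (vproj x).
Proof.
have [sX' _ _] := onbv; rewrite /vproj big_seq.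
by apply: lin_subspace_sum => // e es; apply: lin_subspaceZ => //; exact: sX'.
Qed.

Let svW e : e \in sv -> W e. Proof. by case: onbv => + _ _ es; move=> /(_ _ es)/XW. Qed.

Lemma vprojB x y : W x -> W y -> vproj (x - y) = vproj x - vproj y.
Proof.
move=> Wx Wy; rewrite /vproj -sumrB !big_seq; apply: eq_bigr => e /svW We.
by rewrite (bilBl bV)// scalerBl.
Qed.

Lemma vprojZ a x : W x -> vproj (a *: x) = a *: vproj x.
Proof.
move=> Wx; rewrite /vproj scaler_sumr !big_seq; apply: eq_bigr => e /svW We.
by rewrite (bilZl sW bV)// scalerA.
Qed.

Let vproj_orth x y : W x -> X y -> vdot (x - vproj x) y = 0.
Proof.
move=> Wx Xy; have [sX' [us os] sE] := onbv; have Wp := XW (vproj_in x).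
have he e : e \in sv -> vdot (vproj x) e = vdot x e.
  move=> es; have We := svW es; rewrite /vproj (bil_suml sW bV)//; last first.
    by move=> z /svW Wz; exact: lin_subspaceZ.
  rewrite (bigD1_seq e)//= (bilZl sW bV)// (os e e)// eqxx mulr1.
  rewrite big_seq_cond big1 ?addr0// => z /andP[zs ze]; have Wz := svW zs.
  by rewrite (bilZl sW bV)// (os z e)// (negbTE ze) mulr0.
have Wxp : W (x - vproj x) by exact: lin_subspaceB.
rewrite vC//; last exact: XW.
rewrite (sE _ Xy) (bil_suml sW bV)//; last first.
  by move=> e /svW We; exact: lin_subspaceZ.
rewrite big_seq big1// => e es; have We := svW es.
by rewrite (bilZl sW bV)// (vC We Wxp) (bilBl bV)// he// subrr mulr0.
Qed.

(* Pythagoras in the vdot inner product. *)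
Lemma vproj_best x y : W x -> X y ->
  vdot (x - vproj x) (x - vproj x) <= vdot (x - y) (x - y).
Proof.
move=> Wx Xy; have Wp := XW (vproj_in x); have Wy := XW Xy.
have Xd : X (vproj x - y) by apply: lin_subspaceB => //; exact: vproj_in.
have [Wd Wo] := (XW Xd, lin_subspaceB sW Wx Wp).
have -> : x - y = (x - vproj x) + (vproj x - y) by rewrite addrA subrK.
rewrite (bilDl bV Wo Wd (lin_subspaceD sW Wo Wd)).
rewrite (bilDr bV Wo Wd Wo) (bilDr bV Wo Wd Wd) (vC Wd Wo) (vproj_orth Wx Xd) addr0 add0r.
by rewrite lerDl v0.
Qed.

Lemma vproj_contr x : W x -> vdot (vproj x) (vproj x) <= vdot x x.
Proof.
move=> Wx; have Wp := XW (vproj_in x); have Wo := lin_subspaceB sW Wx Wp.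
have {3 4}-> : x = (x - vproj x) + vproj x by rewrite subrK.
rewrite (bilDl bV Wo Wp (lin_subspaceD sW Wo Wp)).
rewrite (bilDr bV Wo Wp Wo) (bilDr bV Wo Wp Wp) (vC Wp Wo).
by rewrite (vproj_orth Wx (vproj_in x)) addr0 add0r lerDr v0.
Qed.

Section error.
Variables (phi phi1 phi2 : H) (tf d : R).
Hypotheses (g1 : generator S phi phi1) (g2 : generator S phi1 phi2).
Hypothesis d0 : 0 <= d.
Notation u := (C0_orbit S phi).
Notation u1 := (C0_orbit S phi1).
Hypothesis eta_le : forall t, 0 <= t <= tf ->
  vdot (u t - vproj (u t)) (u t - vproj (u t)) <= d.
Hypothesis eta1_le : forall t, 0 <= t <= tf ->
  vdot (u1 t - vproj (u1 t)) (u1 t - vproj (u1 t)) <= d.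

Let max0 t : 0 <= Num.max 0 t :> R. Proof. by rewrite le_max lexx. Qed.

Let gu t : generator S (u t) (u1 t).
Proof. exact: (generator_invariant SC0 (max0 t) g1). Qed.

Let Wu t : W (u t). Proof. exact/VW/(generator_V (@gu t)). Qed.

Let Wu1 t : W (u1 t).
Proof. exact/VW/(generator_V (generator_invariant SC0 (max0 t) g2)). Qed.

Let C := (1 + kappa) / kappa0.

Let C0 : 0 <= C. Proof. by rewrite divr_ge0 ?addr_ge0// ltW. Qed.

(** [vproj] is a contraction for [vdot], not for the norm of [H]; smallness of its value is drawn
    from the graph norm instead. *)
Let vproj_small x y e : generator S x y -> 0 <= e -> `|y| <= e -> `|x| <= e ->
  `|vproj x| <= Num.sqrt C * e.
Proof.
move=> xy e0 ye xe; have Wx := VW (generator_V xy).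
apply: norm_le_vdot; [exact/XW/vproj_in| |by rewrite mulr_ge0// sqrtr_ge0].
rewrite exprMn sqr_sqrtr//; apply: le_trans (vproj_contr Wx) _.
exact: vdot_generator_small xy _ _ _.
Qed.

Let cvproj : continuous (fun t => vproj (u t)).
Proof.
move=> t; apply/cvgrPdist_le => e e0.
have e1 : 0 < e / (Num.sqrt C + 1) by rewrite divr_gt0// ltr_wpDl// sqrtr_ge0.
have /cvgrPdist_le/(_ _ e1) h := @C0_orbit_continuous _ _ _ SC0 phi t.
have /cvgrPdist_le/(_ _ e1) h1 := @C0_orbit_continuous _ _ _ SC0 phi1 t.
apply: filterS2 h h1 => r h h1; rewrite -vprojB//.
apply: le_trans (vproj_small (generatorB (@gu t) (@gu r)) (ltW e1) h1 h) _.
rewrite mulrCA -[leRHS]mulr1 ler_wpM2l ?(ltW e0)// ler_pdivrMr ?ltr_wpDl ?sqrtr_ge0//.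
by rewrite mul1r lerDl.
Qed.

(** [vproj] is applied to [u1 t] minus the difference quotient of [u]. The generator sends that
    vector to the orbit of [phi2] minus the difference quotient of [u1], so the existence of [phi2]
    makes both small. *)
Let dvproj t : 0 < t -> has_deriv (fun t => vproj (u t)) t (vproj (u1 t)).
Proof.
move=> t0; apply/has_derivP => e e0.
have e1 : 0 < e / (Num.sqrt C + 1) by rewrite divr_gt0// ltr_wpDl// sqrtr_ge0.
have [a a0 h] := (has_derivP _ _ _).1 (C0_orbit_deriv SC0 g1 t0) _ e1.
have [b b0 h1] := (has_derivP _ _ _).1 (C0_orbit_deriv SC0 g2 t0) _ e1.
exists (Num.min a b); first by rewrite lt_min a0 b0.
move=> r r0; rewrite lt_min => /andP[ra rb].
have {h}h := h _ r0 ra; have {h1}h1 := h1 _ r0 rb.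
rewrite -vprojB// -vprojZ//; last exact: lin_subspaceB.
rewrite -vprojB//; last by apply: lin_subspaceZ => //; exact: lin_subspaceB.
have g3 := generator_invariant SC0 (max0 t) g2.
rewrite -C0_orbitE in h; last exact: ltW.
rewrite -C0_orbitE in h1; last exact: ltW.
have gr := generatorB g3 (@generatorZ r^-1 _ _ (generatorB (@gu (t + r)) (@gu t))).
apply: le_trans (vproj_small gr (ltW e1) h1 h) _.
rewrite mulrCA -[leRHS]mulr1 ler_wpM2l ?(ltW e0)// ler_pdivrMr ?ltr_wpDl ?sqrtr_ge0//.
by rewrite mul1r lerDl.
Qed.

Let zeta t := vproj (u t) - T t (P phi).

Let XT t : X (T t (P phi)).
Proof. exact: (expsum_in ip sX onb GX Glin _ (PP _).1). Qed.

Let Xzeta t : X (zeta t).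
Proof. by apply: lin_subspaceB => //; exact: vproj_in. Qed.

Let dzeta t : 0 < t ->
  has_deriv zeta t (vproj (u1 t) - G (T t (P phi))).
Proof.
move=> t0; apply: has_derivB; first exact: dvproj.
exact: (@expsum_deriv _ _ _ ip _ _ _ sX onb GX Glin t _ (PP _).1).
Qed.

(** [zeta] lies in [X], hence in [V], so it can test both the equation of the orbit and the Galerkin
    equation. In the constant, 1 comes from the projection error of [u1] and M^2 / (2 kappa0) from
    that of [u]. *)
Let energy t : 0 <= t <= tf ->
  2 * dot (vproj (u1 t) - G (T t (P phi))) (zeta t) <=
  (2 * kappa + 1) * `|zeta t| ^+ 2 + (1 + M ^+ 2 / (2 * kappa0)) * d.
Proof.
move=> tT; have Xz := Xzeta t; have Wz := XW Xz.
pose eta := u t - vproj (u t); pose eta1 := u1 t - vproj (u1 t).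
have Wp := XW (vproj_in (u t)); have WT := XW (XT t).
have We : W eta by exact: lin_subspaceB.
have We1 : W eta1 by apply: lin_subspaceB => //; exact/XW/vproj_in.
(* Subtracting the two equations leaves the projection errors [eta], [eta1] and the coercive
   term. *)
have E : dot (vproj (u1 t) - G (T t (P phi))) (zeta t) =
    - dot eta1 (zeta t) - B eta (zeta t) - B (zeta t) (zeta t).
  rewrite (dotBl ip) (GP (XT t)).2// opprK.
  have -> : vproj (u1 t) = u1 t - eta1 by rewrite /eta1 opprB addrC subrK.
  rewrite (dotBl ip).
  have -> : T t (P phi) = u t - (eta + zeta t).
    by rewrite /eta /zeta addrA subrK opprB addrC subrK.
  rewrite (bilBl bB)//; last exact: (lin_subspaceD sW).
  rewrite (bilDl bB)//.
  have [_ /(_ _ (XV Xz))] := (gen _ _).2 (@gu t); rewrite (dotNl ip) => <-; ring.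
have h1 : - dot eta1 (zeta t) <= `|zeta t| * Num.sqrt d.
  rewrite -(dotNl ip); apply: le_trans (dot_le ip _ _) _; rewrite normrN mulrC.
  rewrite ler_wpM2l//; apply: norm_le_vdot => //.
  by rewrite sqr_sqrtr//; exact: eta1_le.
have h2 : - B eta (zeta t) <= M * Num.sqrt d * Num.sqrt (vdot (zeta t) (zeta t)).
  apply: le_trans (ler_norm _) _; rewrite normrN; apply: le_trans (BM We Wz) _.
  rewrite ler_wpM2r ?sqrtr_ge0// ler_wpM2l// ler_wsqrtr//; exact: eta_le.
have h3 := gard (XV Xz).
rewrite E.
set n := `|zeta t| in h1 h3 *; set q := vdot (zeta t) (zeta t) in h2 h3.
have q0 : 0 <= q by exact: v0.
have [sd sq] := (sqr_sqrtr d0, sqr_sqrtr q0).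
(* Young's inequality absorbs the cross term into kappa0 * q. *)
have y1 : n * Num.sqrt d <= n ^+ 2 / 2 + d / 2.
  have := sqr_ge0 (n - Num.sqrt d); rewrite sqrrB sd -mulr_natr; lra.
have y2 : M * Num.sqrt d * Num.sqrt q <= kappa0 * q + M ^+ 2 / (4 * kappa0) * d.
  have := sqr_ge0 (2 * kappa0 * Num.sqrt q - M * Num.sqrt d).
  rewrite sqrrB !exprMn sd sq => y.
  have k4 : 0 < 4 * kappa0 by rewrite mulr_gt0.
  rewrite -subr_ge0 -(pmulr_rge0 _ k4); apply: le_trans y _.
  rewrite le_eqVlt; apply/orP; left; apply/eqP; field.
  by rewrite gt_eqF.
have -> : M ^+ 2 / (2 * kappa0) = 2 * (M ^+ 2 / (4 * kappa0)).
  by field; rewrite gt_eqF.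
rewrite (_ : (1 + 2 * (M ^+ 2 / (4 * kappa0))) * d = d + 2 * (M ^+ 2 / (4 * kappa0) * d)); last by ring.
lra.
Qed.

(** The error is [eta + zeta]: each squared norm carries a factor 2, [eta] contributes d, and
    Gronwall bounds [zeta] from initial value d and forcing [(1 + M ^+ 2 / (2 * kappa0)) * d]. *)
Definition galerkin_const : R :=
  2 + 2 * expR ((2 * kappa + 1) * tf) * (1 + (1 + M ^+ 2 / (2 * kappa0)) * tf).

Lemma galerkin_error t : 0 <= t <= tf ->
  `|S t phi - T t (P phi)| ^+ 2 <= galerkin_const * d.
Proof.
move=> tT; have [t0 t1] := andP tT.
have tf0 : 0 <= tf by exact: le_trans t0 t1.
pose c := 2 * kappa + 1; pose D := 1 + M ^+ 2 / (2 * kappa0).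
have c0 : 0 <= c by rewrite addr_ge0// mulr_ge0.
have D0 : 0 <= D by rewrite addr_ge0// divr_ge0 ?sqr_ge0// mulr_ge0// ltW.
have Dd0 : 0 <= D * d by rewrite mulr_ge0.
have cz : {within `[0, tf], continuous (fun t => `|zeta t| ^+ 2)}.
  apply: continuous_subspaceT => r.
  have cz : zeta x @[x --> r] --> zeta r.
    apply: cvgB; first exact: cvproj.
    have dT := @expsum_deriv _ _ _ ip _ _ _ sX onb GX Glin r _ (PP phi).1.
    (* The derivative yields only a punctured limit, to which the point [r] is added by hand. *)
    have := has_deriv_cvg dT => /cvgrPdist_lt h; apply/cvgrPdist_lt => e e0.
    have /nbhs_ballP[a a0 ha] := h _ e0.
    apply/nbhs_ballP; exists a => // y; rewrite /ball/= => ry.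
    have [->|yr] := eqVneq y r; first by rewrite subrr normr0.
    rewrite -{1}(subrKC r y); apply: (ha (y - r)); last by rewrite subr_eq0.
    by rewrite /ball/= sub0r opprB.
  by apply: cvgM; exact: cvg_norm.
(* [vproj phi - P phi] is the L_2-projection of [vproj phi - phi], so it is no longer than the
   initial projection error. *)
have z0 : `|zeta 0| ^+ 2 <= d.
  rewrite /zeta expsum0 C0_orbitE//.
  have Sphi : S 0 phi = phi by case: SC0.
  have e0 : vdot (phi - vproj phi) (phi - vproj phi) <= d.
    by have := @eta_le 0; rewrite C0_orbitE// Sphi; apply; rewrite lexx tf0.
  rewrite Sphi; have Wphi : W phi by rewrite -Sphi -(C0_orbitE S phi (lexx 0)).
  have We : W (phi - vproj phi) by apply: lin_subspaceB => //; exact/XW/vproj_in.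
  apply: le_trans e0; apply: le_trans (vge We).
  rewrite ler_sqr ?nnegrE//; set z := vproj phi - P phi.
  have Xz : X z by apply: lin_subspaceB; [|exact: vproj_in|exact: (PP _).1].
  have : `|z| ^+ 2 = dot (vproj phi - phi) z.
    have -> : vproj phi - phi = z - (phi - P phi).
      by rewrite /z opprB addrA subrK.
    by rewrite (dotBl ip) (PP phi).2// subr0 (dotxx ip).
  have [->|zn] := eqVneq z 0; first by rewrite normr0.
  move=> h; have := dot_le ip (vproj phi - phi) z; rewrite -h expr2.
  by rewrite ler_pM2r ?normr_gt0// (distrC phi).
have := @gronwall _ (fun t => `|zeta t| ^+ 2) _ tf c (D * d) c0 Dd0 cz.
move=> /(_ _ (fun r hr => has_deriv_dot ip (dzeta (andP hr).1))) /(_ _ t tT) gr.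
have {}gr : `|zeta t| ^+ 2 <= expR (c * t) * (`|zeta 0| ^+ 2 + D * d * t).
  apply: gr => r /andP[r0 rt]; apply: energy.
  by rewrite !ltW.
have E : S t phi - T t (P phi) = (u t - vproj (u t)) + zeta t.
  by rewrite /zeta addrA subrK C0_orbitE.
rewrite E; set eta := u t - _.
have We : W eta by apply: lin_subspaceB => //; exact/XW/vproj_in.
have hq : `|eta + zeta t| ^+ 2 <= 2 * `|eta| ^+ 2 + 2 * `|zeta t| ^+ 2.
  rewrite -!(dotxx ip); apply: (@quad_triangle _ _ setT dot) => //.
  - exact: (dot_bilinear ip).
  - by move=> z _; rewrite (dotxx ip) sqr_ge0.
apply: le_trans hq _; rewrite /galerkin_const -/c -/D [leRHS]mulrDl lerD//.
  by rewrite ler_pM2l//; apply: le_trans (vge We) _; exact: eta_le.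
rewrite -!mulrA ler_pM2l//; apply: le_trans gr _.
rewrite ler_pM ?expR_ge0//.
- by rewrite addr_ge0 ?sqr_ge0// mulr_ge0.
- by rewrite ler_expR ler_wpM2l.
- by rewrite [leRHS]mulrDl mul1r lerD// -!mulrA ler_wpM2l// mulrC ler_wpM2r.
Qed.

End error.
End fixed_subspace.
End semigroup.
End galerkin_form.

(** * Convergence uniform on compact time intervals *)

Section galerkin_convergence.
Variables (R : realType) (H : completeNormedModType R) (dot : H -> H -> R).
Hypothesis ip : inner_product dot.
Variables (W V : set H) (vdot B : H -> H -> R) (M kappa kappa0 : R).
Hypothesis sW : lin_subspace W.
Hypothesis bV : bilinear_on W vdot.
Hypothesis vC : forall x y, W x -> W y -> vdot x y = vdot y x.
Hypothesis vge : forall x, W x -> `|x| ^+ 2 <= vdot x x.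
Hypothesis bB : bilinear_on W B.
Hypothesis M0 : 0 <= M.
Hypothesis BM : forall u v, W u -> W v ->
  `|B u v| <= M * Num.sqrt (vdot u u) * Num.sqrt (vdot v v).
Hypothesis VW : V `<=` W.
Hypothesis kappa_ge0 : 0 <= kappa.
Hypothesis kappa0_gt0 : 0 < kappa0.
Hypothesis gard : forall x, V x ->
  kappa0 * vdot x x <= B x x + kappa * `|x| ^+ 2.
Variable S : R -> H -> H.
Hypothesis SC0 : C0_semigroup S.
Hypothesis gen : forall x y,
  (V x /\ forall psi, V psi -> dot (- y) psi = B x psi) <-> generator S x y.
Variable X : nat -> set H.
Hypothesis XP : forall K, (0 < K)%N -> findim_subspace (X K) /\ X K `<=` V.
Hypothesis dens : forall x, V x -> exists xK : nat -> H,
  (forall K, (0 < K)%N -> X K (xK K)) /\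
  vdot (x - xK K) (x - xK K) @[K --> \oo] --> (0 : R).
Variables (G P : nat -> H -> H).
Hypothesis GP : forall K x, (0 < K)%N -> X K x ->
  X K (G K x) /\ forall y, X K y -> dot (G K x) y = - B x y.
Hypothesis PP : forall K x, (0 < K)%N ->
  X K (P K x) /\ forall y, X K y -> dot (x - P K x) y = 0.

Let XS K : (0 < K)%N -> lin_subspace (X K).
Proof. by move=> /XP[[n [e ->]] _]; exact: lin_subspace_span. Qed.

Let XV K : (0 < K)%N -> X K `<=` V. Proof. by move=> /XP[]. Qed.

Lemma findim_generators K : (0 < K)%N -> exists n (e : 'I_n -> H),
  X K = [set v | exists k : 'I_n -> R, v = \sum_i k i *: e i] /\
  forall i, X K (e i).
Proof.
move=> /XP[[n [e XE]] _]; exists n, e; split => // i; rewrite XE.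
exists (fun j => (j == i)%:R); rewrite (bigD1 i)//= eqxx scale1r big1 ?addr0//.
by move=> j /negbTE ->; rewrite scale0r.
Qed.

Lemma galerkin_onb K : (0 < K)%N -> exists s, is_onb dot (X K) s.
Proof.
move=> K0; have [n [e [-> _]]] := findim_generators K0.
apply: (@findim_onb _ _ setT dot) => //.
- exact: (dot_bilinear ip).
- by move=> x y _ _; exact: (dotC ip).
- by move=> x _; rewrite (dotxx ip); split; rewrite ?sqr_ge0// eq_sym sqrf_eq0 normr_eq0.
Qed.

Lemma galerkin_vonb K : (0 < K)%N -> exists s, is_onb vdot (X K) s.
Proof.
move=> K0; have [n [e [XE Xe]]] := findim_generators K0; rewrite XE.
apply: (@findim_onb _ _ W vdot) => //; last by move=> i; apply/VW/(XV K0).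
move=> x Wx; have h := vge Wx; split; first by apply: le_trans h; exact: sqr_ge0.
apply/eqP/eqP => [x0|->]; last by rewrite (bil0l sW bV)//; exact: (lin_subspace0 sW).
move: h; rewrite -x0 => h; apply/eqP; rewrite -normr_eq0 -sqrf_eq0.
by rewrite eq_le h sqr_ge0.
Qed.

Notation u x := (C0_orbit S x).

Let gu t x y : generator S x y -> generator S (u x t) (u y t).
Proof. by apply: generator_invariant => //; rewrite le_max lexx. Qed.

Let best_vproj K sv x y : (0 < K)%N -> is_onb vdot (X K) sv -> W x -> X K y ->
  vdot (x - vproj vdot sv x) (x - vproj vdot sv x) <= vdot (x - y) (x - y).
Proof.
by move=> K0 onbv Wx Xy; exact: (vproj_best sW bV vC vge VW (XS K0) (XV K0) onbv Wx Xy).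
Qed.

(* The orbit of an element of the domain is compact for vdot. *)
Lemma vproj_uniform x y T d : generator S x y -> 0 < d ->
  exists N, forall K sv t, (0 < K)%N -> (N <= K)%N -> is_onb vdot (X K) sv ->
    0 <= t <= T ->
    vdot (u x t - vproj vdot sv (u x t)) (u x t - vproj vdot sv (u x t)) <= d.
Proof.
move=> xy d0; have d4 : 0 < d / 4 by rewrite divr_gt0.
have gV t : V (u x t) := generator_V gen (@gu t _ _ xy).
have Wu t : W (u x t) by exact/VW.
pose C := (1 + kappa) / kappa0.
have C0 : 0 <= C by rewrite divr_ge0 ?addr_ge0// ltW.
(* The radius in the graph norm that guarantees [vdot]-distance at most [d / 4]. *)
pose e := Num.sqrt (d / 4 / (C + 1)).
have e0 : 0 < e by rewrite sqrtr_gt0 !divr_gt0// ltr_wpDl.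
have Ce : C * e ^+ 2 <= d / 4.
  rewrite sqr_sqrtr; last by rewrite !divr_ge0 ?ltW// ltr_wpDl.
  rewrite mulrA ler_pdivrMr ?ltr_wpDl// mulrC ler_wpM2l ?lerDl//; exact: ltW.
(* Continuity of the orbits of [x] and [y] together is continuity of [u x] in the graph norm, hence
   for [vdot]. *)
have /choice[r rP] t : exists r, 0 < r /\ forall t', `|t - t'| < r ->
    vdot (u x t' - u x t) (u x t' - u x t) <= d / 4.
  have /cvgrPdist_le/(_ _ e0)/nbhs_ballP[a a0 h] := @C0_orbit_continuous _ _ _ SC0 x t.
  have /cvgrPdist_le/(_ _ e0)/nbhs_ballP[b b0 h'] := @C0_orbit_continuous _ _ _ SC0 y t.
  exists (Num.min a b); split; first by rewrite lt_min a0 b0.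
  move=> t'; rewrite lt_min => /andP[ta tb]; apply: le_trans Ce.
  have gB := generatorB SC0 (@gu t' _ _ xy) (@gu t _ _ xy).
  apply: (vdot_generator_small ip kappa_ge0 kappa0_gt0 gard gen gB (ltW e0)).
    by rewrite distrC; exact: h'.
  by rewrite distrC; exact: h.
have := @segment_compact R 0 T; rewrite compact_cover.
move=> /(_ R [set` `[0, T]] (fun t => ball t (r t))) [].
- by move=> t _; exact: ball_open.
- by move=> t Tt; exists t => //; apply: ballxx; have [] := rP t.
move=> D' _ D'P.
have /choice[xK xKP] t := dens (gV t).
have /choice[N NP] t : exists N, forall K, (N <= K)%N ->
    vdot (u x t - xK t K) (u x t - xK t K) <= d / 4.
  have [_ /cvgrPdist_le/(_ _ d4)[N _ NP]] := xKP t.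
  exists N => K /NP/=; rewrite sub0r normrN; apply: le_trans; exact: ler_norm.
exists (\max_(t <- finmap.enum_fset D') N t)%N => K sv t K0 NK onbv tT.
have [|s sD' st] := D'P t; first by rewrite /= in_itv.
have NsK : (N s <= K)%N.
  by apply: leq_trans NK; rewrite (big_rem s)//= leq_maxl.
have Xs := (xKP s).1 _ K0; have WX := VW (XV K0 Xs).
(* By optimality of [vproj] the approximant chosen at the centre [s] serves the whole ball around
   [s]; [quad_triangle] then gives 2 (d/4) + 2 (d/4) = d. *)
apply: le_trans (best_vproj K0 onbv (Wu t) Xs) _.
have -> : u x t - xK s K = (u x t - u x s) + (u x s - xK s K) by rewrite addrA subrK.
have := quad_triangle sW bV _ (lin_subspaceB sW (Wu t) (Wu s)) (lin_subspaceB sW (Wu s) WX).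
move=> /(_ (fun z Wz => le_trans (sqr_ge0 _) (vge Wz))) /le_trans; apply.
have h1 := (rP s).2 _ st; have h2 := NP _ _ NsK; lra.
Qed.

Lemma galerkin_gen_lin K a x y : (0 < K)%N -> X K x -> X K y ->
  G K (a *: x + y) = a *: G K x + G K y.
Proof.
move=> K0 X1 X2; have X12 : X K (a *: x + y) by apply: (XS K0).2.
have XW v : X K v -> W v by move=> /(XV K0)/VW.
apply/eqP; rewrite -subr_eq0 -normr_eq0 -sqrf_eq0 -(dotxx ip).
set D := _ - _; have XD : X K D.
  apply: (lin_subspaceB (XS K0)); first exact: (GP K0 X12).1.
  by apply: (XS K0).2; [exact: (GP K0 X1).1|exact: (GP K0 X2).1].
rewrite {1}/D (dotBl ip) (dotDl ip) (dotZl ip) (GP K0 X12).2// (GP K0 X1).2// (GP K0 X2).2//.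
by rewrite bB.1 ?subr_eq0; [apply/eqP; ring|exact: XW|exact: XW|exact: XW].
Qed.

Theorem galerkin_converges x T e : 0 < e -> exists N, forall K t,
  (0 < K)%N -> (N <= K)%N -> 0 <= t <= T ->
  `|S t x - expsum (G K) t (P K x)| <= e.
Proof.
move=> e0; have [m m0 mP] := C0_bounded SC0 T.
pose E := expR (kappa * T).
have E0 : 0 < E by exact: expR_gt0.
(* [m] and [E] bound the two semigroups on [0, T], so replacing [x] by [z] costs at most e / 2 in
   total. *)
have e1 : 0 < e / 2 / (m + E) by rewrite !divr_gt0// addr_gt0.
have [z [y [w [zy yw xz]]]] := generator2_dense ip SC0 x e1.
pose C := galerkin_const M kappa kappa0 T.
(* Chosen so that [C * d <= (e / 2) ^+ 2], the squared budget of the error at [z]. *)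
pose d := (e / 2) ^+ 2 / (`|C| + 1).
have d0 : 0 < d by rewrite divr_gt0 ?exprn_gt0 ?divr_gt0// ltr_wpDl.
have [N1 N1P] := vproj_uniform T zy d0.
have [N2 N2P] := vproj_uniform T yw d0.
exists (maxn N1 N2) => K t K0; rewrite geq_max => /andP[K1 K2] tT.
have [t0 tle] := andP tT.
have [s onb] := galerkin_onb K0; have [sv onbv] := galerkin_vonb K0.
have GK v : X K v -> X K (G K v) /\ forall y, X K y -> dot (G K v) y = - B v y.
  by move=> Xv; exact: GP.
have PK v := PP v K0.
have XPK v : X K (P K v) by exact: (PK v).1.
have h1 : `|S t z - expsum (G K) t (P K z)| <= e / 2.
  rewrite -ler_sqr ?nnegrE ?divr_ge0 ?(ltW e0)//.
  have := galerkin_error ip sW bV vC vge bB M0 BM VW kappa_ge0 kappa0_gt0 gard SC0 gen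
    (XS K0) (XV K0) onb onbv GK PK zy yw (ltW d0) (fun t => @N1P K sv t K0 K1 onbv)
    (fun t => @N2P K sv t K0 K2 onbv) tT.
  move=> /le_trans; apply; rewrite -/C /d mulrA ler_pdivrMr ?ltr_wpDl//.
  rewrite mulrC ler_wpM2l ?sqr_ge0//; apply: le_trans (ler_norm C) _.
  by rewrite lerDl.
have h2 : `|S t (x - z)| <= m * (e / 2 / (m + E)).
  by apply: le_trans (mP _ _ tT) _; rewrite ler_wpM2l// ltW.
have h3 : `|expsum (G K) t (P K (z - x))| <= E * (e / 2 / (m + E)).
  have := galerkin_stable ip vge bB VW kappa_ge0 kappa0_gt0 gard (XS K0) (XV K0) onb GK t0
    (XPK (z - x)).
  have -> : expR (2 * kappa * t) = expR (kappa * t) ^+ 2.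
    by rewrite -expRM_natl mulrA.
  rewrite -exprMn ler_sqr ?nnegrE ?mulr_ge0 ?expR_ge0// => /le_trans; apply.
  rewrite ler_pM ?expR_ge0//; first by rewrite ler_expR ler_wpM2l.
  by apply: le_trans (galerkin_proj_contr ip PK _) _; rewrite distrC.
have GKlin a v1 v2 := galerkin_gen_lin a K0 (x := v1) (y := v2).
have GKX v : X K v -> X K (G K v) by move=> /GK[].
have -> : S t x - expsum (G K) t (P K x) =
    S t (x - z) + ((S t z - expsum (G K) t (P K z)) + expsum (G K) t (P K (z - x))).
  rewrite (C0B SC0)// (galerkin_projB ip (XS K0) PK) .
  rewrite (expsumB ip (XS K0) onb GKX GKlin)//.
  by rewrite !subrKA.
apply: le_trans (ler_normD _ _) _.
have n1 := ler_normD (S t z - expsum (G K) t (P K z)) (expsum (G K) t (P K (z - x))).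
have n2 : m * (e / 2 / (m + E)) + E * (e / 2 / (m + E)) = e / 2.
  by rewrite -mulrDl mulrC divfK// gt_eqF// addr_gt0.
lra.
Qed.

End galerkin_convergence.

(** * Weak gradients and the elliptic form *)

Section lebesgue_bounded.
Variable R : realType.
Notation mR := (measurableTypeR R).

(** A bounded [Omega] lies in such a cube and so has finite measure, which makes bounded continuous
    functions square integrable. *)
Lemma lebesgue_tuple_box (n : nat) (M : R) :
  measurable [set t : n.-tuple mR | forall i, `|tnth t i| <= M] /\
  (lebesgue_tuple R n [set t : n.-tuple mR | forall i, (`|tnth t i| <= M)%R] < +oo)%E.
Proof.
have mb k : measurable [set t : k.-tuple mR | forall i, `|tnth t i| <= M].
  have -> : [set t : k.-tuple mR | forall i, `|tnth t i| <= M] =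
      \bigcap_(i in [set: 'I_k]) ((@tnth k mR)^~ i @^-1` `[- M, M]%classic).
    apply/seteqP; split => [t tM i _|t tM i] /=.
      by rewrite in_itv/= -ler_norml.
    by have := tM i I; rewrite /= in_itv/= -ler_norml.
  apply: fin_bigcap_measurable => [|i _]; first exact: finite_finset.
  by rewrite -[X in measurable X]setTI; apply: measurable_tnth => //; exact: measurable_itv.
split => //; elim: n => [|n IH]; first by rewrite /= diracE; exact: ltry.
rewrite /= /lebesgue_tupleS /pushforward.
have -> : @tcons R n @^-1` [set t | forall i, `|tnth t i| <= M] =
    `[- M, M]%classic `*` [set t : n.-tuple mR | forall i, `|tnth t i| <= M].
  apply/seteqP; split => [[x t] /= xt|[x t] /= [xM tM] i].
    split; first by have := xt ord0; rewrite in_itv/= -ler_norml.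
    by move=> i; have := xt (lift ord0 i); rewrite tnthS.
  have [j ->|->] := unliftP ord0 i; first by rewrite tnthS.
  by rewrite tnth0 ler_norml; move: xM; rewrite in_itv.
rewrite product_measure1E//; last exact: mb.
rewrite lte_mul_pinfty// ge0_fin_numE//.
have : (@lebesgue_measure R `[(- M)%R, M] < +oo)%E.
  by rewrite lebesgue_measure_itv/=; case: ifP => // _; rewrite -EFinB ltry.
exact.
Qed.

Variables (d : nat) (Omega : set 'rV[R]_d) (oOmega : open Omega).
Hypothesis bOmega : bounded_set Omega.

Lemma lebesgue_on_finite : (lebesgue_on oOmega setT < +oo)%E.
Proof.
have [M [_ /(_ (M + 1))]] := bOmega; rewrite ltrDl => /(_ ltr01) OM.
have [mb bfin] := lebesgue_tuple_box d (M + 1).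
apply: le_lt_trans bfin; rewrite /= /mrestr setTI /= /lebesgue_Rd /pushforward.
apply: le_measure; rewrite ?inE//.
  rewrite -[X in measurable X]setTI; apply: measurable_rV_of_tuple => //.
  exact: open_measurable_Rd.
move=> t /= /OM h i; apply: le_trans h.
have -> : tnth t i = rV_of_tuple t 0 i by rewrite /rV_of_tuple mxE.
rewrite [leRHS]/Num.norm/= mx_normrE.
exact: (@le_bigmax _ _ _ 0 (fun ij : 'I_1 * 'I_d => `|rV_of_tuple t ij.1 ij.2|) (0, i)).
Qed.

End lebesgue_bounded.

Section test_functions_L2.
Variables (R : realType) (d : nat) (Omega : set 'rV[R]_d) (oOmega : open Omega).
Hypothesis bOmega : bounded_set Omega.
Notation mu := (lebesgue_on oOmega).

Lemma continuous_measurable_Rd (f : 'rV[R]_d -> R) : continuous f ->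
  measurable_fun setT (f : Rd R d -> R).
Proof.
move=> /continuousP cf; apply: (measurability _ (RGenOpens.measurableE R)).
move=> _ [_ [a [b ->] <-]]; rewrite setTI.
by apply: sub_sigma_algebra; apply: cf; exact: interval_open.
Qed.

Lemma test_function_Lfun f : test_function Omega f -> f \in Lfun mu 2%:E.
Proof.
case=> /(_ [::])[/= cf _] cs _.
have mf := continuous_measurable_Rd cf.
have [M M0 fM] : exists2 M, 0 <= M & forall x, `|f x| <= M.
  have := compact_bounded (continuous_compact (continuous_subspaceT cf) cs).
  move=> [M [_ /(_ (`|M| + 1))]]; rewrite ltr_pwDr ?ler_norm// => /(_ isT) h.
  exists (`|M| + 1); first by rewrite addr_ge0.
  move=> x; have [->|fx0] := eqVneq (f x) 0; first by rewrite normr0 addr_ge0.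
  by apply: h; exists x => //; exact: subset_closure.
apply/Lfun2P; split => //.
apply: (@le_lt_trans _ _ (\int[mu]_x (M ^+ 2)%:E)%E).
  apply: ge0_le_integral => //.
  - by move=> x _; rewrite lee_fin sqr_ge0.
  - by apply/measurable_EFinP; exact: measurable_funX.
  - by move=> x _; rewrite lee_fin -(real_normK (num_real (f x))) ler_sqr ?nnegrE.
rewrite integral_cst//; apply: lte_mul_pinfty => //.
  by rewrite lee_fin sqr_ge0.
exact: lebesgue_on_finite.
Qed.

Lemma test_function_partial i f : test_function Omega f ->
  test_function Omega (partial i f).
Proof.
case=> sf cs sO.
(* Off its support [f] vanishes in a neighbourhood, so the difference quotients there are eventually
   0. *)
have supp : closure [set x | partial i f x != 0] `<=` closure [set x | f x != 0].
  have /closure_id -> : closed (closure [set x | f x != 0]) by exact: closed_closure.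
  apply: closureS => x; apply: contra_neqP => /= ncl; rewrite /partial /derive.
  have : nbhs x (~` closure [set x | f x != 0]).
    by apply: open_nbhs_nbhs; split => //; exact: (closed_openC (@closed_closure _ _)).
  move=> nx; apply: cvg_lim => //.
  have fx : f x = 0.
    by apply/eqP/negPn/negP => fx; apply: ncl; exact: subset_closure.
  pose g (r : R) : 'rV[R]_d := r *: delta_mx 0 i + x.
  have h : g r @[r --> (0 : R)^'] --> x.
    rewrite -[X in _ --> X]add0r; apply: cvgD; last exact: cvg_cst.
    rewrite -[X in _ --> X](scale0r (delta_mx 0 i : 'rV[R]_d)).
    by apply: cvgZl; exact: cvg_within.
  have hn : \forall r \near (0 : R)^', (~` closure [set x | f x != 0]) (g r) := h _ nx.
  apply: cvg_near_cst; apply: filterS hn => r /= nr.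
  have -> : f (r *: delta_mx 0 i + x) = 0.
    by apply/eqP/negPn/negP => fr; apply: nr; exact: subset_closure.
  by rewrite fx subrr scaler0.
split.
- move=> s; have := sf (rcons s i).
  by rewrite /iter_partial foldr_rcons.
- by apply: subclosed_compact supp => //; exact: closed_closure.
- exact: subset_trans sO.
Qed.

Notation L2O := (L2 mu).
Notation dot := (@L2dot _ _ R mu).
Implicit Types u v p q w : L2O.
Let ip : inner_product dot := L2dot_inner_product mu.

Lemma is_weak_partialP i (u v : L2O) : is_weak_partial i u v <->
  forall f, test_function Omega f ->
    dot u (toL2 mu (partial i f)) = - dot v (toL2 mu f).
Proof.
split=> h f tf; have := h f tf.
  rewrite !L2dot_toL2//; [exact: test_function_Lfun|].
  by apply: test_function_Lfun; exact: test_function_partial.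
rewrite !L2dot_toL2//; [exact: test_function_Lfun|].
by apply: test_function_Lfun; exact: test_function_partial.
Qed.

Definition test_orth (w : L2O) :=
  forall f, test_function Omega f -> dot w (toL2 mu f) = 0.

(* The orthogonal bicomplement of the test functions: inside it weak partial
   derivatives are unique and no density of test functions is needed. *)
Definition test_closure : set L2O :=
  [set p | forall w, test_orth w -> dot w p = 0].

Definition is_grad i (u p : L2O) := is_weak_partial i u p /\ test_closure p.

(** The difference is orthogonal to the test functions and lies in their bicomplement, hence is
    orthogonal to itself. *)
Lemma is_grad_unique i u p p' : is_grad i u p -> is_grad i u p' -> p = p'.
Proof.
move=> [/is_weak_partialP up cp] [/is_weak_partialP up' cp'].
have o : test_orth (p - p').
  move=> f tf; rewrite (dotBl ip); apply/eqP; rewrite subr_eq0 -eqr_opp.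
  by rewrite -up// -up'.
apply/eqP; rewrite -subr_eq0 -normr_eq0 -sqrf_eq0 -(dotxx ip) (dotBr ip).
by rewrite cp// cp'// subrr.
Qed.

Lemma is_grad_lin i a u v p q : is_grad i u p -> is_grad i v q ->
  is_grad i (a *: u + v) (a *: p + q).
Proof.
move=> [/is_weak_partialP up cp] [/is_weak_partialP vq cq]; split.
  apply/is_weak_partialP => f tf.
  by rewrite !(dotDl ip) !(dotZl ip) up// vq// mulrN opprD.
by move=> w ow; rewrite (dotDr ip) (dotZr ip) cp// cq// mulr0 addr0.
Qed.

Definition Wgrad : set L2O := [set u | forall i, exists p, is_grad i u p].

Definition grad i u : L2O := xget 0 (is_grad i u).

Lemma gradP i u : Wgrad u -> is_grad i u (grad i u).
Proof. by move=> /(_ i)[p up]; rewrite /grad; case: xgetP => // /(_ p). Qed.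

Lemma Wgrad_subspace : lin_subspace Wgrad.
Proof.
split=> [i|a u v Wu Wv i].
  exists 0; split; last by move=> w _; rewrite (dot0r ip).
  by apply/is_weak_partialP => f _; rewrite !(dot0l ip) oppr0.
by exists (a *: grad i u + grad i v); apply: is_grad_lin; exact: gradP.
Qed.

Lemma grad_lin i a u v : Wgrad u -> Wgrad v ->
  grad i (a *: u + v) = a *: grad i u + grad i v.
Proof.
move=> Wu Wv; apply: (@is_grad_unique i (a *: u + v)).
  by apply: gradP; exact: Wgrad_subspace.2.
by apply: is_grad_lin; exact: gradP.
Qed.

Lemma weak_partialP i u : H1 u -> is_weak_partial i u (weak_partial i u).
Proof. by move=> /(_ i)[p up]; rewrite /weak_partial; case: xgetP => // /(_ p). Qed.

(** In [H10] the chosen weak derivative is a limit of partial derivatives of test functions. These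
    are test functions, so the limit stays in the bicomplement. *)
Lemma H10_is_grad i u : H10 u -> is_grad i u (weak_partial i u).
Proof.
move=> [Hu [f [tf fu dfu]]]; split; first exact: weak_partialP.
move=> w ow; rewrite (dotC ip).
have h : dot (toL2 mu (partial i (f n))) w @[n --> \oo] --> dot (weak_partial i u) w.
  by apply: (cvg_dotl ip); exact: dfu.
have E : (fun n => dot (toL2 mu (partial i (f n))) w) = fun=> 0.
  by apply/funext => n; rewrite (dotC ip) ow//; exact: test_function_partial.
rewrite E in h; move/(cvg_lim (@Rhausdorff R)) : h => <-.
exact: (lim_cst (@Rhausdorff R)).
Qed.

Lemma H10_Wgrad u : H10 u -> Wgrad u.
Proof. by move=> Hu i; exists (weak_partial i u); exact: H10_is_grad. Qed.

Lemma grad_H10 i u : H10 u -> grad i u = weak_partial i u.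
Proof.
move=> Hu; apply: (@is_grad_unique i u); last exact: H10_is_grad.
by apply: gradP; exact: H10_Wgrad.
Qed.

(* The grad is the orthogonal projection of any weak partial derivative. *)
Lemma grad_le i u : Wgrad u -> `|grad i u| <= `|weak_partial i u|.
Proof.
move=> Wu; have [up cp] := gradP i Wu.
have Hu : H1 u by move=> j; exists (grad j u); exact: (gradP j Wu).1.
have o : test_orth (weak_partial i u - grad i u).
  move=> f tf; rewrite (dotBl ip); apply/eqP; rewrite subr_eq0 -eqr_opp.
  have /is_weak_partialP wp := weak_partialP i Hu.
  by have /is_weak_partialP up' := up; rewrite -wp// -up'.
have := cp _ o; rewrite (dotBl ip) (dotxx ip) => /eqP; rewrite subr_eq0 => /eqP h.
have := dot_le ip (weak_partial i u) (grad i u); rewrite h expr2.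
have [->|g0] := eqVneq (grad i u) 0; first by rewrite normr0.
by rewrite ler_pM2r// normr_gt0.
Qed.

(** The H^1 product with [grad] in place of [weak_partial]: bilinear on [Wgrad], and inducing
    [H1norm] on [H10]. *)
Definition vdot (u v : L2O) : R := dot u v + \sum_i dot (grad i u) (grad i v).

Lemma vdotC u v : vdot u v = vdot v u.
Proof.
have E : \sum_i dot (grad i u) (grad i v) = \sum_i dot (grad i v) (grad i u).
  by apply: eq_bigr => i _; rewrite (dotC ip).
exact: (congr2 +%R (dotC ip u v) E).
Qed.

Lemma vdot_bilinear : bilinear_on Wgrad vdot.
Proof.
have vl a x y z : Wgrad x -> Wgrad y -> Wgrad z ->
    vdot (a *: x + y) z = a * vdot x z + vdot y z.
  move=> Wx Wy Wz; rewrite /vdot (dotDl ip) (dotZl ip) mulrDr mulr_sumr addrACA.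
  congr (_ + _); rewrite -big_split/=; apply: eq_bigr => i _.
  by rewrite grad_lin// (dotDl ip) (dotZl ip).
split; first exact: vl.
move=> a x y z Wx Wy Wz; rewrite (vdotC z (a *: x + y)) (vdotC z x) (vdotC z y).
exact: vl.
Qed.

Lemma norm_le_vdotxx u : `|u| ^+ 2 <= vdot u u.
Proof.
rewrite /vdot (dotxx ip) lerDl sumr_ge0// => i _.
by rewrite (dotxx ip) sqr_ge0.
Qed.

Lemma grad_norm_le i u : `|grad i u| <= Num.sqrt (vdot u u).
Proof.
have s0 j : 0 <= dot (grad j u) (grad j u) by rewrite (dotxx ip) sqr_ge0.
have u0 : 0 <= dot u u by rewrite (dotxx ip) sqr_ge0.
rewrite -[leLHS]ger0_norm// -sqrtr_sqr; apply: ler_wsqrtr.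
rewrite -(dotxx ip) /vdot (bigD1 i isT).
apply: le_trans (_ : dot (grad i u) (grad i u) <= dot (grad i u) (grad i u) +
    \sum_(j | j != i) dot (grad j u) (grad j u)) _.
  by rewrite lerDl; apply: sumr_ge0 => j _; exact: s0.
by rewrite lerDr.
Qed.

Lemma norm_le_sqrt_vdot u : `|u| <= Num.sqrt (vdot u u).
Proof. by rewrite -[leLHS]ger0_norm// -sqrtr_sqr ler_wsqrtr// norm_le_vdotxx. Qed.

Lemma H1norm_vdot u : H10 u -> H1norm u ^+ 2 = vdot u u.
Proof.
move=> Hu; rewrite /H1norm sqr_sqrtr; last first.
  by rewrite addr_ge0 ?sqr_ge0// sumr_ge0// => i _; exact: sqr_ge0.
rewrite /vdot (dotxx ip); congr (_ + _); apply: eq_bigr => i _.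
by rewrite (dotxx ip) grad_H10.
Qed.

(** The density assumption bounds [H1norm (psi - psiK K)], a difference known to lie in [Wgrad];
    this inequality transfers the convergence to [vdot]. *)
Lemma vdot_le_H1norm u : Wgrad u -> vdot u u <= H1norm u ^+ 2.
Proof.
move=> Wu; rewrite /H1norm sqr_sqrtr; last first.
  by rewrite addr_ge0 ?sqr_ge0// sumr_ge0// => i _; exact: sqr_ge0.
rewrite /vdot (dotxx ip) lerD2l; apply: ler_sum => i _.
by rewrite (dotxx ip) ler_sqr ?nnegrE// grad_le.
Qed.

End test_functions_L2.

(** * Multiplication by bounded coefficients *)

Section multiplication.
Variables (R : realType) (d : nat) (Omega : set 'rV[R]_d) (oOmega : open Omega).
Notation mu := (lebesgue_on oOmega).
Notation L2O := (L2 mu).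
Notation dot := (@L2dot _ _ R mu).
Implicit Types (a : Linfty oOmega) (x y : L2O).
Let ip : inner_product dot := L2dot_inner_product mu.

Lemma Linfty_measurable a : measurable_fun setT (a : Rd R d -> R).
Proof. exact: (measurable_funPT (repr ((a : LspaceType mu (leey 1)) :
  {mfun_ mu, (Rd R d) >-> measurableTypeR R}))). Qed.

Lemma Linfty_bound a : exists2 M, 0 <= M & {ae mu, forall t : Rd R d, `|a t| <= M}.
Proof.
have := @Lebesgue_finite _ _ _ mu +oo%E (leey 1) (a : LspaceType mu (leey 1)).
(* On a space of measure 0 the norm of exponent [+oo] is 0 by definition, and any bound holds almost
   everywhere. *)
rewrite /finite_norm unlock; case: ifPn => [mu0 soo|mu0 _]; last first.
  exists 0 => //; exists setT; split => //; apply/eqP.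
  by rewrite eq_le measure_ge0 andbT leNgt.
have := @ess_sup_ge _ _ R mu (abse \o (EFin \o (a : Rd R d -> R))).
set s := ess_sup _ _ => h.
exists `|fine s| => //; apply: filterS h => t /= h.
have sf : s \is a fin_num.
  rewrite fin_numE; apply/andP; split; last by rewrite lt_eqF.
  by rewrite gt_eqF// (lt_le_trans _ h)// ltNyr.
by rewrite -lee_fin (le_trans h)// -(fineK sf) lee_fin ler_norm.
Qed.

Lemma mulL_Lfun a x : (fun t : Rd R d => a t * x t) \in Lfun mu 2%:E /\
  forall M, 0 <= M -> {ae mu, forall t : Rd R d, `|a t| <= M} ->
  (\int[mu]_t ((a t * x t) ^+ 2)%:E <= (M ^+ 2)%:E * (`|x| ^+ 2)%:E)%E.
Proof.
have mx : measurable_fun setT (fun t => x t ^+ 2).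
  by apply: measurable_funX; exact: L2_measurable.
have max : measurable_fun setT (fun t : Rd R d => a t * x t).
  by apply: measurable_funM; [exact: Linfty_measurable|exact: L2_measurable].
have b M : 0 <= M -> {ae mu, forall t : Rd R d, `|a t| <= M} ->
    (\int[mu]_t ((a t * x t) ^+ 2)%:E <= (M ^+ 2)%:E * (`|x| ^+ 2)%:E)%E.
  move=> M0 aM; rewrite L2_norm -ge0_integralZl//; last 3 first.
  - exact/measurable_EFinP.
  - by move=> t _; rewrite lee_fin sqr_ge0.
  - by rewrite lee_fin sqr_ge0.
  apply: ae_ge0_le_integral => //.
  - by move=> t _; rewrite lee_fin sqr_ge0.
  - by apply/measurable_EFinP; exact: measurable_funX.
  - by move=> t _; rewrite -EFinM lee_fin mulr_ge0// sqr_ge0.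
  - by apply/measurable_EFinP; apply: measurable_funM.
  - apply: filterS aM => t atM _; rewrite -EFinM lee_fin exprMn ler_wpM2r ?sqr_ge0//.
    by rewrite -(real_normK (num_real (a t))) ler_sqr ?nnegrE.
split => //; have [M M0 aM] := Linfty_bound a.
by apply/Lfun2P; split => //; apply: le_lt_trans (b M M0 aM) _; rewrite -EFinM ltry.
Qed.

Definition mulL a x : L2O := toL2 mu (fun t : Rd R d => a t * x t).

Lemma mulLE a x : (mulL a x : Rd R d -> R) = (fun t : Rd R d => a t * x t) %[ae mu].
Proof. by apply: toL2E; exact: (mulL_Lfun a x).1. Qed.

Lemma mulL_norm a : exists2 M, 0 <= M & forall x, `|mulL a x| <= M * `|x|.
Proof.
have [M M0 aM] := Linfty_bound a; exists M => // x.
rewrite -ler_sqr ?nnegrE ?mulr_ge0// -lee_fin toL2_norm; last exact: (mulL_Lfun a x).1.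
by rewrite exprMn EFinM; exact: (mulL_Lfun a x).2.
Qed.

Lemma mulL_lin a k x y : mulL a (k *: x + y) = k *: mulL a x + mulL a y.
Proof.
apply: L2_eqP; apply: filterS (filterI (filterI (mulLE a (k *: x + y)) (L2_DE (k *: x) y))
  (filterI (filterI (L2_DE (k *: mulL a x) (mulL a y)) (L2_ZE k (mulL a x)))
    (filterI (filterI (mulLE a x) (mulLE a y)) (L2_ZE k x)))).
move=> t [[/(_ I) h1 /(_ I) h2] [[/(_ I) h3 /(_ I) h4] [[/(_ I) h5 /(_ I) h6] /(_ I) h7]]] _.
by rewrite h1 h2 h3 h4 h5 h6 h7 mulrDr mulrCA.
Qed.

Lemma mulL_dot a x y :
  mu.-integrable setT (EFin \o (fun t : Rd R d => a t * x t * y t)) /\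
  \int[mu]_t (a t * x t * y t) = dot (mulL a x) y.
Proof.
have La := (mulL_Lfun a x).1; split; first exact: (L2_integrableM La (L2_Lfun y)).
apply/esym; apply: L2dot_ae; [exact: (Lfun2_measurable La)|exact: L2_measurable| |].
  exact: mulLE.
exact: ae_eq_refl.
Qed.

Variables (a : 'I_d -> 'I_d -> Linfty oOmega) (b : 'I_d -> Linfty oOmega).
Variable c : Linfty oOmega.

(** The elliptic form with [grad] in place of [weak_partial], split into L_2 products: bilinear on
    all of [Wgrad], and equal to [elliptic_form] on [H10]. *)
Definition gform (u v : L2O) : R :=
  \sum_i \sum_j dot (mulL (a i j) (grad i u)) (grad j v) +
  \sum_i dot (mulL (b i) (grad i u)) v + dot (mulL c u) v.

Lemma elliptic_formE (bOmega : bounded_set Omega) (u v : L2O) : H10 u -> H10 v ->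
  elliptic_form a b c u v = gform u v.
Proof.
move=> Hu Hv.
have gE i : weak_partial i u = grad i u := esym (grad_H10 bOmega i Hu).
have gE' i : weak_partial i v = grad i v := esym (grad_H10 bOmega i Hv).
have iA i j := (mulL_dot (a i j) (grad i u) (grad j v)).1.
have iB i := (mulL_dot (b i) (grad i u) v).1.
have iC := (mulL_dot c u v).1.
have sumI (f : 'I_d -> Rd R d -> R) :
    (forall i, mu.-integrable setT (EFin \o f i)) ->
    mu.-integrable setT (EFin \o (fun t => \sum_i f i t)) /\
    \int[mu]_t (\sum_i f i t) = \sum_i \int[mu]_t f i t.
  move=> fi; have E : EFin \o (fun t => \sum_i f i t) =
      (fun t => \sum_(i <- index_enum _) (f i t)%:E)%E.
    by apply/funext => t /=; rewrite sumEFin.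
  have I1 : mu.-integrable setT (EFin \o (fun t => \sum_i f i t)).
    by rewrite E; apply: integrable_sum => // i _; exact: fi.
  split => //; apply/EFin_inj; rewrite /Rintegral -sumEFin fineK; last first.
    exact: (integrable_fin_num measurableT I1).
  under eq_integral => t _ do rewrite -sumEFin.
  rewrite integral_sum//; apply: eq_bigr => i _; rewrite fineK//.
  exact: (integrable_fin_num measurableT (fi i)).
pose fA i (t : Rd R d) := \sum_j a i j t * grad i u t * grad j v t.
have jA i := sumI (fun j t => a i j t * grad i u t * grad j v t) (iA i).
have kA := sumI fA (fun i => (jA i).1).
have kB := sumI (fun i t => b i t * grad i u t * v t) iB.
have -> : elliptic_form a b c u v = \int[mu]_t
    ((\sum_i fA i t + \sum_i b i t * grad i u t * v t) + c t * u t * v t).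
  rewrite /elliptic_form /fA; congr Rintegral; apply/funext => t.
  congr (_ + _ + _); last by apply: eq_bigr => i _; rewrite gE.
  by apply: eq_bigr => i _; apply: eq_bigr => j _; rewrite gE gE'.
rewrite RintegralD//; last exact: (integrableD measurableT kA.1 kB.1).
rewrite RintegralD//; [|exact: kA.1|exact: kB.1].
rewrite kA.2 kB.2 /gform (mulL_dot c u v).2; congr (_ + _ + _).
- apply: eq_bigr => i _; rewrite (jA i).2; apply: eq_bigr => j _.
  exact: (mulL_dot _ _ _).2.
- by apply: eq_bigr => i _; exact: (mulL_dot _ _ _).2.
Qed.

Hypothesis bOmega : bounded_set Omega.
Notation W := (@Wgrad R d Omega oOmega).

Lemma gform_bilinear : bilinear_on W gform.
Proof.
have dl k x y z : dot (k *: x + y) z = k * dot x z + dot y z.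
  by rewrite (dotDl ip) (dotZl ip).
have dr k x y z : dot z (k *: x + y) = k * dot z x + dot z y.
  by rewrite (dotDr ip) (dotZr ip).
have sum3 (k A A1 A2 B B1 B2 C C1 C2 : R) : A = k * A1 + A2 -> B = k * B1 + B2 ->
    C = k * C1 + C2 -> A + B + C = k * (A1 + B1 + C1) + (A2 + B2 + C2).
  by move=> -> -> ->; ring.
have suml (k : R) (f g h : 'I_d -> R) : (forall i, f i = k * g i + h i) ->
    \sum_i f i = k * (\sum_i g i) + \sum_i h i.
  by move=> fE; rewrite mulr_sumr -big_split/=; apply: eq_bigr => i _; exact: fE.
have gl k x y i : W x -> W y -> grad i (k *: x + y) = k *: grad i x + grad i y.
  by move=> Wx Wy; exact: grad_lin.
split=> k x y z Wx Wy Wz; apply: sum3.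
- apply: (suml) => i; apply: (suml) => j.
  by rewrite (gl _ _ _ _ Wx Wy) mulL_lin dl.
- by apply: (suml) => i; rewrite (gl _ _ _ _ Wx Wy) mulL_lin dl.
- by rewrite mulL_lin dl.
- by apply: (suml) => i; apply: (suml) => j; rewrite (gl _ _ _ _ Wx Wy) dr.
- by apply: (suml) => i; rewrite dr.
- by rewrite dr.
Qed.

Lemma gform_bound : exists2 M, 0 <= M & forall u v : L2O,
  `|gform u v| <= M * Num.sqrt (vdot u u) * Num.sqrt (vdot v v).
Proof.
have /choice[Ma MaP] (p : 'I_d * 'I_d) : exists M, 0 <= M /\
    forall x, `|mulL (a p.1 p.2) x| <= M * `|x|.
  by have [M M0 h] := mulL_norm (a p.1 p.2); exists M.
have /choice[Mb MbP] (i : 'I_d) : exists M, 0 <= M /\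
    forall x, `|mulL (b i) x| <= M * `|x|.
  by have [M M0 h] := mulL_norm (b i); exists M.
have [Mc Mc0 McP] := mulL_norm c.
exists (\sum_i \sum_j Ma (i, j) + \sum_i Mb i + Mc).
  rewrite !addr_ge0//; apply: sumr_ge0 => i _; last exact: (MbP i).1.
  by apply: sumr_ge0 => j _; exact: (MaP (i, j)).1.
move=> u v; pose su := Num.sqrt (vdot u u); pose sv := Num.sqrt (vdot v v).
change (`|gform u v| <= (\sum_i \sum_j Ma (i, j) + \sum_i Mb i + Mc) * su * sv).
have su0 : 0 <= su by exact: sqrtr_ge0.
have sv0 : 0 <= sv by exact: sqrtr_ge0.
have gu i : `|grad i u| <= su := grad_norm_le i u.
have gv i : `|grad i v| <= sv := grad_norm_le i v.
have u1 : `|u| <= su := norm_le_sqrt_vdot u.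
have v1 : `|v| <= sv := norm_le_sqrt_vdot v.
clearbody su sv.
have bd (M : R) (m x y : L2O) : 0 <= M -> `|m| <= M * `|x| -> `|x| <= su -> `|y| <= sv ->
    `|dot m y| <= M * su * sv.
  move=> M0 mx xu yv; apply: le_trans (cauchy_schwarz ip _ _) _.
  apply: ler_pM => //; apply: le_trans mx _; exact: ler_wpM2l.
rewrite /gform !mulrDl; apply: le_trans (ler_normD _ _) _; apply: lerD.
  apply: le_trans (ler_normD _ _) _; apply: lerD.
    apply: le_trans (ler_norm_sum _ _ _) _; rewrite !mulr_suml; apply: ler_sum => i _.
    apply: le_trans (ler_norm_sum _ _ _) _; rewrite !mulr_suml; apply: ler_sum => j _.
    exact: (bd _ _ _ _ (MaP (i, j)).1 ((MaP (i, j)).2 _) (gu i) (gv j)).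
  apply: le_trans (ler_norm_sum _ _ _) _; rewrite !mulr_suml; apply: ler_sum => i _.
  exact: (bd _ _ _ _ (MbP i).1 ((MbP i).2 _) (gu i) v1).
exact: (bd _ _ _ _ Mc0 (McP _) u1 v1).
Qed.

End multiplication.

(** * Control-to-state operators *)

Section time_measure.
Variables (R : realType) (tF : R).
Notation mR := (measurableTypeR R).
Notation lambda := (@lebesgue_measure R).
Notation lt := (lebesgue_time tF).
Let I0 : set mR := `]0, tF[%classic.
Let mI0 : measurable I0. Proof. exact: measurable_itv. Qed.

(** [lebesgue_time] lives on the open interval, admissibility and the Bochner integrals on the
    closed one; the two endpoints are a null set. *)
Lemma lebesgue_time_ae (P : mR -> Prop) :
  {ae lambda, forall t, t \in `[0, tF] -> P t} <-> {ae lt, forall t, P t}.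
Proof.
have s0 : lambda ([set 0] `|` [set tF]) = 0%E.
  by rewrite measureU0//; exact: lebesgue_measure_set1.
split=> -[A [mA A0 AP]].
- exists (A `|` ~` I0); split.
  + by apply: measurableU => //; exact: measurableC.
  + apply/eqP; rewrite eq_le measure_ge0 andbT -A0 /lebesgue_time /mrestr/=.
    apply: le_measure; rewrite ?inE//; last by move=> t [[]].
    by apply: measurableI => //; apply: measurableU => //; exact: measurableC.
  + move=> t /= nP; have [It|] := pselect (I0 t); last by right.
    left; apply: AP => /= h; apply: nP; apply: h.
    by move: It; rewrite /I0/= !in_itv/= => /andP[/ltW -> /ltW ->].
- exists ((A `&` I0) `|` ([set 0] `|` [set tF])); split.
  + by do !apply: measurableU => //; exact: measurableI.
  + rewrite measureU0//; [exact: measurableI|exact: measurableU].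
  + move=> t /= /not_implyP[]; rewrite in_itv/= => /andP[t0 tT] nP.
    have [->|tn0] := eqVneq t 0; first by right; left.
    have [->|tnT] := eqVneq t tF; first by right; right.
    left; split; first exact: AP.
    by rewrite /I0/= in_itv/= !lt_neqAle t0 tT tnT eq_sym tn0.
Qed.

Lemma lebesgue_time_integral (f : mR -> \bar R) : measurable_fun setT f ->
  (\int[lt]_t f t = \int[lambda]_(t in `[0%R, tF]) f t)%E.
Proof.
have ge0P g : measurable_fun setT g -> (forall t, 0 <= g t)%E ->
    (\int[lt]_t g t = \int[lambda]_(t in `[0%R, tF]) g t)%E.
  move=> mg g0; rewrite integral_itv_bndoo; last exact: measurable_funTS.
  have N0 : lt (~` I0) = 0%E by rewrite /lebesgue_time/= /mrestr setICl measure0.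
  rewrite (ge0_negligible_integral (measurableC mI0) measurableT mg _ N0)//.
  rewrite setTD setCK; apply: eq_measure_integral => A mA AI.
  by rewrite /lebesgue_time/= /mrestr setIidl.
move=> mf; rewrite integralE [RHS]integralE !ge0P//.
- exact: measurable_funeneg.
- exact: measurable_funepos.
Qed.

Lemma lebesgue_time_setT : 0 <= tF -> lt setT = tF%:E.
Proof.
move=> T0; rewrite /lebesgue_time/= /mrestr setTI lebesgue_measure_itv/=.
by rewrite lte_fin; case: ltP => [_|T0']; rewrite ?sube0//; congr EFin; apply: le_anti; rewrite T0 T0'.
Qed.

Lemma bounded_time_L2 (f : mR -> R) (C : R) : 0 <= tF -> measurable_fun setT f ->
  0 <= C -> {ae lt, forall t, `|f t| <= C} ->
  f \in Lfun lt 2%:E /\ `|toL2 lt f| <= C * Num.sqrt tF.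
Proof.
move=> T0 mf C0 fC.
have I : (\int[lt]_t (f t ^+ 2)%:E <= (C ^+ 2 * tF)%:E)%E.
  rewrite EFinM -lebesgue_time_setT// -integral_cst//; apply: ae_ge0_le_integral => //.
  - by move=> t _; rewrite lee_fin sqr_ge0.
  - by apply/measurable_EFinP; exact: measurable_funX.
  - by move=> t _; rewrite lee_fin sqr_ge0.
  - by apply: filterS fC => t ft _; rewrite lee_fin -(real_normK (num_real (f t))) lerXn2r// nnegrE.
have Lf : f \in Lfun lt 2%:E by apply/Lfun2P; split => //; exact: le_lt_trans I (ltry _).
split => //; rewrite -ler_sqr ?nnegrE ?mulr_ge0 ?sqrtr_ge0//.
by rewrite exprMn sqr_sqrtr// -lee_fin toL2_norm.
Qed.

End time_measure.

(** * The set of admissible controls *)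

Section admissible_controls.
Variables (R : realType) (tF : R) (m : nat) (bnd : 'I_m -> R).
Hypothesis tF_ge0 : 0 <= tF.
Hypothesis bnd_ge0 : forall i, 0 <= bnd i.
Notation mR := (measurableTypeR R).
Notation lt := (lebesgue_time tF).
Notation adm := (@admissible R tF m bnd).

Lemma time_aeS (P Q : mR -> Prop) : (forall t, P t -> Q t) ->
  {ae lt, forall t, P t} -> {ae lt, forall t, Q t}.
Proof. by move=> PQ; apply: filterS. Qed.

Lemma time_aeS2 (P Q S : mR -> Prop) : (forall t, P t -> Q t -> S t) ->
  {ae lt, forall t, P t} -> {ae lt, forall t, Q t} -> {ae lt, forall t, S t}.
Proof. by move=> PQ; apply: filterS2. Qed.

Lemma admissibleP (u : control tF m) :
  adm u <-> forall i, {ae lt, forall t, `|u i t| <= bnd i}.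
Proof.
split=> au i.
  by have /lebesgue_time_ae := au i; apply: time_aeS => t; rewrite ler_norml.
by apply/lebesgue_time_ae; have := au i; apply: time_aeS => t; rewrite ler_norml.
Qed.

Lemma admissible0 : adm (fun=> 0).
Proof.
apply/admissibleP => i; have := L2zeroE lt; apply: time_aeS => t /(_ I) h.
by rewrite [X in `|X|]h normr0.
Qed.

Definition midpoint (u w : control tF m) : control tF m :=
  fun i => 2^-1 *: (u i + w i).

Lemma admissible_midpoint u w : adm u -> adm w -> adm (midpoint u w).
Proof.
move=> /admissibleP au /admissibleP aw; apply/admissibleP => i.
have h1 := L2_ZE 2^-1 (u i + w i); have h2 := L2_DE (u i) (w i).
apply: time_aeS2 (filterI (au i) (aw i)) (filterI h1 h2) => t [ut wt] [/(_ I) e1 /(_ I) e2].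
rewrite /midpoint e1 e2 normrM gtr0_norm ?invr_gt0//.
have := ler_normD (u i t) (w i t); lra.
Qed.

Lemma admissible_norm u i : adm u -> `|u i| <= bnd i * Num.sqrt tF.
Proof.
move=> /admissibleP au; rewrite -[X in `|X|]toL2K.
by have [] := bounded_time_L2 tF_ge0 (L2_measurable (u i)) (bnd_ge0 i) (au i).
Qed.

Let clip (b x : R) := Num.max (- b) (Num.min b x).

Let clip_le b x : 0 <= b -> `|clip b x| <= b.
Proof.
by move=> b0; rewrite /clip ler_norml le_max lexx/= ge_max ge_min lexx/= andbT; lra.
Qed.

Let clip_dist b x y : `|y| <= b -> `|clip b x - y| <= `|x - y|.
Proof.
rewrite /clip ler_norml => /andP[yb1 yb2].
case: (leP b x) => bx; case: (leP (- b) _) => h; rewrite ler_norml;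
  by case: (ger0P (x - y)) => xy; apply/andP; split; lra.
Qed.

(* The pointwise projection onto [-b, b] is closer to the u_n than u is, hence
   it is also their limit. *)
Lemma admissible_closed (u : nat -> control tF m) (w : control tF m) :
  (forall n, adm (u n)) -> (forall i, u n i @[n --> \oo] --> w i) -> adm w.
Proof.
move=> au uw; apply/admissibleP => i.
pose f (t : mR) := clip (bnd i) (w i t).
have mf : measurable_fun setT f.
  apply: measurable_maxr => //; apply: measurable_minr => //; exact: L2_measurable.
have [Lf _] := bounded_time_L2 tF_ge0 mf (bnd_ge0 i) (aeW _ (fun t => clip_le (w i t) (bnd_ge0 i))).
have le n : `|toL2 lt f - u n i| <= `|w i - u n i|.
  rewrite -ler_sqr ?nnegrE// -lee_fin !L2_normB; apply: ae_ge0_le_integral => //.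
  - by move=> t _; rewrite lee_fin sqr_ge0.
  - by apply/measurable_EFinP; apply: measurable_funX; apply: measurable_funB; exact: L2_measurable.
  - by move=> t _; rewrite lee_fin sqr_ge0.
  - by apply/measurable_EFinP; apply: measurable_funX; apply: measurable_funB; exact: L2_measurable.
  have /admissibleP/(_ i) an := au n.
  apply: time_aeS2 an (toL2E Lf) => t ut /(_ I) ft _.
  rewrite lee_fin ft -(real_normK (num_real (f t - _))) -(real_normK (num_real (w i t - _))).
  by rewrite ler_sqr ?nnegrE//; exact: clip_dist.
have uf : u n i @[n --> \oo] --> toL2 lt f.
  apply/cvgrPdist_lt => e e0; have /cvgrPdist_lt/(_ e e0) := uw i.
  by apply: filterS => n; exact: le_lt_trans (le n).
have wE : w i = toL2 lt f by apply: (cvg_unique _ (uw i) uf); exact: norm_hausdorff.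
by rewrite wE; apply: time_aeS (toL2E Lf) => t /(_ I) ->; exact: clip_le.
Qed.

End admissible_controls.

(** * Operators given by a continuous kernel *)

Section duhamel.
Variables (R : realType) (H : completeNormedModType R) (dot : H -> H -> R).
Hypothesis ip : inner_product dot.
Variables (tF : R) (m : nat) (bnd : 'I_m -> R).
Hypothesis tF_ge0 : 0 <= tF.
Hypothesis bnd_ge0 : forall i, 0 <= bnd i.
Notation mR := (measurableTypeR R).
Notation lambda := (@lebesgue_measure R).
Notation lt := (lebesgue_time tF).
Notation adm := (@admissible R tF m bnd).
Implicit Types (u w : control tF m) (v : 'I_m -> R -> H).

(** Both control-to-state operators have this form, with kernels S_A(t_F - t) beta_i and S_K(t_F -
    t) P_K beta_i. *)
Definition duhamel v u : H :=
  bochner `[0, tF] (fun t => \sum_i u i t *: v i t).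

(** Tested against [psi], [duhamel] becomes a sum of L_2(0, t_F) products of the controls with these
    functions; Cauchy-Schwarz in time then yields the estimates. *)
Definition pairing (f : R -> H) (psi : H) : L2 lt :=
  toL2 lt (fun t => dot (f t) psi).

Lemma continuous_itv_bound (f : R -> H) : continuous f ->
  exists2 C, 0 <= C & forall t, 0 <= t <= tF -> `|f t| <= C.
Proof.
move=> cf; have cf' : {within `[0, tF], continuous f} by exact: continuous_subspaceT.
have := compact_bounded (continuous_compact cf' (@segment_compact R 0 tF)).
move=> [M [_ /(_ (`|M| + 1))]] h; exists (`|M| + 1); first by rewrite addr_ge0.
move=> t tT; apply: h; first by rewrite (le_lt_trans (ler_norm M))// ltrDl.
by exists t => //=; rewrite in_itv.
Qed.

Lemma pairing_bound (f : R -> H) psi C : continuous f -> 0 <= C ->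
  (forall t, 0 <= t <= tF -> `|f t| <= C) ->
  (fun t => dot (f t) psi) \in Lfun lt 2%:E /\
  `|pairing f psi| <= C * `|psi| * Num.sqrt tF.
Proof.
move=> cf C0 fC; apply: bounded_time_L2 => //.
- by apply: continuous_measurable_fun => t; apply: (cvg_dotl ip); exact: cf.
- by rewrite mulr_ge0.
- apply/lebesgue_time_ae; apply: aeW => t; rewrite in_itv/= => tT.
  by apply: le_trans (cauchy_schwarz ip _ _) _; rewrite ler_wpM2r// fC.
Qed.

Lemma pairing_Lfun (f : R -> H) psi : continuous f ->
  (fun t => dot (f t) psi) \in Lfun lt 2%:E.
Proof.
by move=> cf; have [C C0 fC] := continuous_itv_bound cf; exact: (pairing_bound psi cf C0 fC).1.
Qed.

Lemma pairingB (f g : R -> H) psi : continuous f -> continuous g ->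
  pairing (fun t => f t - g t) psi = pairing f psi - pairing g psi.
Proof.
move=> cf cg; have cfg : continuous (fun t => f t - g t).
  by move=> t; apply: cvgB; [exact: cf|exact: cg].
apply: L2_eqP; apply: filterS (filterI (filterI (toL2E (pairing_Lfun psi cf))
  (toL2E (pairing_Lfun psi cg))) (filterI (toL2E (pairing_Lfun psi cfg))
  (L2_BE (pairing f psi) (pairing g psi)))) => t [[/(_ I) e1 /(_ I) e2] [/(_ I) e3 /(_ I) e4]] _.
exact: (etrans e3 (etrans (dotBl ip _ _ _) (esym (etrans e4 (congr2 (fun a b => a - b) e1 e2))))).
Qed.

Lemma duhamel_dot v u psi : (forall i, continuous (v i)) -> adm u ->
  dot (duhamel v u) psi = \sum_i L2dot (u i) (pairing (v i) psi).
Proof.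
move=> cv au.
have mu i : measurable_fun `[0, tF] (u i : mR -> R).
  by apply: measurable_funTS; exact: (L2_measurable (u i)).
have ub i : {ae lambda, forall t, `[0, tF]%classic t -> `|u i t| <= bnd i}.
  have /admissibleP/(_ i)/lebesgue_time_ae := au; exact.
have cv' i : {within `[0, tF], continuous (v i)} by exact: continuous_subspaceT.
have [_ E] := bochner_control ip mu bnd_ge0 ub cv' (dot_functional ip psi).
rewrite /duhamel E; apply: eq_bigr => i _.
rewrite L2dot_toL2; last exact: pairing_Lfun.
rewrite /Rintegral lebesgue_time_integral//; apply/measurable_EFinP; apply: measurable_funM.
  exact: L2_measurable.
exact: Lfun2_measurable (pairing_Lfun psi (cv i)).
Qed.

(** Midpoints remain admissible, so all three integrals are known to exist and can be compared after
    pairing. *)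
Lemma duhamel_midpoint v u w : (forall i, continuous (v i)) -> adm u -> adm w ->
  duhamel v (midpoint u w) = 2^-1 *: (duhamel v u + duhamel v w).
Proof.
move=> cv au aw; apply: (dot_ext ip) => psi.
apply: etrans (duhamel_dot psi cv (admissible_midpoint au aw)) _.
apply: etrans (esym (dotZl ip 2^-1 (duhamel v u + duhamel v w) psi)).
apply: etrans (congr1 _ (esym (dotDl ip (duhamel v u) (duhamel v w) psi))).
apply: etrans (congr1 _ (congr2 +%R (esym (duhamel_dot psi cv au)) (esym (duhamel_dot psi cv aw)))).
rewrite -big_split/= mulr_sumr; apply: eq_bigr => i _.
have ipt := L2dot_inner_product lt.
exact: (etrans (dotZl ipt _ _ _) (congr1 _ (dotDl ipt _ _ _))).
Qed.

Lemma duhamel_lipschitz v : (forall i, continuous (v i)) ->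
  exists2 k, 0 <= k & forall u w, adm u -> adm w ->
  `|duhamel v u - duhamel v w| <= k * \sum_i `|u i - w i|.
Proof.
move=> cv; have /choice[C CP] i : exists C, 0 <= C /\ forall t, 0 <= t <= tF -> `|v i t| <= C.
  by have [C] := continuous_itv_bound (cv i); exists C.
have C0 : 0 <= \sum_i C i by apply: sumr_ge0 => i _; exact: (CP i).1.
have ipt := L2dot_inner_product lt.
exists ((\sum_i C i) * Num.sqrt tF) => [|u w au aw]; first by rewrite mulr_ge0 ?sqrtr_ge0.
apply: (norm_le_dot ip) => [|psi].
  by rewrite !mulr_ge0 ?sqrtr_ge0// sumr_ge0.
have -> := dotBl ip (duhamel v u) (duhamel v w) psi.
have -> := congr2 (fun a b => a - b) (duhamel_dot psi cv au) (duhamel_dot psi cv aw).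
rewrite -sumrB mulr_sumr mulr_suml; apply: ler_sum => i _.
have -> := esym (dotBl ipt (u i) (w i) (pairing (v i) psi)).
apply: le_trans (dot_le ipt _ _) _.
have [_ h] := pairing_bound psi (cv i) (CP i).1 (CP i).2.
apply: le_trans (ler_wpM2l (normr_ge0 _) h) _.
have : C i <= \sum_i C i by rewrite (bigD1 i)//= lerDl sumr_ge0// => j _; exact: (CP j).1.
move: (normr_ge0 (u i - w i)) (normr_ge0 psi) (sqrtr_ge0 tF).
set p := `|u i - w i|; set q := `|psi|; set r := Num.sqrt tF; set K := \sum_i C i.
move: p q r K (C i) => p q r K c p0 q0 r0 cK.
rewrite (_ : K * r * p * q = p * (K * q * r)); last by ring.
by rewrite !ler_wpM2l ?ler_wpM2r.
Qed.

(** One factor sqrt(t_F) comes from the norm of an admissible control, the other from the pairing of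
    [v i - w i]; together they make [tF]. *)
Lemma duhamel_close v (w : 'I_m -> R -> H) u e : (forall i, continuous (v i)) -> (forall i, continuous (w i)) ->
  adm u -> 0 <= e -> (forall i t, 0 <= t <= tF -> `|v i t - w i t| <= e) ->
  `|duhamel v u - duhamel w u| <= (\sum_i bnd i) * tF * e.
Proof.
move=> cv cw au e0 vw; have ipt := L2dot_inner_product lt.
have b0 : 0 <= \sum_i bnd i by apply: sumr_ge0.
apply: (norm_le_dot ip) => [|psi]; first by rewrite !mulr_ge0.
have -> := dotBl ip (duhamel v u) (duhamel w u) psi.
have -> := congr2 (fun a b => a - b) (duhamel_dot psi cv au) (duhamel_dot psi cw au).
rewrite -sumrB !mulr_suml; apply: ler_sum => i _.
have -> := esym (dotBr ipt (pairing (v i) psi) (pairing (w i) psi) (u i)).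
have <- := pairingB psi (cv i) (cw i). apply: le_trans (dot_le ipt _ _) _.
have cvw : continuous (fun t => v i t - w i t).
  by move=> t; apply: cvgB; [exact: cv|exact: cw].
have [_ h] := pairing_bound psi cvw e0 (vw i).
apply: le_trans (ler_pM (normr_ge0 _) (normr_ge0 _) (admissible_norm tF_ge0 bnd_ge0 i au) h) _.
rewrite -{3}(sqr_sqrtr tF_ge0); set s := Num.sqrt tF; clearbody s.
by rewrite le_eqVlt; apply/orP; left; apply/eqP; ring.
Qed.

Lemma duhamel_converges v (vK : nat -> 'I_m -> R -> H) :
  (forall i, continuous (v i)) ->
  (forall K i, (0 < K)%N -> continuous (vK K i)) ->
  (forall i e, 0 < e -> exists N, forall K t, (0 < K)%N -> (N <= K)%N ->
    0 <= t <= tF -> `|v i t - vK K i t| <= e) ->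
  forall e, 0 < e -> exists N, forall K u, (0 < K)%N -> (N <= K)%N -> adm u ->
    `|duhamel v u - duhamel (vK K) u| <= e.
Proof.
move=> cv cvK vvK e e0; pose q := (\sum_i bnd i) * tF.
have q0 : 0 <= q by apply: mulr_ge0 => //; exact: sumr_ge0.
have e20 : 0 < e / (q + 1) by rewrite divr_gt0// ltr_wpDl.
have /choice[N NP] i := vvK i _ e20.
exists (\max_i N i) => K u K0 NK au.
have vc i t : 0 <= t <= tF -> `|v i t - vK K i t| <= e / (q + 1).
  by apply: (NP i K t K0); apply: leq_trans (leq_bigmax i) NK.
have := duhamel_close cv (fun i => cvK K i K0) au (ltW e20) vc.
move=> /le_trans; apply; rewrite -/q mulrCA ler_piMr ?(ltW e0)//.
by rewrite ler_pdivrMr ?ltr_wpDl// mul1r lerDl.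
Qed.

End duhamel.

(** * The tracking functional *)

Section tracking.
Variables (R : realType) (H : completeNormedModType R) (dot : H -> H -> R).
Hypothesis ip : inner_product dot.
Variables (tF : R) (m : nat) (bnd : 'I_m -> R).
Hypothesis tF_ge0 : 0 <= tF.
Hypothesis bnd_ge0 : forall i, 0 <= bnd i.
Variables (theta : H) (rho : R).
Hypothesis rho_gt0 : 0 < rho.
Notation lt := (lebesgue_time tF).
Notation adm := (@admissible R tF m bnd).
Implicit Types (u w : control tF m) (T : control tF m -> H).

Definition tracking T u : R :=
  `|T u - theta| ^+ 2 + rho * control_norm u ^+ 2.

Definition midpoint_preserving T := forall u w, adm u -> adm w ->
  T (midpoint u w) = 2^-1 *: (T u + T w).

Definition control_lipschitz T := exists2 k, 0 <= k & forall u w, adm u ->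
  adm w -> `|T u - T w| <= k * \sum_i `|u i - w i|.

Lemma control_normE u : control_norm u ^+ 2 = \sum_i `|u i| ^+ 2.
Proof. by rewrite sqr_sqrtr// sumr_ge0// => i _; exact: sqr_ge0. Qed.

Lemma norm_le_control_norm u i : `|u i| <= control_norm u.
Proof.
rewrite -ler_sqr ?nnegrE ?sqrtr_ge0// control_normE (bigD1 i)//= lerDl.
by rewrite sumr_ge0// => j _; exact: sqr_ge0.
Qed.

Lemma tracking_ge0 T u : 0 <= tracking T u.
Proof. by rewrite addr_ge0 ?sqr_ge0// mulr_ge0 ?sqr_ge0// ltW. Qed.

Lemma norm_midpoint (V : normedModType R) (f : V -> V -> R) (x y : V) :
  inner_product f ->
  `|2^-1 *: (x + y)| ^+ 2 = 2^-1 * (`|x| ^+ 2 + `|y| ^+ 2) - 4^-1 * `|x - y| ^+ 2.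
Proof.
move=> ipf; rewrite normrZ exprMn (normD_sqr ipf) (normB_sqr ipf) gtr0_norm ?invr_gt0//.
by field.
Qed.

Lemma tracking_midpoint T u w : midpoint_preserving T -> adm u -> adm w ->
  rho / 4 * control_norm (fun i => u i - w i) ^+ 2 <=
  (tracking T u + tracking T w) / 2 - tracking T (midpoint u w).
Proof.
move=> Tm au aw; rewrite /tracking (Tm _ _ au aw).
have -> : 2^-1 *: (T u + T w) - theta = 2^-1 *: ((T u - theta) + (T w - theta)).
  rewrite addrACA [in RHS]scalerDr; congr (_ + _); rewrite -opprD scalerN -[theta in RHS]scale1r.
  by rewrite -scalerDl scalerA (_ : 2^-1 * _ = 1) ?scale1r//; field.
rewrite (norm_midpoint _ _ ip).
have -> : control_norm (midpoint u w) ^+ 2 =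
    2^-1 * (control_norm u ^+ 2 + control_norm w ^+ 2) -
    4^-1 * control_norm (fun i => u i - w i) ^+ 2.
  rewrite !control_normE -big_split/= !mulr_sumr -sumrB; apply: eq_bigr => i _.
  exact: norm_midpoint (L2dot_inner_product lt).
(* The parallelogram law also produces this state term, which is dropped. *)
have := sqr_ge0 `|T u - theta - (T w - theta)|.
move: (control_norm _ ^+ 2) (control_norm _ ^+ 2) (control_norm _ ^+ 2) => c1 c2 c3 h.
lra.
Qed.

Lemma tracking_unique T u : midpoint_preserving T -> adm u ->
  (forall w, adm w -> tracking T u <= tracking T w) ->
  unique_minimizer (tracking T) adm u.
Proof.
move=> Tm au uP; split=> // w aw wu.
have h := tracking_midpoint Tm au aw.
have := uP _ (admissible_midpoint au aw); have : 0 < rho / 4 * control_norm (fun i => u i - w i) ^+ 2.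
  rewrite mulr_gt0 ?divr_gt0// lt_def sqr_ge0 andbT; apply/eqP => /eqP.
  rewrite sqrf_eq0 => /eqP c0; apply: wu; apply/funext => i.
  have := norm_le_control_norm (fun i => u i - w i) i.
  by rewrite c0 normr_le0 subr_eq0 => /eqP ->.
by have := uP _ aw; lra.
Qed.

Lemma control_lipschitz_cvg T (u : nat -> control tF m) w : control_lipschitz T ->
  (forall n, adm (u n)) -> adm w -> (forall i, u n i @[n --> \oo] --> w i) ->
  T (u n) @[n --> \oo] --> T w.
Proof.
move=> [k k0 kP] au aw uw; apply/cvgrPdist_le => e e0.
have h : k * \sum_i `|w i - u n i| @[n --> \oo] --> (0 : R).
  rewrite -[X in _ --> X](mulr0 k); apply: cvgMr.
  have z : \sum_(i < m) (0 : R) = 0 by rewrite big1.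
  rewrite -[X in _ --> X]z.
  apply: cvg_big => [|i _]; first exact: add_continuous.
  rewrite -[X in _ --> X](@normr0 _ (L2 lt)) -[X in `|X|](subrr (w i)); apply: cvg_norm.
  by apply: cvgB; [exact: cvg_cst|exact: uw].
move/cvgrPdist_le : h => /(_ _ e0); apply: filterS => n; rewrite sub0r normrN => h.
by apply: le_trans (kP _ _ aw (au n)) (le_trans (ler_norm _) h).
Qed.

Lemma tracking_cvg T (u : nat -> control tF m) w : control_lipschitz T ->
  (forall n, adm (u n)) -> adm w -> (forall i, u n i @[n --> \oo] --> w i) ->
  tracking T (u n) @[n --> \oo] --> tracking T w.
Proof.
move=> Tl au aw uw; rewrite /tracking.
have hT := control_lipschitz_cvg Tl au aw uw.
apply: cvgD.
  by apply: (@cvgM _ _ _ _ (fun n => `|T (u n) - theta|)); apply: cvg_norm; apply: cvgB => //; exact: cvg_cst.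
apply: cvgMr; rewrite control_normE.
under eq_fun do rewrite control_normE.
apply: cvg_big => [|i _]; first exact: add_continuous.
by apply: (@cvgM _ _ _ _ (fun n => `|u n i|)); apply: cvg_norm; exact: uw.
Qed.

(* A minimizing sequence is Cauchy by the midpoint inequality. *)
Lemma tracking_minimizer T : midpoint_preserving T -> control_lipschitz T ->
  exists u, unique_minimizer (tracking T) adm u.
Proof.
move=> Tm Tl; pose d := inf (tracking T @` adm).
have hi : has_inf (tracking T @` adm).
  split; first by exists (tracking T (fun=> 0)); exists (fun=> 0) => //; exact: admissible0.
  by exists 0 => _ [u _ <-]; exact: tracking_ge0.
have dP u : adm u -> d <= tracking T u.
  by move=> au; apply: ge_inf; [exact: hi.2|exists u].
have q0 n : 0 < (16^-1 : R) ^+ n by rewrite exprn_gt0.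
(* With this excess over the infimum, the midpoint inequality bounds the squared distance of
   successive controls by 16^-n. *)
have e0 n : 0 < rho / 4 * 16^-1 ^+ n by rewrite mulr_gt0 ?divr_gt0.
have /choice[u uP] n : exists u, adm u /\ tracking T u < d + rho / 4 * 16^-1 ^+ n.
  by have [_ [u au <-] ud] := inf_adherent (e0 n) hi; exists u.
have st n i : `|u n.+1 i - u n i| <= 1 * 4^-1 ^+ n.
  rewrite mul1r; apply: le_trans (norm_le_control_norm (fun i => u n.+1 i - u n i) i) _.
  rewrite -ler_sqr ?nnegrE ?sqrtr_ge0 ?exprn_ge0//.
  have -> : ((4^-1 : R) ^+ n) ^+ 2 = 16^-1 ^+ n.
    by rewrite exprAC; congr (_ ^+ n); field.
  rewrite -(ler_pM2l (divr_gt0 rho_gt0 (ltr0Sn R 3))).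
  have := tracking_midpoint Tm (uP n.+1).1 (uP n).1.
  have := dP _ (admissible_midpoint (uP n.+1).1 (uP n).1).
  have := (uP n.+1).2; have := (uP n).2; rewrite exprS.
  have := e0 n; set e := 16^-1 ^+ n.
  rewrite [rho / 4 * (_ * e)]mulrCA; lra.
have uw i : cvgn (fun n => u n i) by apply: cvg_geometric_steps (fun n => st n i); lra.
pose w : control tF m := fun i => limn (fun n => u n i).
have au n : adm (u n) by exact: (uP n).1.
have aw : adm w by exact: (admissible_closed tF_ge0 bnd_ge0 au uw).
exists w; apply: tracking_unique => // v av; apply: le_trans (dP _ av).
have h1 := tracking_cvg Tl au aw uw.
have h2 : d + rho / 4 * 16^-1 ^+ n @[n --> \oo] --> d.
  rewrite -[X in _ --> X]addr0; apply: cvgD; first exact: cvg_cst.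
  rewrite -[X in _ --> X](mulr0 (rho / 4)); apply: cvgMr; apply: cvg_expr.
  by rewrite gtr0_norm ?invr_gt0//; lra.
apply: (ler_cvg_to h1 h2); apply: nearW => n; exact/ltW/(uP n).2.
Qed.

(** Two applications of the bound and minimality of [u'] give J(u') <= J(u) + 2D, while J at the
    midpoint is at least J(u); the midpoint inequality then leaves half of 2D. *)
Lemma tracking_stability T T' u u' D : midpoint_preserving T ->
  unique_minimizer (tracking T) adm u -> unique_minimizer (tracking T') adm u' ->
  (forall w, adm w -> `|tracking T w - tracking T' w| <= D) ->
  rho / 4 * control_norm (fun i => u' i - u i) ^+ 2 <= D.
Proof.
move=> Tm [au uP] [au' uP'] TT.
have min w : adm w -> tracking T u <= tracking T w.
  by have [->//|/eqP wu aw] := eqVneq w u; exact/ltW/uP.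
have min' w : adm w -> tracking T' u' <= tracking T' w.
  by have [->//|/eqP wu aw] := eqVneq w u'; exact/ltW/uP'.
have := tracking_midpoint Tm au' au.
have := min _ (admissible_midpoint au' au); have := min' _ au.
have := TT _ au; have := TT _ au'; rewrite !ler_norml => /andP[h1 h2] /andP[h3 h4].
lra.
Qed.

(** Factor a^2 - b^2 with a, b the two distances to [theta]: |a - b| <= e and a <= M + |theta|,
    while e <= 1 gives b <= a + 1. *)
Lemma tracking_close T T' u e M : 0 <= e <= 1 -> `|T u| <= M -> `|T u - T' u| <= e ->
  `|tracking T u - tracking T' u| <= e * (2 * (M + `|theta|) + 1).
Proof.
move=> /andP[e0 e1] TM TT; rewrite /tracking.
rewrite (_ : _ + _ - _ = `|T u - theta| ^+ 2 - `|T' u - theta| ^+ 2); last by ring.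
have := ler_normB (T u) theta; have a0 := normr_ge0 (T u - theta).
have b0 := normr_ge0 (T' u - theta).
have : `| `|T u - theta| - `|T' u - theta| | <= e.
  apply: le_trans (ler_dist_dist _ _) _.
  by rewrite opprB addrA subrK.
rewrite ler_norml => /andP[h1 h2] h3; rewrite ler_norml subr_sqr.
by apply/andP; split; nra.
Qed.

Lemma control_lipschitz_bounded T : control_lipschitz T ->
  exists2 M, 0 <= M & forall u, adm u -> `|T u| <= M.
Proof.
move=> [k k0 kP]; pose z : control tF m := fun=> 0.
have az : adm z by exact: admissible0.
exists (`|T z| + k * \sum_i bnd i * Num.sqrt tF).
  rewrite addr_ge0// mulr_ge0// sumr_ge0// => i _.
  by rewrite mulr_ge0// sqrtr_ge0.
move=> u au; rewrite -(subrKC (T z) (T u)); apply: le_trans (ler_normD _ _) _.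
rewrite lerD2l; apply: le_trans (kP _ _ au az) _; rewrite ler_wpM2l//.
by apply: ler_sum => i _; rewrite subr0; exact: (admissible_norm tF_ge0 bnd_ge0).
Qed.

Lemma tracking_minimizers_cvg T (TK : nat -> control tF m -> H) u
    (uK : nat -> control tF m) : midpoint_preserving T -> control_lipschitz T ->
  (forall e, 0 < e -> exists N, forall K w, (0 < K)%N -> (N <= K)%N -> adm w ->
    `|T w - TK K w| <= e) ->
  unique_minimizer (tracking T) adm u ->
  (forall K, (0 < K)%N -> unique_minimizer (tracking (TK K)) adm (uK K)) ->
  control_norm (fun i => uK K i - u i) @[K --> \oo] --> 0.
Proof.
move=> Tm Tl TTK uP uKP; have [M M0 TM] := control_lipschitz_bounded Tl.
pose L := 2 * (M + `|theta|) + 1.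
have L0 : 0 < L by rewrite /L ltr_wpDl// mulr_ge0// addr_ge0.
apply/cvgrPdist_le => e e0.
pose e1 := Num.min 1 (rho / 4 * e ^+ 2 / L).
have e10 : 0 < e1 by rewrite /e1 lt_min ltr01/= divr_gt0// mulr_gt0 ?divr_gt0 ?exprn_gt0.
(* The successor forces [0 < K], as the closeness hypothesis requires. *)
have [N NP] := TTK _ e10; exists N.+1 => // K /= NK.
have K0 : (0 < K)%N by exact: leq_trans NK.
rewrite sub0r normrN ger0_norm ?sqrtr_ge0//.
have JJ w : adm w -> `|tracking T w - tracking (TK K) w| <= e1 * L.
  move=> aw; apply: tracking_close; [|exact: TM|exact: (NP _ _ K0 (ltnW NK) aw)].
  by rewrite (ltW e10)/= /e1 ge_min lexx.
have := tracking_stability Tm uP (uKP K K0) JJ.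
have e1L : e1 * L <= rho / 4 * e ^+ 2 by rewrite -ler_pdivlMr// /e1 ge_min lexx orbT.
move=> /le_trans/(_ e1L); rewrite ler_pM2l ?divr_gt0//.
by rewrite ler_sqr ?nnegrE ?sqrtr_ge0// ltW.
Qed.

End tracking.

(** * Transfer to the concrete operators *)

Lemma eq_bochner (R : realType) (V : normedModType R) (D : set (measurableTypeR R))
    (F G : R -> V) : measurable D -> (forall t, D t -> F t = G t) -> bochner D F = bochner D G.
Proof.
move=> mD FG; congr xget; apply/funext => z; apply/propext.
have is_bochner_ext (F' G' : R -> V) : (forall t, D t -> F' t = G' t) ->
    is_bochner D F' z -> is_bochner D G' z.
  move=> FG' [s [si sI s0 sz]]; exists s.
  have E n t : t \in D -> `|F' t - simple_eval (s n) t|%:E = `|G' t - simple_eval (s n) t|%:E.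
    by rewrite inE => /FG' ->.
  split => //.
    by move=> n; apply: eq_integrable (sI n) => // t tD; exact: E.
  rewrite (_ : (fun n => _) = fun n => (\int[@lebesgue_measure R]_(t in D)
    `|F' t - simple_eval (s n) t|%:E)%E)//.
  by apply/funext => n; apply: eq_integral => t tD; rewrite E.
by split; apply: is_bochner_ext => // t Dt; rewrite FG.
Qed.

Lemma has_deriv_continuous (R : realType) (H : normedModType R) (f g : R -> H) :
  (forall t, has_deriv f t (g t)) -> continuous f.
Proof.
move=> fg t; apply/cvgrPdist_lt => e e0.
have /cvgrPdist_lt/(_ _ e0)/nbhs_ballP[r /= r0 rP] := @has_deriv_cvg _ _ _ _ _ (fg t).
apply/nbhs_ballP; exists r => //= s; rewrite /ball/= => ts.
have [->|st] := eqVneq s t; first by rewrite subrr normr0.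
have := rP (s - t); rewrite [t + _]addrC subrK; apply; last by rewrite subr_eq0.
by rewrite /ball/= sub0r normrN distrC.
Qed.

Lemma linear_on_sum (R : realType) (H : lmodType R) (X : set H) (f : H -> H)
    (m : nat) (c : 'I_m -> R) (x : 'I_m -> H) : lin_subspace X ->
  (forall a y z, X y -> X z -> f (a *: y + z) = a *: f y + f z) ->
  (forall i, X (x i)) -> f (\sum_i c i *: x i) = \sum_i c i *: f (x i).
Proof.
move=> sX lf Xx; have X0 := lin_subspace0 sX.
have f0 : f 0 = 0.
  have := lf 1 _ _ X0 X0.
  by rewrite !scale1r addr0 => /eqP; rewrite -subr_eq0 opprD addNKr oppr_eq0 => /eqP.
have h (r : seq 'I_m) : X (\sum_(i <- r) c i *: x i).
  by apply: lin_subspace_sum => // i _; exact: lin_subspaceZ.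
elim: (index_enum _) => [|i r IH]; first by rewrite !big_nil.
by rewrite !big_cons lf ?IH.
Qed.

(** Riesz representation on a finite-dimensional subspace: it shows that the sets from which
    [galerkin_op] and [orth_proj] choose are inhabited. *)
Lemma onb_riesz (R : realType) (H : normedModType R) (dot : H -> H -> R) (X : set H)
    (s : seq H) (l : H -> R) : inner_product dot -> lin_subspace X -> is_onb dot X s ->
  (forall a x y, X x -> X y -> l (a *: x + y) = a * l x + l y) ->
  exists w, X w /\ forall x, X x -> dot w x = l x.
Proof.
move=> ip sX [sXs _ sE] ll; have X0 := lin_subspace0 sX.
have l0 : l 0 = 0.
  have := ll 1 _ _ X0 X0.
  by rewrite !scale1r mul1r addr0 => /eqP; rewrite -subr_eq0 opprD addNKr oppr_eq0 => /eqP.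
exists (\sum_(e <- s) l e *: e); split.
  by rewrite big_seq; apply: lin_subspace_sum => // e es; apply: lin_subspaceZ => //; exact: sXs.
move=> x Xx; rewrite (dot_suml ip) [in RHS](sE _ Xx).
have Xs (r : seq H) : {subset r <= s} -> X (\sum_(e <- r) dot x e *: e).
  move=> rs; rewrite big_seq; apply: lin_subspace_sum => // e er.
  by apply: lin_subspaceZ => //; apply: sXs; exact: rs.
have : {subset s <= s} by [].
elim: {1 3 4}s => [|e r IH] rs; first by rewrite !big_nil.
have re : {subset r <= s} by move=> y yr; apply: rs; rewrite inE yr orbT.
rewrite !big_cons ll ?IH//; [|by apply: sXs; apply: rs; rewrite mem_head|exact: Xs].
by rewrite (dotZl ip) (dotC ip) mulrC.
Qed.

Section discretization.
Variables (R : realType) (d m : nat) (Omega : set 'rV[R]_d) (oOmega : open Omega).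
Hypothesis bOmega : bounded_set Omega.
Variables (tF : R) (a : 'I_d -> 'I_d -> Linfty oOmega) (b : 'I_d -> Linfty oOmega).
Variable c : Linfty oOmega.
Notation mu := (lebesgue_on oOmega).
Notation L2O := (L2 mu).
Notation dot := (@L2dot _ _ R mu).
Notation V := (@H10 R d Omega oOmega).
Notation W := (@Wgrad R d Omega oOmega).
Notation B := (elliptic_form a b c).
Notation gB := (gform a b c).
Hypothesis gardingB : garding B.
Variable SA : R -> L2O -> L2O.
Hypothesis genSA : generates (opA B) SA.
Variable X : nat -> set L2O.
Hypothesis X_sub : forall K, (0 < K)%N -> findim_subspace (X K) /\ X K `<=` V.
Hypothesis X_dense : forall psi, V psi -> exists psiK : nat -> L2O,
  (forall K, (0 < K)%N -> X K (psiK K)) /\ H1norm (psi - psiK K) @[K --> \oo] --> (0 : R).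

Let ip := L2dot_inner_product mu.
Let SC0 : C0_semigroup SA. Proof. exact: genSA.1. Qed.
Let G K := galerkin_op B (X K).
Let P K := orth_proj (X K).

Let VW : V `<=` W. Proof. by move=> u; exact: H10_Wgrad. Qed.

Let XS K : (0 < K)%N -> lin_subspace (X K).
Proof. by move=> /X_sub[[n [e ->]] _]; exact: lin_subspace_span. Qed.

Let XW K : (0 < K)%N -> X K `<=` W.
Proof. by move=> /X_sub[_ XV] u /XV; exact: VW. Qed.

Let onbX K : (0 < K)%N -> exists s, is_onb dot (X K) s.
Proof. exact: (galerkin_onb ip (V := V) X_sub). Qed.

(** The abstract estimates ask for a form bilinear on [Wgrad], hence [gform]; on [X K], inside
    [H10], it agrees with the elliptic form. *)
Lemma galerkin_opP K x : (0 < K)%N -> X K x ->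
  X K (G K x) /\ forall y, X K y -> dot (G K x) y = - gB x y.
Proof.
move=> K0 Xx; have [s onb] := onbX K0; have [_ XV] := X_sub K0.
have [|w [Xw wP]] := onb_riesz (l := fun y => - gB x y) ip (XS K0) onb.
  move=> k y z Xy Xz; have [Wx [Wy Wz]] := (XW K0 Xx, (XW K0 Xy, XW K0 Xz)).
  by rewrite mulrN -opprD; congr (- _); exact: (gform_bilinear a b c bOmega).2.
have h : exists w, [set w | X K w /\ forall psi, X K psi -> L2dot w psi = - B x psi] w.
  exists w; split => // y Xy; rewrite wP//; congr (- _); apply: esym.
  by apply: elliptic_formE => //; exact: XV.
have [h1 h2] := xgetPex 0 h; split => // y Xy.
rewrite [LHS]h2//; congr (- _); apply: elliptic_formE => //; exact: XV.
Qed.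

Lemma orth_projP K x : (0 < K)%N ->
  X K (P K x) /\ forall y, X K y -> dot (x - P K x) y = 0.
Proof.
move=> K0; have [s onb] := onbX K0.
have [|w [Xw wP]] := onb_riesz (l := dot x) ip (XS K0) onb.
  by move=> k y z _ _; rewrite (dotDr ip) (dotZr ip).
apply: (@xgetPex _ 0 [set w | X K w /\ forall psi, X K psi -> L2dot (x - w) psi = 0]).
by exists w; split => // y Xy; rewrite (dotBl ip) wP// subrr.
Qed.

Let gengB x y : (V x /\ forall psi, V psi -> dot (- y) psi = gB x psi) <-> generator SA x y.
Proof.
split=> [[Vx h]|/(genSA.2 x y)[Vx h]].
  apply/(genSA.2 x y); split=> // psi Vpsi.
  exact: (etrans (h _ Vpsi) (esym (elliptic_formE a b c bOmega Vx Vpsi))).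
split=> // psi Vpsi.
exact: (etrans (h _ Vpsi) (elliptic_formE a b c bOmega Vx Vpsi)).
Qed.

Let vdens x : V x -> exists xK : nat -> L2O, (forall K, (0 < K)%N -> X K (xK K)) /\
  @vdot R d Omega oOmega (x - xK K) (x - xK K) @[K --> \oo] --> (0 : R).
Proof.
move=> Vx; have [xK [XxK h]] := X_dense Vx; exists xK; split=> //.
have h2 : H1norm (x - xK K) ^+ 2 @[K --> \oo] --> (0 : R).
  by rewrite -[X in _ --> X](mulr0 (0 : R)); exact: (cvgM h h).
apply: (@squeeze_cvgr _ _ _ _ (fun=> 0) (fun K => H1norm (x - xK K) ^+ 2)) => //; last exact: cvg_cst.
(* The index 0 is left out: the subspaces are indexed from 1. *)
exists 1 => // K /= K0; apply/andP; split.
  by apply: le_trans (norm_le_vdotxx _); exact: sqr_ge0.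
apply: (vdot_le_H1norm bOmega).
exact: (lin_subspaceB (Wgrad_subspace oOmega bOmega) (VW Vx) (XW K0 (XxK K K0))).
Qed.

Lemma galerkin_semigroup_converges x e : 0 < e -> exists N, forall K t,
  (0 < K)%N -> (N <= K)%N -> 0 <= t <= tF ->
  `|SA t x - galerkin_semigroup B (X K) t (P K x)| <= e.
Proof.
move=> e0; have [kappa [kappa0 [k0 k1 gard]]] := gardingB.
have [M M0 BM] := gform_bound a b c.
have gard' u : V u -> kappa0 * @vdot R d Omega oOmega u u <= gB u u + kappa * `|u| ^+ 2.
  move=> Vu; have := gard u Vu.
  by rewrite (H1norm_vdot bOmega Vu) (elliptic_formE a b c bOmega Vu Vu).
exact: (galerkin_converges ip (Wgrad_subspace oOmega bOmega) (vdot_bilinear oOmega bOmega)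
  (fun u v _ _ => vdotC u v) (fun u _ => norm_le_vdotxx u) (gform_bilinear a b c bOmega) M0
  (fun u v _ _ => BM u v) VW k0 k1 gard' SC0 gengB X_sub vdens galerkin_opP orth_projP x tF e0).
Qed.

Variable beta : 'I_m -> L2O.

(** The clamped orbit keeps this kernel continuous beyond [tF], where the time [tF - t] is
    negative. *)
Definition semigroup_kernel i t := C0_orbit SA (beta i) (tF - t).

Definition galerkin_kernel K i t :=
  galerkin_semigroup B (X K) (tF - t) (P K (beta i)).

Lemma galerkin_kernel_converges i e : 0 < e -> exists N, forall K t,
  (0 < K)%N -> (N <= K)%N -> 0 <= t <= tF ->
  `|semigroup_kernel i t - galerkin_kernel K i t| <= e.
Proof.
move=> e0; have [N NP] := galerkin_semigroup_converges (beta i) e0.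
exists N => K t K0 NK /andP[t0 tT].
rewrite /semigroup_kernel C0_orbitE ?subr_ge0//; apply: NP => //.
by rewrite subr_ge0 tT/= gerBl.
Qed.

Lemma semigroup_kernel_continuous i : continuous (semigroup_kernel i).
Proof.
move=> t; apply: (@continuous_comp _ _ _ (fun t => tF - t) (C0_orbit SA (beta i))).
  by apply: cvgB; [exact: cvg_cst|exact: cvg_id].
exact: (C0_orbit_continuous SC0).
Qed.

Let GX K x : (0 < K)%N -> X K x -> X K (G K x).
Proof. by move=> K0 Xx; exact: (galerkin_opP K0 Xx).1. Qed.

Let Glin K k x y : (0 < K)%N -> X K x -> X K y -> G K (k *: x + y) = k *: G K x + G K y.
Proof.
exact: (galerkin_gen_lin ip (gform_bilinear a b c bOmega) VW X_sub galerkin_opP).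
Qed.

Lemma galerkin_kernel_continuous K i : (0 < K)%N -> continuous (galerkin_kernel K i).
Proof.
move=> K0; have [s onb] := onbX K0.
move=> t; apply: (@continuous_comp _ _ _ (fun t => tF - t) (expsum (G K) ^~ (P K (beta i)))).
  by apply: cvgB; [exact: cvg_cst|exact: cvg_id].
have GXK x : X K x -> X K (G K x) by exact: GX.
have GlK k x y : X K x -> X K y -> G K (k *: x + y) = k *: G K x + G K y by exact: Glin.
have XP := (orth_projP (beta i) K0).1.
apply: (@has_deriv_continuous _ _ _ (fun r => G K (expsum (G K) r (P K (beta i))))) => r.
have hd := expsum_deriv ip (XS K0) onb GXK GlK.
exact: (hd r _ XP).
Qed.

Lemma Ttheta_duhamel (u : control tF m) : Ttheta SA beta u = duhamel semigroup_kernel u.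
Proof.
apply: eq_bochner => // t; rewrite /= in_itv/= => /andP[_ tT].
have t0 : 0 <= tF - t by rewrite subr_ge0.
have lin k x y : setT x -> setT y -> SA (tF - t) (k *: x + y) = k *: SA (tF - t) x + SA (tF - t) y.
  by move=> _ _; exact: (C0_linear SC0).
apply: (etrans (@linear_on_sum _ _ setT _ _ (fun i => u i t) beta (@lin_subspaceT _ _) lin (fun=> I))).
by apply: eq_bigr => i _; rewrite /semigroup_kernel C0_orbitE.
Qed.

Lemma TthetaK_duhamel K (u : control tF m) : (0 < K)%N ->
  TthetaK B (X K) beta u = duhamel (galerkin_kernel K) u.
Proof.
move=> K0; have [s onb] := onbX K0; apply: eq_bochner => // t _.
have XP x : X K (P K x) by exact: (orth_projP x K0).1.
have linP k x y : setT x -> setT y -> P K (k *: x + y) = k *: P K x + P K y.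
  by move=> _ _; exact: (galerkin_proj_lin ip (XS K0) (fun x => orth_projP x K0)).
have GXK z : X K z -> X K (G K z) by exact: GX.
have GlK l z w : X K z -> X K w -> G K (l *: z + w) = l *: G K z + G K w by exact: Glin.
have hl := expsum_lin ip (XS K0) onb GXK GlK.
apply: (etrans (congr1 _ (@linear_on_sum _ _ setT _ _ (fun i => u i t) beta (@lin_subspaceT _ _) linP (fun=> I)))).
exact: (@linear_on_sum _ _ (X K) (expsum (G K) (tF - t)) _ _ (fun i => P K (beta i)) (XS K0)
  (fun k x y => hl _ k x y) (fun=> XP _)).
Qed.

End discretization.

Theorem proposition5p2 (R : realType) (d m : nat) (d_gt0 : (0 < d)%N)
    (m_gt0 : (0 < m)%N)
    (Omega : set 'rV[R]_d) (oOmega : open Omega) (bOmega : bounded_set Omega) (cOmega : connected Omega)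
    (tF : R) (tF_gt0 : 0 < tF)
    (a : 'I_d -> 'I_d -> Linfty oOmega) (b : 'I_d -> Linfty oOmega) (c : Linfty oOmega)
    (a_sym : forall i j, a i j = a j i)
    (gardingB : garding (elliptic_form a b c))
    (SA : R -> L2 (lebesgue_on oOmega) -> L2 (lebesgue_on oOmega))
    (genSA : generates (opA (elliptic_form a b c)) SA)
    (beta : 'I_m -> L2 (lebesgue_on oOmega)) (fS : L2 (lebesgue_spacetime oOmega tF))
    (g theta_r : L2 (lebesgue_on oOmega))
    (rho : R) (rho_gt0 : 0 < rho)
    (bnd : 'I_m -> R) (bnd_gt0 : forall i, 0 < bnd i)
    (X : nat -> set (L2 (lebesgue_on oOmega)))
    (X_sub : forall K, (0 < K)%N ->
      findim_subspace (X K) /\ X K `<=` @H10 R d Omega oOmega)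
    (X_dense : forall psi, H10 psi ->
      exists psiK : nat -> L2 (lebesgue_on oOmega),
        (forall K, (0 < K)%N -> X K (psiK K)) /\
        H1norm (psi - psiK K) @[K --> \oo] --> 0)
    (uc : control tF m) :
  let theta_ro := theta_r - theta_free SA fS g tF in
  let J := cost (Ttheta SA beta) theta_ro rho in
  let JK K := cost (TthetaK (elliptic_form a b c) (X K) beta) theta_ro rho in
  let SuF := admissible bnd in
  unique_minimizer J SuF uc ->
  (forall K, (0 < K)%N -> exists ucK, unique_minimizer (JK K) SuF ucK) /\
  (forall ucK : nat -> control tF m,
    (forall K, (0 < K)%N -> unique_minimizer (JK K) SuF (ucK K)) ->
    control_norm (fun i => ucK K i - uc i) @[K --> \oo] --> 0).
Proof.
move=> theta_ro J JK SuF ucP.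
pose mu := lebesgue_on oOmega; have ip := L2dot_inner_product mu.
have T0 := ltW tF_gt0; have bnd0 i := ltW (bnd_gt0 i).
pose D := @duhamel R (L2 mu) tF m.
pose v := semigroup_kernel tF SA beta; pose vK := galerkin_kernel tF a b c X beta.
have cv i : continuous (v i) by exact: (@semigroup_kernel_continuous _ _ _ _ _ _ _ _ _ _ genSA).
have cvK K i : (0 < K)%N -> continuous (vK K i).
  by move=> K0; exact: (@galerkin_kernel_continuous _ _ _ _ _ bOmega _ _ _ _ _ X_sub _ _ _ K0).
(* Replacing both operators by [duhamel] reduces the theorem to the tracking functional with
   continuous kernels. *)
have TE : Ttheta SA beta = D v.
  by apply/funext => u; exact: (Ttheta_duhamel genSA beta u).
have TKE K : (0 < K)%N -> TthetaK (elliptic_form a b c) (X K) beta = D (vK K).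
  by move=> K0; apply/funext => u; exact: (TthetaK_duhamel bOmega a b c X_sub beta u K0).
have Tm w : (forall i, continuous (w i)) -> midpoint_preserving bnd (D w).
  by move=> cw u u' au au'; exact: (duhamel_midpoint ip T0 bnd0 cw au au').
have Tl w : (forall i, continuous (w i)) -> control_lipschitz bnd (D w).
  by move=> cw; exact: (duhamel_lipschitz ip T0 bnd0 cw).
rewrite /J TE in ucP.
split=> [K K0|ucK ucKP].
  rewrite /JK (TKE K K0).
  exact: (tracking_minimizer ip T0 bnd0 theta_ro rho_gt0 (Tm _ (fun i => cvK K i K0))
    (Tl _ (fun i => cvK K i K0))).
have vvK i e := @galerkin_kernel_converges _ _ _ _ _ bOmega tF _ _ _ gardingB _ genSA _
  X_sub X_dense beta i e.
have close := duhamel_converges ip T0 bnd0 cv (fun K i K0 => cvK K i K0) vvK.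
have ucKP' K : (0 < K)%N -> unique_minimizer (tracking theta_ro rho (D (vK K))) SuF (ucK K).
  by move=> K0; have := ucKP K K0; rewrite /JK (TKE K K0).
exact: (tracking_minimizers_cvg ip T0 bnd0 rho_gt0 (Tm _ cv) (Tl _ cv) close ucP ucKP').
Qed.
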